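(* Let $\omega$ be an almost monotone weight on $\mathbb N^2$, and let $\widetilde a:\mathbb H^2\to\mathbb C$ have an $\omega$-absolutely convergent Dirichlet series. (I) If $\widetilde a$ is bounded away from zero on $\mathbb H^2$, then there is an almost monotone weight $\nu$ on $\mathbb N^2$ such that: $\nu$ is constant if and only if $\omega$ is constant; $\nu$ is admissible if and only if $\omega$ is admissible; $1\le\nu\le\omega$ pointwise; and $1/\widetilde a$ has a $\nu$-absolutely convergent Dirichlet series. (II) If $\varphi$ is holomorphic on an open neighbourhood of the closure of the range of $\widetilde a$, then there is an almost monotone weight $\xi$ on $\mathbb N^2$ such that: $\xi$ is constant if and only if $\omega$ is constant; $\xi$ is admissible if and only if $\omega$ is admissible; $1\le\xi\le\omega$ pointwise; and $\varphi\circ\widetilde a$ has a $\xi$-absolutely convergent Dirichlet series.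
   Context: $\mathbb N=\{1,2,\dots\}$; $p_1<p_2<\cdots$ are the primes in increasing order; $\mathbb H=\{z\in\mathbb C:\operatorname{Re}z\ge0\}$. $\mathbb N^2$ is a semigroup under coordinatewise multiplication. A weight on $\mathbb N^2$ is a map $\omega:\mathbb N^2\to[1,\infty)$ with $\omega((m_1,n_1)(m_2,n_2))\le\omega(m_1,n_1)\omega(m_2,n_2)$ for all $(m_1,n_1),(m_2,n_2)$. A weight $\omega$ is admissible if $\lim_{n\to\infty}\omega(l^n,k^n)^{1/n}=1$ for all $(l,k)\in\mathbb N^2$. A weight $\omega$ is almost monotone if either $\omega$ is admissible, or there is $K>0$ such that $\omega(m_1,n_1)\le K\omega(m_2,n_2)$ whenever $(m_1,n_1),(m_2,n_2)\in\mathbb N^2$ and either $m_1\mid m_2$ or $n_1\mid n_2$. For a weight $\omega$, a function $\widetilde a:\mathbb H^2\to\mathbb C$ has an $\omega$-absolutely convergent Dirichlet series if there is $a:\mathbb N^2\to\mathbb C$ with $\sum_{(m,n)\in\mathbb N^2}|a(m,n)|\omega(m,n)<\infty$ and $\widetilde a(s_1,s_2)=\sum_{(m,n)}a(m,n)m^{-s_1}n^{-s_2}$ for all $(s_1,s_2)\in\mathbb H^2$. $\widetilde a$ is bounded away from zero if there is $k>0$ with $|\widetilde a|\ge k$ on $\mathbb H^2$. *)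

(* Defs.v *)
From Stdlib Require Import Reals.
From Coquelicot Require Import Coquelicot.
Open Scope R_scope.

(* N = {1,2,...} is represented by nat restricted to positive values;
   values of functions at index 0 are irrelevant. *)

Definition weight (w : nat -> nat -> R) : Prop :=
  (forall m n, (1 <= m)%nat -> (1 <= n)%nat -> 1 <= w m n) /\
  (forall m1 n1 m2 n2, (1 <= m1)%nat -> (1 <= n1)%nat -> (1 <= m2)%nat -> (1 <= n2)%nat ->
     w (m1 * m2)%nat (n1 * n2)%nat <= w m1 n1 * w m2 n2).

Definition admissible (w : nat -> nat -> R) : Prop :=
  forall l k, (1 <= l)%nat -> (1 <= k)%nat ->
    is_lim_seq (fun n => Rpower (w (l ^ n)%nat (k ^ n)%nat) (/ INR n)) 1.

Definition almost_monotone (w : nat -> nat -> R) : Prop :=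
  weight w /\
  (admissible w \/
   exists K, 0 < K /\
     forall m1 n1 m2 n2, (1 <= m1)%nat -> (1 <= n1)%nat -> (1 <= m2)%nat -> (1 <= n2)%nat ->
       (Nat.divide m1 m2 \/ Nat.divide n1 n2) -> w m1 n1 <= K * w m2 n2).

Definition constant_on_N2 (w : nat -> nat -> R) : Prop :=
  forall m n m' n', (1 <= m)%nat -> (1 <= n)%nat -> (1 <= m')%nat -> (1 <= n')%nat ->
    w m n = w m' n'.

Definition inH (z : C) : Prop := 0 <= fst z.

(* n^{-s} = exp(-s log n) for n >= 1 *)
Definition npow_neg (n : nat) (s : C) : C :=
  (Rpower (INR n) (- fst s) * cos (- snd s * ln (INR n)),
   Rpower (INR n) (- fst s) * sin (- snd s * ln (INR n))).

Definition dir_partial (a : nat -> nat -> C) (s1 s2 : C) (N : nat) : C :=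
  sum_n (fun i => sum_n (fun j =>
     Cmult (Cmult (a (S i) (S j)) (npow_neg (S i) s1)) (npow_neg (S j) s2)) N) N.

(* sum_{(m,n) in N^2} |a(m,n)| w(m,n) < oo  (nonnegative terms: bounded partial sums) *)
Definition w_summable (w : nat -> nat -> R) (a : nat -> nat -> C) : Prop :=
  exists M, forall N,
    sum_n (fun i => sum_n (fun j => Cmod (a (S i) (S j)) * w (S i) (S j)) N) N <= M.

Definition w_abs_dirichlet (w : nat -> nat -> R) (f : C -> C -> C) : Prop :=
  exists a : nat -> nat -> C,
    w_summable w a /\
    forall s1 s2, inH s1 -> inH s2 ->
      filterlim (dir_partial a s1 s2) eventually (locally (f s1 s2)).

Definition bounded_away_from_zero (f : C -> C -> C) : Prop :=
  exists k, 0 < k /\ forall s1 s2, inH s1 -> inH s2 -> k <= Cmod (f s1 s2).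

Definition in_closure_range (f : C -> C -> C) (z : C) : Prop :=
  forall eps, 0 < eps -> exists s1 s2, inH s1 /\ inH s2 /\ Cmod (Cminus (f s1 s2) z) < eps.

Definition holo_near_closure_range (phi : C -> C) (f : C -> C -> C) : Prop :=
  exists U : C -> Prop,
    @open C_UniformSpace U /\
    (forall z, in_closure_range f z -> U z) /\
    (forall z, U z -> @ex_derive C_AbsRing C_NormedModule phi z).

(* Main.v *)
Require Import Defs.
From Stdlib Require Import Reals Factorial Arith Lra Lia Classical ClassicalEpsilon List Permutation.
From Coquelicot Require Import Coquelicot.
Open Scope R_scope.

(* An almost monotone weight is admissible: the alternative condition forces it
   to be bounded.  One can therefore take [nu = xi = w], and (I) is (II) for the
   function [z |-> 1/z].

   For (II), approximate [a] in the weighted norm by a Dirichlet polynomial [P],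
   and let [P_t(s) = P(s + t)] for [t >= -h].  All powers of [P_t] are supported
   on a finitely generated semigroup [S] of N^2, and admissibility makes
   [sum_{p in S} w(p) |p|^-h] finite, where [|(m, n)| = m n].  If every
   holomorphic [f] operates on [P_t], the coefficients of [f(P_t)] are at most
   [sup |f|] (average over a vertical line), so the norm of [f(P_{t+h})] is at
   most [C sup |f|] with [C] independent of [f].  Because of this uniformity the
   Taylor series [sum_k f_k(P_{t+h}) (P_{t-h} - P_{t+h})^k] converges in norm, and
   [f] operates on [P_{t-h}].  Starting from [t] large, where [P_t] is nearly
   constant, finitely many steps reach [t = -h]; this gives the uniform bound at
   [t = 0], and one more Taylor expansion passes from [P] to [a].

   Taylor's theorem for functions that are only assumed complex differentiable
   is obtained from Goursat's bisection argument, applied to the form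
   [f(zeta) d zeta / (zeta - z)] on the circles [zeta = z + t (z0 + r e^{ix} - z)]. *)

(** * Complex derivatives and curves *)

(** Admissibility controls [w] only along the powers of one element, without uniformity over the
    elements, so a sum of [w(p) |p|^-h] over all of N^2 may diverge. This forces the detour through
    a polynomial: finitely many generators make the growth uniform. The sup bound on coefficients
    presupposes that [f(P_t)] already has an absolutely convergent expansion, so it cannot start the
    argument; it upgrades a qualitative statement at [t] to a uniform one at [t + h]. The upgrade
    costs [h] to the right, the Taylor step then moves [2 h] to the left, a net gain of [h]. Neither
    the constant of the upgrade nor the step length depends on [t] or [f]. For [t >= 0] the values
    of [P_t] are values of [P] at translated points, hence close to the range of the given series;
    for slightly negative [t] they are close by continuity in [t]. The descent goes below 0 because
    the last upgrade has to land at 0. Taylor's theorem must deliver each [f_k] as a holomorphic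
    function of the centre on the whole open set, with Cauchy bounds, because the calculus is
    applied to every [f_k] in turn. *)

Definition has_cderiv (f : C -> C) (z l : C) : Prop :=
  forall eps, 0 < eps -> exists d, 0 < d /\ forall z', Cmod (z' - z)%C < d ->
    Cmod (f z' - f z - l * (z' - z))%C <= eps * Cmod (z' - z)%C.

Definition continuous_C (f : R -> C) (x : R) : Prop :=
  forall eps, 0 < eps -> exists d, 0 < d /\ forall y, Rabs (y - x) < d ->
    Cmod (f y - f x)%C < eps.

Lemma is_derive_has_cderiv (f : C -> C) (z l : C) :
  @is_derive C_AbsRing C_NormedModule f z l -> has_cderiv f z l.
Proof.
  intros [_ H] eps He.
  specialize (H z (fun P HP => HP)).
  destruct (H (mkposreal eps He)) as [d Hd].
  exists d; split; [apply cond_pos|].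
  intros z' Hz'. specialize (Hd z').
  specialize (Hd Hz').
  unfold norm, minus, plus, opp, scal in Hd; simpl in Hd.
  unfold mult, abs, minus, plus, opp in Hd; simpl in Hd.
  replace (f z' - f z - l * (z' - z))%C with (f z' + - f z + - ((z' + - z) * l))%C by ring.
  exact Hd.
Qed.

Lemma continuous_C_continuous (f : R -> C) (x : R) :
  continuous_C f x -> @continuous R_UniformSpace C_UniformSpace f x.
Proof.
  intros H. apply filterlim_locally. intros eps.
  destruct (H eps (cond_pos eps)) as [d [Hd Hx]].
  exists (mkposreal d Hd). intros y Hy.
  apply C_NormedModule_mixin_compat1. apply Hx. exact Hy.
Qed.

Lemma continuous_C_const (c : C) x : continuous_C (fun _ => c) x.
Proof.
  intros e He; exists 1; split; [lra|]; intros.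
  replace (c - c)%C with (RtoC 0) by ring. rewrite Cmod_0; lra.
Qed.

Lemma continuous_C_plus f g x : continuous_C f x -> continuous_C g x ->
  continuous_C (fun t => f t + g t)%C x.
Proof.
  intros Hf Hg e He.
  destruct (Hf (e/2) ltac:(lra)) as [d1 [H1 K1]].
  destruct (Hg (e/2) ltac:(lra)) as [d2 [H2 K2]].
  exists (Rmin d1 d2); split; [apply Rmin_pos; auto|]. intros y Hy.
  specialize (K1 y ltac:(eapply Rlt_le_trans; [exact Hy|apply Rmin_l])).
  specialize (K2 y ltac:(eapply Rlt_le_trans; [exact Hy|apply Rmin_r])).
  replace (f y + g y - (f x + g x))%C with ((f y - f x) + (g y - g x))%C by ring.
  eapply Rle_lt_trans; [apply Cmod_triangle|lra].
Qed.

Lemma continuous_C_mult f g x : continuous_C f x -> continuous_C g x ->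
  continuous_C (fun t => f t * g t)%C x.
Proof.
  intros Hf Hg e He.
  pose proof (Cmod_ge_0 (f x)) as P1. pose proof (Cmod_ge_0 (g x)) as P2.
  set (A := Cmod (f x) + Cmod (g x) + 1).
  assert (HA : 0 < A) by (unfold A; lra).
  set (e' := Rmin 1 (e / (2 * A))).
  assert (He' : 0 < e'). { apply Rmin_pos; [lra|]. apply Rdiv_lt_0_compat; lra. }
  assert (E1 : e' <= 1) by apply Rmin_l.
  assert (E2 : e' * A < e).
  { apply Rle_lt_trans with (e / (2 * A) * A).
    - apply Rmult_le_compat_r; [lra|apply Rmin_r].
    - replace (e / (2 * A) * A) with (e / 2) by (field; lra). lra. }
  destruct (Hf e' He') as [d1 [H1 K1]].
  destruct (Hg e' He') as [d2 [H2 K2]].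
  exists (Rmin d1 d2); split; [apply Rmin_pos; auto|]. intros y Hy.
  specialize (K1 y ltac:(eapply Rlt_le_trans; [exact Hy|apply Rmin_l])).
  specialize (K2 y ltac:(eapply Rlt_le_trans; [exact Hy|apply Rmin_r])).
  replace (f y * g y - f x * g x)%C
    with ((f y - f x) * (g y - g x) + ((f y - f x) * g x + f x * (g y - g x)))%C by ring.
  eapply Rle_lt_trans; [apply Cmod_triangle|].
  eapply Rle_lt_trans; [apply Rplus_le_compat_l, Cmod_triangle|].
  rewrite !Cmod_mult.
  pose proof (Cmod_ge_0 (f y - f x)). pose proof (Cmod_ge_0 (g y - g x)).
  unfold A in *. nra.
Qed.

Lemma continuous_C_opp f x : continuous_C f x -> continuous_C (fun t => - f t)%C x.
Proof.
  intros Hf e He. destruct (Hf e He) as [d [Hd K]]. exists d; split; auto. intros y Hy.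
  replace (- f y - - f x)%C with (- (f y - f x))%C by ring. rewrite Cmod_opp; auto.
Qed.

Lemma continuous_C_minus f g x : continuous_C f x -> continuous_C g x ->
  continuous_C (fun t => f t - g t)%C x.
Proof. intros; apply continuous_C_plus, continuous_C_opp; auto. Qed.

Lemma continuous_C_inv (f : R -> C) x : f x <> 0 -> continuous_C f x ->
  continuous_C (fun t => / f t)%C x.
Proof.
  intros Hn Hf e He.
  assert (P : 0 < Cmod (f x)) by (exact (proj1 (Cmod_gt_0 _) Hn)).
  set (A := Cmod (f x)) in *.
  set (e' := Rmin (A / 2) (e * A * A / 4)).
  assert (He' : 0 < e'). { apply Rmin_pos; [lra|]. assert (0 < e * A * A) by (repeat apply Rmult_lt_0_compat; lra). lra. }
  destruct (Hf e' He') as [d [H1 K1]].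
  exists d; split; auto. intros y Hy. specialize (K1 y Hy).
  assert (L1 : Cmod (f y - f x) < A / 2) by (eapply Rlt_le_trans; [exact K1|apply Rmin_l]).
  assert (L2 : Cmod (f y - f x) < e * A * A / 4) by (eapply Rlt_le_trans; [exact K1|apply Rmin_r]).
  assert (L3 : A / 2 <= Cmod (f y)).
  { assert (T := Cmod_triangle (f y) (- (f y - f x))).
    replace (f y + - (f y - f x))%C with (f x) in T by ring.
    rewrite Cmod_opp in T. fold A in T. lra. }
  assert (Ny : f y <> 0) by (apply (proj2 (Cmod_gt_0 _)); lra).
  replace (/ f y - / f x)%C with (- (f y - f x) / (f y * f x))%C by (field; auto).
  rewrite Cmod_div, Cmod_opp, Cmod_mult by (apply Cmult_neq_0; auto). fold A.
  apply Rmult_lt_reg_r with (Cmod (f y) * A); [apply Rmult_lt_0_compat; lra|].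
  unfold Rdiv at 1. rewrite Rmult_assoc, Rinv_l, Rmult_1_r by nra.
  assert (0 < e * A) by nra. nra.
Qed.

Lemma continuous_C_RtoC (f : R -> R) x : continuous f x -> continuous_C (fun t => RtoC (f t)) x.
Proof.
  intros H e He.
  destruct (proj1 (filterlim_locally f (f x)) H (mkposreal _ He)) as [d Hd].
  exists d; split; [apply cond_pos|]. intros y Hy. specialize (Hd y Hy).
  replace (RtoC (f y) - RtoC (f x))%C with (RtoC (f y - f x)) by (rewrite RtoC_minus; ring).
  rewrite Cmod_R. exact Hd.
Qed.

Lemma has_cderiv_continuous_comp (f : C -> C) (g : R -> C) (x : R) l :
  has_cderiv f (g x) l -> continuous_C g x -> continuous_C (fun t => f (g t)) x.
Proof.
  intros Hf Hg e He.
  destruct (Hf 1 ltac:(lra)) as [d [Hd K]].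
  pose proof (Cmod_ge_0 l) as P.
  set (e' := Rmin d (e / (2 + Cmod l))).
  assert (He' : 0 < e') by (apply Rmin_pos; auto; apply Rdiv_lt_0_compat; lra).
  destruct (Hg e' He') as [d2 [H2 K2]].
  exists d2; split; auto. intros y Hy. specialize (K2 y Hy).
  assert (L1 : Cmod (g y - g x) < d) by (eapply Rlt_le_trans; [exact K2|apply Rmin_l]).
  assert (L2 : Cmod (g y - g x) < e / (2 + Cmod l)) by (eapply Rlt_le_trans; [exact K2|apply Rmin_r]).
  specialize (K _ L1).
  replace (f (g y) - f (g x))%C with ((f (g y) - f (g x) - l * (g y - g x)) + l * (g y - g x))%C by ring.
  eapply Rle_lt_trans; [apply Cmod_triangle|]. rewrite Cmod_mult.
  assert (L3 : Cmod (g y - g x) * (2 + Cmod l) < e).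
  { replace e with (e / (2 + Cmod l) * (2 + Cmod l)) by (field; lra).
    apply Rmult_lt_compat_r; lra. }
  pose proof (Cmod_ge_0 (g y - g x)). nra.
Qed.

(** * Integrals of complex-valued functions *)

Definition CInt (f : R -> C) (a b : R) : C := @RInt C_R_CompleteNormedModule f a b.

Definition continuous_on_C (f : R -> C) (a b : R) : Prop :=
  forall x, a <= x <= b -> continuous_C f x.

Lemma is_CInt f a b : a <= b -> continuous_on_C f a b ->
  @is_RInt C_R_NormedModule f a b (CInt f a b).
Proof.
  intros Hab H. apply (@RInt_correct C_R_CompleteNormedModule).
  apply (@ex_RInt_continuous C_R_CompleteNormedModule). intros x Hx.
  rewrite Rmin_left, Rmax_right in Hx by auto.
  apply (continuous_C_continuous f x). auto.
Qed.

Lemma CInt_unique f a b l : @is_RInt C_R_NormedModule f a b l -> CInt f a b = l.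
Proof. apply (@is_RInt_unique C_R_CompleteNormedModule). Qed.

Lemma CInt_ext f g a b : a <= b -> (forall x, a <= x <= b -> f x = g x) -> CInt f a b = CInt g a b.
Proof.
  intros Hab H. apply (@RInt_ext C_R_CompleteNormedModule). intros x Hx.
  rewrite Rmin_left, Rmax_right in Hx by auto. apply H; lra.
Qed.

Lemma CInt_plus f g a b : a <= b -> continuous_on_C f a b -> continuous_on_C g a b ->
  CInt (fun x => f x + g x)%C a b = (CInt f a b + CInt g a b)%C.
Proof.
  intros Hab Hf Hg. apply CInt_unique.
  apply (@is_RInt_plus C_R_NormedModule); apply is_CInt; auto.
Qed.

Lemma CInt_minus f g a b : a <= b -> continuous_on_C f a b -> continuous_on_C g a b ->
  CInt (fun x => f x - g x)%C a b = (CInt f a b - CInt g a b)%C.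
Proof.
  intros Hab Hf Hg. apply CInt_unique.
  apply (@is_RInt_minus C_R_NormedModule); apply is_CInt; auto.
Qed.

(** The integral lives in a module over R, where a complex factor is not a scalar. It mixes the two
    components, which are therefore integrated separately. *)
Lemma CInt_scal k f a b : a <= b -> continuous_on_C f a b ->
  CInt (fun x => k * f x)%C a b = (k * CInt f a b)%C.
Proof.
  intros Hab Hf. apply CInt_unique. pose proof (is_CInt f a b Hab Hf) as H.
  pose proof (@is_RInt_fct_extend_fst R_NormedModule R_NormedModule _ _ _ _ H) as H1.
  pose proof (@is_RInt_fct_extend_snd R_NormedModule R_NormedModule _ _ _ _ H) as H2.
  apply (@is_RInt_fct_extend_pair R_NormedModule R_NormedModule); simpl.
  - apply (is_RInt_minus (V := R_NormedModule));
      apply (is_RInt_scal (V := R_NormedModule)); auto.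
  - apply (is_RInt_plus (V := R_NormedModule)).
    + apply (is_RInt_scal (V := R_NormedModule)); auto.
    + apply (is_RInt_scal (V := R_NormedModule)); auto.
Qed.

Lemma CInt_Chasles f a b c : a <= b -> b <= c -> continuous_on_C f a c ->
  (CInt f a b + CInt f b c)%C = CInt f a c.
Proof.
  intros H1 H2 Hf. symmetry. apply CInt_unique.
  apply (@is_RInt_Chasles C_R_NormedModule) with b; apply is_CInt; auto;
    intros x Hx; apply Hf; lra.
Qed.

Lemma CInt_bound f a b M : a <= b -> continuous_on_C f a b ->
  (forall x, a <= x <= b -> Cmod (f x) <= M) -> Cmod (CInt f a b) <= (b - a) * M.
Proof.
  intros Hab Hf HM.
  assert (N : forall z : C, @norm _ C_R_NormedModule z = Cmod z).
  { intros z. unfold norm; simpl. unfold prod_norm; simpl. unfold Cmod, norm; simpl.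
    unfold abs; simpl. f_equal. rewrite !Rmult_1_r, <- !Rabs_mult.
    rewrite !Rabs_pos_eq; auto; apply Rle_0_sqr. }
  rewrite <- N.
  apply (@norm_RInt_le_const C_R_NormedModule f a b (CInt f a b) M Hab).
  - intros x Hx. rewrite N. auto.
  - apply is_CInt; auto.
Qed.

Definition has_rderiv (f : R -> C) (x : R) (l : C) : Prop :=
  is_derive (fun t => fst (f t)) x (fst l) /\ is_derive (fun t => snd (f t)) x (snd l).

Lemma CInt_derive f df a b : a <= b ->
  (forall x, a <= x <= b -> has_rderiv f x (df x)) -> continuous_on_C df a b ->
  CInt df a b = (f b - f a)%C.
Proof.
  intros Hab Hd Hc. apply CInt_unique.
  assert (K : forall x, a <= x <= b -> continuous (fun t => fst (df t)) x /\ continuous (fun t => snd (df t)) x).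
  { intros x Hx. pose proof (continuous_C_continuous _ _ (Hc x Hx)) as K.
    split.
    - apply (continuous_comp df fst); auto. apply continuous_fst.
    - apply (continuous_comp df snd); auto. apply continuous_snd. }
  apply (@is_RInt_fct_extend_pair R_NormedModule R_NormedModule); simpl.
  - apply (@is_RInt_derive R_CompleteNormedModule (fun t => fst (f t)));
      rewrite Rmin_left, Rmax_right by auto; intros x Hx; [apply Hd|apply K]; auto.
  - apply (@is_RInt_derive R_CompleteNormedModule (fun t => snd (f t)));
      rewrite Rmin_left, Rmax_right by auto; intros x Hx; [apply Hd|apply K]; auto.
Qed.

(** * Goursat's bisection argument *)

Section Bisection.

Variables (J : R -> R -> R -> R -> C) (A B P Q : R).
Hypothesis HAB : A <= B.
Hypothesis HPQ : P <= Q.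
Hypothesis J_split_l : forall t1 t2 t3 p q, A <= t1 -> t1 <= t2 -> t2 <= t3 -> t3 <= B ->
  P <= p -> p <= q -> q <= Q -> J t1 t3 p q = (J t1 t2 p q + J t2 t3 p q)%C.
Hypothesis J_split_r : forall t1 t2 p1 p2 p3, A <= t1 -> t1 <= t2 -> t2 <= B ->
  P <= p1 -> p1 <= p2 -> p2 <= p3 -> p3 <= Q -> J t1 t2 p1 p3 = (J t1 t2 p1 p2 + J t1 t2 p2 p3)%C.
Hypothesis J_local : forall t p, A <= t <= B -> P <= p <= Q -> forall eps, 0 < eps ->
  exists d, 0 < d /\ forall t1 t2 p1 p2, A <= t1 -> t1 <= t <= t2 -> t2 <= B ->
    P <= p1 -> p1 <= p <= p2 -> p2 <= Q -> t2 - t1 < d -> p2 - p1 < d ->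
    Cmod (J t1 t2 p1 p2) <= eps * (t2 - t1 + (p2 - p1)) ^ 2.

Let w (n : nat) := (B - A) / 2 ^ n.
Let v (n : nat) := (Q - P) / 2 ^ n.
Let cell (n : nat) (x : R * R) := J (fst x) (fst x + w n) (snd x) (snd x + v n).

Let w_S n : w n = w (S n) + w (S n).
Proof. unfold w. simpl. field. apply pow_nonzero; lra. Qed.
Let v_S n : v n = v (S n) + v (S n).
Proof. unfold v. simpl. field. apply pow_nonzero; lra. Qed.
Let w_ge0 n : 0 <= w n.
Proof. unfold w. apply Rdiv_le_0_compat; [lra|apply pow_lt; lra]. Qed.
Let v_ge0 n : 0 <= v n.
Proof. unfold v. apply Rdiv_le_0_compat; [lra|apply pow_lt; lra]. Qed.

Let good n (x : R * R) := A <= fst x /\ fst x + w n <= B /\ P <= snd x /\ snd x + v n <= Q /\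
  Cmod (J A B P Q) / 4 ^ n <= Cmod (cell n x).
Let below n (x y : R * R) := fst x <= fst y /\ fst y + w (S n) <= fst x + w n /\
  snd x <= snd y /\ snd y + v (S n) <= snd x + v n.

(** A cell is the sum of its four quarters, so one quarter keeps at least a fourth of the modulus.
    The lower bound in [good] decreases like the area of the cell. *)
Lemma bisection_step n x : good n x -> exists y, good (S n) y /\ below n x y.
Proof.
  intros (G1 & G2 & G3 & G4 & G5). destruct x as [t p]; simpl in *.
  pose proof (w_S n) as Ew. pose proof (v_S n) as Ev.
  pose proof (w_ge0 (S n)) as Pw. pose proof (v_ge0 (S n)) as Pv.
  set (h := w (S n)) in *. set (k := v (S n)) in *.
  set (K := Cmod (J A B P Q) / 4 ^ n) in *.
  assert (EK : Cmod (J A B P Q) / 4 ^ S n = K / 4).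
  { unfold K. simpl. field. apply pow_nonzero; lra. }
  assert (S0 : cell n (t, p) =
     (cell (S n) (t, p) + cell (S n) (t, (p + k)%R) + (cell (S n) ((t + h)%R, p) + cell (S n) ((t + h)%R, (p + k)%R)))%C).
  { unfold cell; simpl. fold h k.
    replace (t + h + h) with (t + w n) by lra. replace (p + k + k) with (p + v n) by lra.
    rewrite (J_split_l t (t + h) (t + w n)) by lra.
    rewrite (J_split_r t (t + h) p (p + k) (p + v n)) by lra.
    rewrite (J_split_r (t + h) (t + w n) p (p + k) (p + v n)) by lra. ring. }
  rewrite S0 in G5.
  assert (T1 := Cmod_triangle (cell (S n) (t, p) + cell (S n) (t, (p + k)%R))
                              (cell (S n) ((t + h)%R, p) + cell (S n) ((t + h)%R, (p + k)%R))).
  assert (T2 := Cmod_triangle (cell (S n) (t, p)) (cell (S n) (t, (p + k)%R))).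
  assert (T3 := Cmod_triangle (cell (S n) ((t + h)%R, p)) (cell (S n) ((t + h)%R, (p + k)%R))).
  destruct (Rle_dec (K / 4) (Cmod (cell (S n) (t, p)))) as [Y1|N1];
  [|destruct (Rle_dec (K / 4) (Cmod (cell (S n) (t, (p + k)%R)))) as [Y2|N2];
  [|destruct (Rle_dec (K / 4) (Cmod (cell (S n) ((t + h)%R, p)))) as [Y3|N3];
  [|assert (Y4 : K / 4 <= Cmod (cell (S n) ((t + h)%R, (p + k)%R))) by lra]]].
  - exists (t, p). unfold good, below; cbn [fst snd]. fold h k. rewrite EK. repeat split; lra.
  - exists (t, (p + k)%R). unfold good, below; cbn [fst snd]. fold h k. rewrite EK. repeat split; lra.
  - exists ((t + h)%R, p). unfold good, below; cbn [fst snd]. fold h k. rewrite EK. repeat split; lra.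
  - exists ((t + h)%R, (p + k)%R). unfold good, below; cbn [fst snd]. fold h k. rewrite EK. repeat split; lra.
Qed.

Lemma bisection_sequence : exists x : nat -> R * R,
  (forall n, good n (x n)) /\ (forall n, below n (x n) (x (S n))).
Proof.
  assert (G0 : good 0 (A, P)).
  { unfold good, cell, w, v; simpl.
    replace (A + (B - A) / 1) with B by field. replace (P + (Q - P) / 1) with Q by field.
    repeat split; lra. }
  (* The recursion carries the proof of [good] along, since a next cell is available only below a
     good one. *)
  set (step n (x : {y | good n y}) :=
    constructive_indefinite_description _ (bisection_step n (proj1_sig x) (proj2_sig x))).
  set (x := fix x n : {y | good n y} := match n with
    | O => exist _ (A, P) G0
    | S m => exist _ (proj1_sig (step m (x m))) (proj1 (proj2_sig (step m (x m))))
    end).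
  exists (fun n => proj1_sig (x n)). split.
  - intros n. exact (proj2_sig (x n)).
  - intros n. exact (proj2 (proj2_sig (step n (x n)))).
Qed.

Lemma nested_point (a h : nat -> R) : (forall n, 0 <= h n) ->
  (forall n, a n <= a (S n)) -> (forall n, a (S n) + h (S n) <= a n + h n) ->
  exists t, forall n, a n <= t <= a n + h n.
Proof.
  intros H0 H1 H2.
  assert (M1 : forall n k, a n <= a (n + k)%nat).
  { intros n k; induction k; [rewrite Nat.add_0_r; lra|].
    rewrite Nat.add_succ_r. specialize (H1 (n + k)%nat). lra. }
  assert (M2 : forall n k, a (n + k)%nat + h (n + k)%nat <= a n + h n).
  { intros n k; induction k; [rewrite Nat.add_0_r; lra|].
    rewrite Nat.add_succ_r. specialize (H2 (n + k)%nat). lra. }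
  assert (M3 : forall m n, a m <= a n + h n).
  { intros m n. specialize (M1 m n). specialize (M2 n m). rewrite (Nat.add_comm n m) in M2.
    specialize (H0 (m + n)%nat). lra. }
  destruct (completeness (fun y => exists n, y = a n)) as [t [T1 T2]].
  - exists (a O + h O). intros y [n ->]. apply M3.
  - exists (a O). exists O; auto.
  - exists t. intros n. split.
    + apply T1. exists n; auto.
    + apply T2. intros y [m ->]. apply M3.
Qed.

(** Around the common point of the cells, [J] is at least [|J A B P Q| / 4 ^ n] and, by [J_local],
    at most [eps * (D / 2 ^ n) ^ 2]. Both have order [4 ^ -n], and [eps] is chosen so that
    [eps * D ^ 2] stays below half of the total. *)
Lemma bisection_zero : J A B P Q = 0.
Proof.
  destruct (classic (J A B P Q = 0)) as [|N]; auto. exfalso.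
  assert (K0 : 0 < Cmod (J A B P Q)) by (apply (proj1 (Cmod_gt_0 _)); auto).
  destruct bisection_sequence as [x [G L]].
  destruct (nested_point (fun n => fst (x n)) w) as [t Ht]; [auto|apply L|apply L|].
  destruct (nested_point (fun n => snd (x n)) v) as [p Hp]; [auto|apply L|apply L|].
  set (D := B - A + (Q - P)).
  assert (HD : 0 <= D) by (unfold D; lra).
  set (eps := Cmod (J A B P Q) / (2 * (D ^ 2 + 1))).
  assert (D2 : 0 < D ^ 2 + 1) by nra.
  assert (He : 0 < eps) by (apply Rdiv_lt_0_compat; lra).
  destruct (J_local t p) with (eps := eps) as [d [Hd K]]; auto.
  { destruct (G O) as (G1 & G2 & _). specialize (Ht O). lra. }
  { destruct (G O) as (_ & _ & G1 & G2 & _). specialize (Hp O). lra. }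
  assert (exists n, D / 2 ^ n < d) as [n Hn].
  { destruct (pow_lt_1_zero (/2) ltac:(rewrite Rabs_pos_eq; lra) (d / (D + 1))) as [n Hn].
    { apply Rdiv_lt_0_compat; lra. }
    exists n. specialize (Hn n (Nat.le_refl _)).
    rewrite Rabs_pos_eq in Hn by (apply pow_le; lra).
    rewrite pow_inv in Hn. unfold Rdiv.
    assert (0 < / 2 ^ n) by (apply Rinv_0_lt_compat, pow_lt; lra).
    apply Rle_lt_trans with ((D + 1) * / 2 ^ n); [nra|].
    replace d with ((D + 1) * (d / (D + 1))) by (field; lra).
    apply Rmult_lt_compat_l; lra. }
  destruct (G n) as (G1 & G2 & G3 & G4 & G5).
  assert (Ewv : w n + v n = D / 2 ^ n). { unfold w, v, D. field. apply pow_nonzero; lra. }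
  specialize (K (fst (x n)) (fst (x n) + w n) (snd (x n)) (snd (x n) + v n)).
  pose proof (w_ge0 n). pose proof (v_ge0 n).
  specialize (K G1 (Ht n) G2 G3 (Hp n) G4 ltac:(lra) ltac:(lra)).
  unfold cell in G5.
  replace (fst (x n) + w n - fst (x n) + (snd (x n) + v n - snd (x n))) with (D / 2 ^ n) in K by lra.
  assert (P4 : 0 < 4 ^ n) by (apply pow_lt; lra).
  assert (P2 : 2 ^ n * 2 ^ n = 4 ^ n). { rewrite <- Rpow_mult_distr. f_equal; lra. }
  assert (P2' : 0 < 2 ^ n) by (apply pow_lt; lra).
  assert (F : Cmod (J A B P Q) / 4 ^ n <= eps * (D / 2 ^ n) ^ 2) by lra.
  apply (Rmult_le_compat_r (4 ^ n)) in F; [|lra].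
  replace (Cmod (J A B P Q) / 4 ^ n * 4 ^ n) with (Cmod (J A B P Q)) in F by (field; lra).
  replace (eps * (D / 2 ^ n) ^ 2 * 4 ^ n) with (eps * D ^ 2) in F
    by (rewrite <- P2; field; lra).
  assert (E2 : eps * (2 * (D ^ 2 + 1)) = Cmod (J A B P Q)) by (unfold eps; field; lra).
  nra.
Qed.

End Bisection.

(** * Cauchy's formula on a circle *)

Definition cis (x : R) : C := (cos x, sin x).

Lemma Cmod_cis x : Cmod (cis x) = 1.
Proof.
  unfold Cmod, cis; simpl. rewrite !Rmult_1_r.
  replace (cos x * cos x + sin x * sin x) with 1; [apply sqrt_1|].
  pose proof (sin2_cos2 x) as H. unfold Rsqr in H. lra.
Qed.

Lemma cis_plus a b : cis (a + b) = (cis a * cis b)%C.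
Proof. unfold cis, Cmult; simpl. rewrite cos_plus, sin_plus. f_equal; ring. Qed.

Lemma cis_0 : cis 0 = 1.
Proof. unfold cis. rewrite cos_0, sin_0. reflexivity. Qed.

Lemma cis_period a (k : nat) : cis (a + 2 * INR k * PI) = cis a.
Proof. unfold cis. rewrite cos_period, sin_period. reflexivity. Qed.

Lemma continuous_C_cis x : continuous_C cis x.
Proof.
  assert (H : continuous_C (fun t => RtoC (cos t) + Ci * RtoC (sin t))%C x).
  { apply continuous_C_plus; [|apply continuous_C_mult; [apply continuous_C_const|]];
      apply continuous_C_RtoC; [apply continuous_cos|apply continuous_sin]. }
  intros e He. destruct (H e He) as [d [Hd K]]. exists d; split; auto.
  intros y Hy. specialize (K y Hy).
  replace (cis y - cis x)%C with (RtoC (cos y) + Ci * RtoC (sin y) - (RtoC (cos x) + Ci * RtoC (sin x)))%C; auto.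
  apply injective_projections; simpl; ring.
Qed.

Lemma continuous_C_cis_scal a x : continuous_C (fun t => cis (a * t)) x.
Proof.
  intros e He. destruct (continuous_C_cis (a * x) e He) as [d [Hd K]].
  pose proof (Rabs_pos a).
  exists (d / (Rabs a + 1)); split; [apply Rdiv_lt_0_compat; lra|].
  intros y Hy. apply K. replace (a * y - a * x) with (a * (y - x)) by ring.
  rewrite Rabs_mult. pose proof (Rabs_pos (y - x)).
  apply Rle_lt_trans with (Rabs (y - x) * (Rabs a + 1)); [nra|].
  replace d with (d / (Rabs a + 1) * (Rabs a + 1)) by (field; lra).
  apply Rmult_lt_compat_r; lra.
Qed.

Lemma has_rderiv_cis (k m : C) a x :
  has_rderiv (fun t => k * cis (a * t) + m)%C x (k * (RtoC a * Ci * cis (a * x)))%C.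
Proof.
  split; unfold cis, Ci, RtoC, Cplus, Cmult; simpl; auto_derive; auto; ring.
Qed.

Lemma has_rderiv_cis1 (k m : C) x :
  has_rderiv (fun t => k * cis t + m)%C x (k * (Ci * cis x))%C.
Proof.
  split; unfold cis, Ci, RtoC, Cplus, Cmult; simpl; auto_derive; auto; ring.
Qed.

Lemma cis_lipschitz a b : Cmod (cis b - cis a) <= Rabs (b - a).
Proof.
  assert (H : forall a b, a <= b -> Cmod (cis b - cis a) <= b - a).
  { clear. intros a b Hab.
    assert (E : CInt (fun x => 1 * (Ci * cis x))%C a b = (1 * cis b + 0 - (1 * cis a + 0))%C).
    { apply (CInt_derive (fun t => 1 * cis t + 0)%C); auto.
      - intros x _. apply has_rderiv_cis1.
      - intros x _. repeat apply continuous_C_mult; try apply continuous_C_const.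
        apply continuous_C_cis. }
    replace (cis b - cis a)%C with (1 * cis b + 0 - (1 * cis a + 0))%C by ring.
    rewrite <- E. rewrite <- (Rmult_1_r (b - a)). apply CInt_bound; auto.
    - intros x _. repeat apply continuous_C_mult; try apply continuous_C_const.
      apply continuous_C_cis.
    - intros x _. rewrite !Cmod_mult, Cmod_1, Cmod_Ci, Cmod_cis. lra. }
  destruct (Rle_dec a b).
  - rewrite Rabs_pos_eq by lra. auto.
  - rewrite Rabs_left1 by lra. replace (cis b - cis a)%C with (- (cis a - cis b))%C by ring.
    rewrite Cmod_opp. replace (- (b - a)) with (a - b) by ring. apply H; lra.
Qed.

Section Cauchy.

Variables (phi : C -> C) (z0 : C) (r : R) (u : C).
Hypothesis Hr : 0 < r.
Hypothesis Hu : Cmod u < r.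
Hypothesis Hphi : forall z, Cmod (z - z0) <= r -> exists l, has_cderiv phi z l.

Let c (x : R) : C := (r * cis x - u)%C.
Let zeta (t x : R) : C := (z0 + u + t * c x)%C.
Let F (t x : R) : C := phi (zeta t x).
Let kap (x : R) : C := (Ci * (r * cis x) / c x)%C.
Let Kk := r / (r - Cmod u).

Let c_lower x : r - Cmod u <= Cmod (c x).
Proof.
  unfold c. assert (T := Cmod_triangle (r * cis x - u) u).
  replace (r * cis x - u + u)%C with (r * cis x)%C in T by ring.
  rewrite Cmod_mult, Cmod_cis, Cmod_R, Rabs_pos_eq in T by lra. lra.
Qed.

Let c_upper x : Cmod (c x) <= 2 * r.
Proof.
  unfold c, Cminus. eapply Rle_trans; [apply Cmod_triangle|].
  rewrite Cmod_opp, Cmod_mult, Cmod_cis, Cmod_R, Rabs_pos_eq by lra. lra.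
Qed.

Let c_neq_0 x : c x <> 0.
Proof. apply (proj2 (Cmod_gt_0 _)). pose proof (c_lower x). lra. Qed.

Let zeta_disc t x : 0 <= t <= 1 -> Cmod (zeta t x - z0) <= r.
Proof.
  intros Ht. unfold zeta, c.
  replace (z0 + u + t * (r * cis x - u) - z0)%C with ((1 - t) * u + t * (r * cis x))%C by ring.
  eapply Rle_trans; [apply Cmod_triangle|].
  rewrite <- RtoC_minus, !Cmod_mult, !Cmod_R, Cmod_cis. rewrite !Rabs_pos_eq by lra. nra.
Qed.

Let cont_c x : continuous_C c x.
Proof.
  apply continuous_C_minus; [apply continuous_C_mult|]; try apply continuous_C_const.
  apply continuous_C_cis.
Qed.

Let cont_F_r t x : 0 <= t <= 1 -> continuous_C (F t) x.
Proof.
  intros Ht. destruct (Hphi _ (zeta_disc t x Ht)) as [l Hl].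
  apply (has_cderiv_continuous_comp phi (zeta t) x l Hl).
  apply continuous_C_plus; [|apply continuous_C_mult]; try apply continuous_C_const. apply cont_c.
Qed.

Let cont_F_l t x : 0 <= t <= 1 -> continuous_C (fun t => F t x) t.
Proof.
  intros Ht. destruct (Hphi _ (zeta_disc t x Ht)) as [l Hl].
  apply (has_cderiv_continuous_comp phi (fun t => zeta t x) t l Hl).
  apply continuous_C_plus; [|apply continuous_C_mult]; try apply continuous_C_const.
  apply continuous_C_RtoC, continuous_id.
Qed.

Let cont_kap x : continuous_C kap x.
Proof.
  unfold kap. apply continuous_C_mult.
  - repeat apply continuous_C_mult; try apply continuous_C_const. apply continuous_C_cis.
  - apply (continuous_C_inv c); auto.
Qed.

Let kap_bound x : Cmod (kap x) <= Kk.
Proof.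
  unfold kap, Kk. rewrite Cmod_div by auto.
  rewrite !Cmod_mult, Cmod_Ci, Cmod_cis, Cmod_R, Rabs_pos_eq by lra.
  rewrite Rmult_1_l, Rmult_1_r. apply Rmult_le_compat_l; [lra|].
  apply Rinv_le_contravar; auto; lra.
Qed.

Let Kk_pos : 0 < Kk.
Proof. unfold Kk. apply Rdiv_lt_0_compat; lra. Qed.

Let cont_inv t : 0 < t -> continuous_C (fun t => / RtoC t)%C t.
Proof.
  intros Ht. apply (continuous_C_inv RtoC).
  - apply (proj2 (Cmod_gt_0 _)). rewrite Cmod_R, Rabs_pos_eq; lra.
  - apply continuous_C_RtoC, continuous_id.
Qed.

(** Put [z = z0 + u]. Since [zeta t x - z = t * c x], the form [d zeta / (zeta - z)] equals
    [dt / t + kap x dx]. So [J] is the integral of [phi(zeta) d zeta / (zeta - z)] along the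
    boundary of a rectangle in the [(t, x)] plane. *)
Let J (t1 t2 p q : R) : C :=
  (CInt (fun x => (F t2 x - F t1 x) * kap x) p q - CInt (fun t => (F t q - F t p) * / RtoC t) t1 t2)%C.

Let cont_J1 t1 t2 x : 0 <= t1 <= 1 -> 0 <= t2 <= 1 -> continuous_C (fun x => (F t2 x - F t1 x) * kap x)%C x.
Proof. intros. apply continuous_C_mult; auto. apply continuous_C_minus; auto. Qed.

Let cont_J2 p q t : 0 < t <= 1 -> continuous_C (fun t => (F t q - F t p) * / RtoC t)%C t.
Proof.
  intros. apply continuous_C_mult; [|apply cont_inv; lra].
  apply (continuous_C_minus (fun t => F t q) (fun t => F t p)); apply cont_F_l; lra.
Qed.

(* The form [phi(zeta) d zeta / (zeta - z)] vanishes to second order on small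
   cells: on the affine part of [phi] both integrals are explicit and cancel. *)
Lemma cauchy_cell_local t0 t p : 0 < t0 -> t0 <= t <= 1 -> forall eps, 0 < eps ->
  exists d, 0 < d /\ forall t1 t2 p1 p2, t0 <= t1 -> t1 <= t <= t2 -> t2 <= 1 ->
    p1 <= p <= p2 -> t2 - t1 < d -> p2 - p1 < d ->
    Cmod (J t1 t2 p1 p2) <= eps * (t2 - t1 + (p2 - p1)) ^ 2.
Proof.
  intros H0 Ht eps He.
  destruct (Hphi (zeta t p) (zeta_disc t p ltac:(lra))) as [l Hl].
  (* The estimates below end with [D * (2 * B * (Kk + / t0))] where [B = eps / K * (2 * r * D)];
     this [K] makes it exactly [eps * D ^ 2]. *)
  set (K := 4 * r * (Kk + / t0)).
  assert (Hit : 0 < / t0) by (apply Rinv_0_lt_compat; lra).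
  assert (HK : 0 < K). { unfold K. apply Rmult_lt_0_compat; lra. }
  destruct (Hl (eps / K)) as [d [Hd K1]]; [apply Rdiv_lt_0_compat; auto|].
  exists (d / (8 * r)). split; [apply Rdiv_lt_0_compat; lra|].
  intros t1 t2 p1 p2 A1 A2 A3 A4 A5 A6.
  set (D := t2 - t1 + (p2 - p1)).
  assert (HD0 : 0 <= D) by (unfold D; lra).
  assert (HD : 2 * r * D < d).
  { assert (D < 2 * (d / (8 * r))) by (unfold D; lra).
    apply Rlt_le_trans with (2 * r * (2 * (d / (8 * r)))).
    - apply Rmult_lt_compat_l; lra.
    - replace (2 * r * (2 * (d / (8 * r)))) with (d / 2) by (field; lra). lra. }
  assert (Z : forall s x, t1 <= s <= t2 -> p1 <= x <= p2 -> Cmod (zeta s x - zeta t p) <= 2 * r * D).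
  { intros s x Hs Hx. unfold zeta.
    replace (z0 + u + s * c x - (z0 + u + t * c p))%C
      with ((s - t) * c x + t * (r * (cis x - cis p)))%C by (unfold c; ring).
    eapply Rle_trans; [apply Cmod_triangle|].
    rewrite <- RtoC_minus, !Cmod_mult, !Cmod_R.
    rewrite (Rabs_pos_eq t), (Rabs_pos_eq r) by lra.
    pose proof (cis_lipschitz p x) as L. pose proof (c_upper x) as L2.
    assert (B1 : Rabs (s - t) <= t2 - t1) by (apply Rabs_le; lra).
    assert (B2 : Rabs (x - p) <= p2 - p1) by (apply Rabs_le; lra).
    pose proof (Rabs_pos (s - t)). pose proof (Cmod_ge_0 (cis x - cis p)). pose proof (Cmod_ge_0 (c x)).
    assert (Q1 : Rabs (s - t) * Cmod (c x) <= (t2 - t1) * (2 * r)) by (apply Rmult_le_compat; auto).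
    assert (Q2 : r * Cmod (cis x - cis p) <= r * (p2 - p1)) by (apply Rmult_le_compat_l; lra).
    assert (Q3 : t * (r * Cmod (cis x - cis p)) <= 1 * (r * (p2 - p1))).
    { apply Rmult_le_compat; try lra. apply Rmult_le_pos; lra. }
    unfold D. nra. }
  set (B := eps / K * (2 * r * D)).
  assert (Rem : forall s x, t1 <= s <= t2 -> p1 <= x <= p2 ->
     Cmod (F s x - phi (zeta t p) - l * (zeta s x - zeta t p)) <= B).
  { intros s x Hs Hx. specialize (Z s x Hs Hx).
    eapply Rle_trans; [apply K1; lra|]. apply Rmult_le_compat_l; auto.
    apply Rlt_le, Rdiv_lt_0_compat; auto. }
  (* [G1] and [G2] are the contributions of the linear part [l * (zeta - zeta t p)] of [phi]; the
     constant part drops out of the differences. Both integrate to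
     [(t2 - t1) * l * (c p2 - c p1)]. *)
  set (G1 := fun x => (RtoC (t2 - t1) * l * (Ci * (r * cis x)))%C).
  set (G2 := fun s : R => (l * (c p2 - c p1))%C).
  assert (CG1 : continuous_on_C G1 p1 p2).
  { intros x _. repeat apply continuous_C_mult; try apply continuous_C_const. apply continuous_C_cis. }
  assert (CG2 : continuous_on_C G2 t1 t2) by (intros x _; apply continuous_C_const).
  assert (E1 : CInt G1 p1 p2 = (RtoC (t2 - t1) * l * (c p2 - c p1))%C).
  { transitivity ((RtoC (t2 - t1) * l * r) * cis p2 + 0 - ((RtoC (t2 - t1) * l * r) * cis p1 + 0))%C.
    2:{ unfold c. ring. }
    rewrite <- (CInt_derive (fun x => (RtoC (t2 - t1) * l * r) * cis x + 0)%C
              (fun x => (RtoC (t2 - t1) * l * r) * (Ci * cis x))%C); try lra.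
    - apply CInt_ext; [lra|]. intros x _. unfold G1. ring.
    - intros; apply has_rderiv_cis1.
    - intros x _. repeat apply continuous_C_mult; try apply continuous_C_const. apply continuous_C_cis. }
  assert (E2 : CInt G2 t1 t2 = (RtoC (t2 - t1) * l * (c p2 - c p1))%C).
  { rewrite (CInt_derive (fun s => RtoC s * (l * (c p2 - c p1)))%C); [|lra| |auto].
    - rewrite RtoC_minus. ring.
    - intros x _. unfold G2. split; simpl.
      + auto_derive; auto. ring.
      + auto_derive; auto. ring. }
  assert (EJ : J t1 t2 p1 p2 =
     (CInt (fun x => (F t2 x - F t1 x) * kap x - G1 x) p1 p2
      - CInt (fun s => (F s p2 - F s p1) * / RtoC s - G2 s) t1 t2)%C).
  { rewrite !CInt_minus; try lra; auto.
    - rewrite E1, E2. unfold J. ring.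
    - intros s Hs. apply cont_J2. lra.
    - intros x Hx. apply cont_J1; lra. }
  rewrite EJ. unfold Cminus at 1. eapply Rle_trans; [apply Cmod_triangle|]. rewrite Cmod_opp.
  assert (B0 : 0 <= B).
  { unfold B. apply Rmult_le_pos; [apply Rlt_le, Rdiv_lt_0_compat; auto|]. apply Rmult_le_pos; lra. }
  assert (I1 : Cmod (CInt (fun x => (F t2 x - F t1 x) * kap x - G1 x) p1 p2)%C <= (p2 - p1) * (2 * B * Kk)).
  { apply CInt_bound; [lra| |].
    - intros x Hx. apply continuous_C_minus; auto. apply cont_J1; lra.
    - intros x Hx.
      replace ((F t2 x - F t1 x) * kap x - G1 x)%C with
        (((F t2 x - phi (zeta t p) - l * (zeta t2 x - zeta t p))
          - (F t1 x - phi (zeta t p) - l * (zeta t1 x - zeta t p))) * kap x)%C.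
      2:{ unfold G1, kap, zeta. rewrite RtoC_minus. field. apply c_neq_0. }
      rewrite Cmod_mult. apply Rmult_le_compat; auto; try apply Cmod_ge_0.
      unfold Cminus at 1. eapply Rle_trans; [apply Cmod_triangle|]. rewrite Cmod_opp.
      pose proof (Rem t2 x ltac:(lra) Hx). pose proof (Rem t1 x ltac:(lra) Hx). lra. }
  assert (I2 : Cmod (CInt (fun s => (F s p2 - F s p1) * / RtoC s - G2 s) t1 t2)%C <= (t2 - t1) * (2 * B * / t0)).
  { apply CInt_bound; [lra| |].
    - intros x Hx. apply continuous_C_minus; auto. apply cont_J2; lra.
    - intros s Hs.
      assert (Ns : RtoC s <> 0). { apply (proj2 (Cmod_gt_0 _)). rewrite Cmod_R, Rabs_pos_eq; lra. }
      replace ((F s p2 - F s p1) * / RtoC s - G2 s)%C with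
        (((F s p2 - phi (zeta t p) - l * (zeta s p2 - zeta t p))
          - (F s p1 - phi (zeta t p) - l * (zeta s p1 - zeta t p))) * / RtoC s)%C.
      2:{ unfold G2, zeta. field. auto. }
      rewrite Cmod_mult, Cmod_inv, Cmod_R, Rabs_pos_eq by (auto; lra).
      apply Rmult_le_compat; try apply Cmod_ge_0.
      + apply Rlt_le, Rinv_0_lt_compat; lra.
      + unfold Cminus at 1. eapply Rle_trans; [apply Cmod_triangle|]. rewrite Cmod_opp.
        pose proof (Rem s p2 Hs ltac:(lra)). pose proof (Rem s p1 Hs ltac:(lra)). lra.
      + apply Rinv_le_contravar; lra. }
  apply Rle_trans with (D * (2 * B * (Kk + / t0))).
  { eapply Rle_trans; [apply Rplus_le_compat; [exact I1|exact I2]|].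
    unfold D.
    assert (0 <= 2 * B * Kk) by (apply Rmult_le_pos; lra).
    assert (0 <= 2 * B * / t0) by (apply Rmult_le_pos; lra). nra. }
  apply Req_le. unfold B, K. field. repeat split; try lra.
  intros Q. assert (0 < t0 * Kk) by (apply Rmult_lt_0_compat; lra). lra.
Qed.

(** The boundary integral over [[t0, 1] x [0, 2 PI]] vanishes, and its two radial sides carry the
    same values of [F] because [cis] is periodic. What remains compares two homothetic circles.
    Keeping [t0] positive avoids the pole of [/ t]. *)
Lemma cauchy_circle_scaling t0 : 0 < t0 <= 1 ->
  CInt (fun x => F 1 x * kap x)%C 0 (2 * PI) = CInt (fun x => F t0 x * kap x)%C 0 (2 * PI).
Proof.
  intros H0. pose proof PI_RGT_0 as HPI.
  assert (Z : J t0 1 0 (2 * PI) = 0).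
  { apply bisection_zero; try lra.
    - intros t1 t2 t3 p q A1 A2 A3 A4 A5 A6 A7. unfold J.
      rewrite <- (CInt_Chasles _ t1 t2 t3); [|lra|lra|intros s Hs; apply cont_J2; lra].
      rewrite (CInt_ext (fun x => (F t3 x - F t1 x) * kap x)%C
        (fun x => (F t2 x - F t1 x) * kap x + (F t3 x - F t2 x) * kap x)%C); [|lra|intros; ring].
      rewrite CInt_plus; [ring|lra| |]; intros x Hx; apply cont_J1; lra.
    - intros t1 t2 p1 p2 p3 A1 A2 A3 A4 A5 A6 A7. unfold J.
      rewrite <- (CInt_Chasles _ p1 p2 p3); [|lra|lra|intros s Hs; apply cont_J1; lra].
      rewrite (CInt_ext (fun s => (F s p3 - F s p1) * / RtoC s)%C
        (fun s => (F s p2 - F s p1) * / RtoC s + (F s p3 - F s p2) * / RtoC s)%C); [|lra|intros; ring].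
      rewrite CInt_plus; [ring|lra| |]; intros x Hx; apply cont_J2; lra.
    - intros t p Ht Hp eps He.
      destruct (cauchy_cell_local t0 t p) with (eps := eps) as [d [Hd K]]; try lra.
      exists d; split; auto. }
  unfold J in Z.
  assert (Z2 : CInt (fun t => (F t (2 * PI) - F t 0) * / RtoC t)%C t0 1 = 0).
  { rewrite (CInt_ext _ (fun _ => RtoC 0)).
    - rewrite (CInt_derive (fun _ => RtoC 0)); [ring|lra| |intros x _; apply continuous_C_const].
      intros; split; simpl; auto_derive; auto.
    - lra.
    - intros x _. unfold F, zeta, c.
      replace (cis (2 * PI)) with (cis 0).
      2:{ rewrite <- (cis_period 0 1). f_equal. simpl. ring. }
      ring. }
  rewrite Z2 in Z.
  rewrite (CInt_ext (fun x => (F 1 x - F t0 x) * kap x)%C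
    (fun x => F 1 x * kap x - F t0 x * kap x)%C) in Z; [|lra|intros; ring].
  rewrite CInt_minus in Z; [|lra| |].
  - set (a := CInt (fun x => F 1 x * kap x)%C 0 (2 * PI)) in *.
    set (b := CInt (fun x => F t0 x * kap x)%C 0 (2 * PI)) in *.
    replace a with (a - b - 0 + b)%C by ring. rewrite Z. ring.
  - intros x _. apply continuous_C_mult; auto. apply cont_F_r; lra.
  - intros x _. apply continuous_C_mult; auto. apply cont_F_r; lra.
Qed.

(** Shrinking the circle to its homothety centre [z0 + u] replaces [F t0] by the constant
    [phi (z0 + u)], by continuity. The integral of the kernel itself is left symbolic here and
    evaluated in [kernel_total]. *)
Lemma cauchy_formula_kernel :
  CInt (fun x => phi (z0 + r * cis x) * (r * cis x / (r * cis x - u)))%C 0 (2 * PI)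
  = (phi (z0 + u) * CInt (fun x => r * cis x / (r * cis x - u)) 0 (2 * PI))%C.
Proof.
  pose proof PI_RGT_0 as HPI.
  assert (M : CInt (fun x => F 1 x * kap x)%C 0 (2 * PI) = CInt (fun x => phi (z0 + u) * kap x)%C 0 (2 * PI)).
  { set (a := CInt (fun x => F 1 x * kap x)%C 0 (2 * PI)).
    set (b := CInt (fun x => phi (z0 + u) * kap x)%C 0 (2 * PI)).
    assert (D : Cmod (a - b) <= 0).
    { apply le_epsilon. intros e He. rewrite Rplus_0_l.
      destruct (Hphi (z0 + u)%C) as [l Hl].
      { replace (z0 + u - z0)%C with u by ring. lra. }
      assert (Q : 0 < 2 * PI * Kk) by (apply Rmult_lt_0_compat; lra).
      set (e1 := e / (2 * PI * Kk)).
      assert (He1 : 0 < e1) by (apply Rdiv_lt_0_compat; lra).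
      assert (X : exists d, 0 < d /\ forall z', Cmod (z' - (z0 + u)) < d -> Cmod (phi z' - phi (z0 + u)%C) <= e1).
      { destruct (Hl 1 ltac:(lra)) as [d [Hd K]].
        pose proof (Cmod_ge_0 l).
        exists (Rmin d (e1 / (1 + Cmod l))). split; [apply Rmin_pos; auto; apply Rdiv_lt_0_compat; lra|].
        intros z' Hz'.
        assert (L1 : Cmod (z' - (z0 + u)) < d) by (eapply Rlt_le_trans; [exact Hz'|apply Rmin_l]).
        assert (L2 : Cmod (z' - (z0 + u)) < e1 / (1 + Cmod l)) by (eapply Rlt_le_trans; [exact Hz'|apply Rmin_r]).
        specialize (K z' L1).
        replace (phi z' - phi (z0 + u))%C with
          ((phi z' - phi (z0 + u) - l * (z' - (z0 + u))) + l * (z' - (z0 + u)))%C by ring.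
        eapply Rle_trans; [apply Cmod_triangle|]. rewrite Cmod_mult.
        replace e1 with (e1 / (1 + Cmod l) * (1 + Cmod l)) by (field; lra). nra. }
      destruct X as [d [Hd K]].
      set (t0 := Rmin 1 (d / (4 * r))).
      assert (Ht0 : 0 < t0 <= 1).
      { split; [apply Rmin_pos; [lra|apply Rdiv_lt_0_compat; lra]|apply Rmin_l]. }
      unfold a, b. rewrite (cauchy_circle_scaling t0 Ht0).
      rewrite <- CInt_minus; [|lra| |].
      - replace e with ((2 * PI - 0) * (e1 * Kk)) by (unfold e1; field; lra).
        apply CInt_bound; [lra| |].
        + intros x _. apply continuous_C_minus; apply continuous_C_mult; auto; [apply cont_F_r; lra|apply continuous_C_const].
        + intros x _. replace (F t0 x * kap x - phi (z0 + u) * kap x)%C with ((F t0 x - phi (z0 + u)) * kap x)%C by ring.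
          rewrite Cmod_mult. apply Rmult_le_compat; auto; try apply Cmod_ge_0.
          apply K. unfold zeta. replace (z0 + u + t0 * c x - (z0 + u))%C with (t0 * c x)%C by ring.
          rewrite Cmod_mult, Cmod_R, Rabs_pos_eq by lra.
          pose proof (c_upper x).
          assert (t0 <= d / (4 * r)) by apply Rmin_r.
          apply Rle_lt_trans with (d / (4 * r) * (2 * r)).
          * apply Rmult_le_compat; try lra. apply Cmod_ge_0.
          * replace (d / (4 * r) * (2 * r)) with (d / 2) by (field; lra). lra.
      - intros x _. apply continuous_C_mult; auto. apply cont_F_r; lra.
      - intros x _. apply continuous_C_mult; auto. apply continuous_C_const. }
    assert (Cmod (a - b) = 0) by (apply Rle_antisym; auto; apply Cmod_ge_0).
    apply Cmod_eq_0 in H. replace a with (a - b + b)%C by ring. rewrite H. ring. }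
  assert (CE : forall x, continuous_C (fun x => r * cis x / (r * cis x - u))%C x).
  { intros x. apply continuous_C_mult.
    - apply continuous_C_mult; [apply continuous_C_const|apply continuous_C_cis].
    - apply (continuous_C_inv c); auto. }
  assert (N : forall f : R -> C, (forall x, continuous_C f x) -> CInt (fun x => f x * kap x)%C 0 (2 * PI)
     = (Ci * CInt (fun x => f x * (r * cis x / (r * cis x - u))) 0 (2 * PI))%C).
  { intros f Hf. rewrite <- CInt_scal; [|lra|].
    - apply CInt_ext; [lra|]. intros x _. unfold kap, c. field. apply c_neq_0.
    - intros x _. apply continuous_C_mult; auto. }
  rewrite N in M by (intros; apply cont_F_r; lra).
  rewrite (N (fun _ => phi (z0 + u)%C)) in M by (intros; apply continuous_C_const).
  assert (NCi : Ci <> 0). { apply (proj2 (Cmod_gt_0 _)). rewrite Cmod_Ci; lra. }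
  rewrite CInt_scal in M; [|lra|intros x _; auto].
  rewrite (CInt_ext _ (fun x => phi (z0 + r * cis x) * (r * cis x / (r * cis x - u)))%C) in M.
  - match goal with |- ?a = ?b => set (X := a) in *; set (Y := b) in * end.
    replace X with (/ Ci * (Ci * X))%C by (field; auto). rewrite M. field. auto.
  - lra.
  - intros x _. unfold F, zeta, c. f_equal. f_equal. ring.
Qed.

End Cauchy.

(** * Power series *)

Fixpoint psum (f : nat -> C) (n : nat) : C :=
  match n with O => 0 | S m => psum f m + f m end.

Definition csums (f : nat -> C) (l : C) : Prop :=
  forall eps, 0 < eps -> exists N, forall n, (N <= n)%nat -> Cmod (psum f n - l) < eps.

Lemma psum_S f n : psum f (S n) = (psum f n + f n)%C.
Proof. reflexivity. Qed.

Lemma psum_ext f g n : (forall k, f k = g k) -> psum f n = psum g n.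
Proof. intros H; induction n; simpl; rewrite ?IHn, ?H; auto. Qed.

Lemma psum_scal c f n : psum (fun k => c * f k)%C n = (c * psum f n)%C.
Proof. induction n; simpl; [|rewrite IHn]; ring. Qed.

Lemma csums_unique f l1 l2 : csums f l1 -> csums f l2 -> l1 = l2.
Proof.
  intros H1 H2.
  assert (Cmod (l1 - l2) = 0).
  { apply Rle_antisym; [|apply Cmod_ge_0]. apply le_epsilon. intros e He.
    destruct (H1 (e/2) ltac:(lra)) as [N1 K1]. destruct (H2 (e/2) ltac:(lra)) as [N2 K2].
    specialize (K1 (N1 + N2)%nat ltac:(lia)). specialize (K2 (N1 + N2)%nat ltac:(lia)).
    replace (l1 - l2)%C with (- (psum f (N1 + N2) - l1) + (psum f (N1 + N2) - l2))%C by ring.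
    eapply Rle_trans; [apply Cmod_triangle|]. rewrite Cmod_opp. lra. }
  apply Cmod_eq_0 in H. replace l1 with (l1 - l2 + l2)%C by ring. rewrite H; ring.
Qed.

Lemma csums_geometric_error f l K q : 0 <= q < 1 ->
  (forall n, Cmod (l - psum f n) <= K * q ^ n) -> csums f l.
Proof.
  intros Hq H e He.
  assert (K0 : 0 <= K). { specialize (H O). pose proof (Cmod_ge_0 (l - psum f 0)). simpl in *; lra. }
  destruct (pow_lt_1_zero q ltac:(rewrite Rabs_pos_eq; lra) (e / (K + 1))) as [N HN].
  { apply Rdiv_lt_0_compat; lra. }
  exists N. intros n Hn. specialize (HN n Hn).
  assert (0 <= q ^ n) by (apply pow_le; lra).
  rewrite Rabs_pos_eq in HN by auto.
  replace (psum f n - l)%C with (- (l - psum f n))%C by ring. rewrite Cmod_opp.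
  eapply Rle_lt_trans; [apply H|].
  apply Rle_lt_trans with ((K + 1) * q ^ n); [nra|].
  replace e with ((K + 1) * (e / (K + 1))) by (field; lra).
  apply Rmult_lt_compat_l; lra.
Qed.

Lemma csums_scal c f l : csums f l -> csums (fun k => c * f k)%C (c * l)%C.
Proof.
  intros H e He. pose proof (Cmod_ge_0 c).
  destruct (H (e / (Cmod c + 1))) as [N HN]; [apply Rdiv_lt_0_compat; lra|].
  exists N. intros n Hn. specialize (HN n Hn).
  rewrite psum_scal. replace (c * psum f n - c * l)%C with (c * (psum f n - l))%C by ring.
  rewrite Cmod_mult. pose proof (Cmod_ge_0 (psum f n - l)).
  apply Rle_lt_trans with ((Cmod c + 1) * Cmod (psum f n - l)); [nra|].
  replace e with ((Cmod c + 1) * (e / (Cmod c + 1))) by (field; lra).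
  apply Rmult_lt_compat_l; lra.
Qed.

Lemma csums_ext f g l : (forall k, f k = g k) -> csums f l -> csums g l.
Proof.
  intros E H e He. destruct (H e He) as [N HN]. exists N. intros n Hn.
  rewrite <- (psum_ext f g n E). auto.
Qed.

(** * Circle integrals *)

(** A Fourier coefficient without the factor [1 / (2 PI)]. *)
Definition circle_coef (g : R -> C) (k : nat) : C :=
  CInt (fun x => g x * cis (- INR k * x))%C 0 (2 * PI).

Lemma circle_coef_one k : circle_coef (fun _ => 1) k = if Nat.eqb k 0 then RtoC (2 * PI) else 0.
Proof.
  pose proof PI_RGT_0 as HPI. unfold circle_coef.
  destruct k as [|k].
  - simpl. rewrite (CInt_ext _ (fun _ => RtoC 1)); [|lra|].
    + rewrite (CInt_derive (fun x => RtoC x)); [|lra| |].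
      * rewrite <- RtoC_minus. f_equal. ring.
      * intros; split; simpl; auto_derive; auto.
      * intros x _. apply continuous_C_const.
    + intros x _. replace (-0 * x) with 0 by ring. rewrite cis_0. ring.
  - simpl Nat.eqb. cbv iota.
    set (a := - INR (S k)).
    assert (Ha : a <> 0). { unfold a. pose proof (lt_0_INR (S k) ltac:(lia)). lra. }
    assert (Hc : (RtoC a * Ci)%C <> 0).
    { apply (proj2 (Cmod_gt_0 _)). rewrite Cmod_mult, Cmod_Ci, Cmod_R, Rmult_1_r.
      apply Rabs_pos_lt; auto. }
    rewrite (CInt_ext _ (fun x => / (RtoC a * Ci) * (RtoC a * Ci * cis (a * x)))%C); [|lra|].
    + rewrite (CInt_derive (fun t => / (RtoC a * Ci) * cis (a * t) + 0)%C); [|lra| |].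
      * replace (cis (a * 0)) with (cis (a * (2 * PI))); [ring|].
        rewrite Rmult_0_r. rewrite <- (cis_period (a * (2 * PI)) (S k)). f_equal. unfold a; ring.
      * intros; apply has_rderiv_cis.
      * intros x _. repeat apply continuous_C_mult; try apply continuous_C_const. apply continuous_C_cis_scal.
    + intros x _. field. split; intros Q; apply Hc; rewrite Q; ring.
Qed.

Section Kernel.

Variables (r : R) (g : R -> C) (G : R).
Hypothesis Hr : 0 < r.
Hypothesis Hg : forall x, continuous_C g x.
Hypothesis HG : forall x, Cmod (g x) <= G.

Lemma kernel_lower (u : C) x : r - Cmod u <= Cmod (r * cis x - u).
Proof.
  assert (T := Cmod_triangle (r * cis x - u) u).
  replace (r * cis x - u + u)%C with (r * cis x)%C in T by ring.
  rewrite Cmod_mult, Cmod_cis, Cmod_R, Rabs_pos_eq in T by lra. lra.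
Qed.

Lemma kernel_neq_0 (u : C) x : Cmod u < r -> (r * cis x - u)%C <> 0.
Proof. intros Hu. apply (proj2 (Cmod_gt_0 _)). pose proof (kernel_lower u x). lra. Qed.

Lemma continuous_C_kernel (u : C) x : Cmod u < r -> continuous_C (fun x => / (r * cis x - u))%C x.
Proof.
  intros Hu. apply (continuous_C_inv (fun x => r * cis x - u)%C).
  - apply kernel_neq_0; auto.
  - apply continuous_C_minus; [apply continuous_C_mult|]; try apply continuous_C_const. apply continuous_C_cis.
Qed.

(** The kernel is [1 / (1 - (u / r) * cis (- x))]. Splitting off [n] terms of the geometric series
    leaves an exact remainder, namely [(u / r) ^ n] times an integral of the same kind, so no
    interchange of limit and integral occurs. *)
Lemma kernel_expansion (u : C) : Cmod u < r -> forall n,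
  Cmod (CInt (fun x => g x * (r * cis x / (r * cis x - u))) 0 (2 * PI)
        - psum (fun k => circle_coef g k * (u / r) ^ k) n)%C
    <= 2 * PI * (G * (r / (r - Cmod u))) * (Cmod u / r) ^ n.
Proof.
  intros Hu n. pose proof PI_RGT_0 as HPI.
  assert (Nr : RtoC r <> 0). { apply (proj2 (Cmod_gt_0 _)). rewrite Cmod_R, Rabs_pos_eq; lra. }
  assert (CE : forall m x, continuous_C (fun x => g x * cis (- INR m * x) * (r * cis x / (r * cis x - u)))%C x).
  { intros m x. apply continuous_C_mult; apply continuous_C_mult; auto.
    - apply continuous_C_cis_scal.
    - apply continuous_C_mult; [apply continuous_C_const|apply continuous_C_cis].
    - apply continuous_C_kernel; auto. }
  assert (Rec : forall n, CInt (fun x => g x * (r * cis x / (r * cis x - u)))%C 0 (2 * PI) =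
    (psum (fun k => circle_coef g k * (u / r) ^ k) n +
     (u / r) ^ n * CInt (fun x => g x * cis (- INR n * x) * (r * cis x / (r * cis x - u))) 0 (2 * PI))%C).
  { clear n. induction n as [|n IH].
    - simpl. rewrite (CInt_ext _ (fun x => g x * cis (- 0 * x) * (r * cis x / (r * cis x - u)))%C 0 (2 * PI)); [ring|lra|].
      intros x _. replace (- 0 * x) with 0 by ring. rewrite cis_0. ring.
    - rewrite IH. simpl psum.
      rewrite (CInt_ext (fun x => g x * cis (- INR n * x) * (r * cis x / (r * cis x - u)))%C
        (fun x => g x * cis (- INR n * x) + (u / r) * (g x * cis (- INR (S n) * x) * (r * cis x / (r * cis x - u))))%C);
        [|lra|].
      + rewrite CInt_plus, CInt_scal; try lra.
        * unfold circle_coef. simpl Cpow. ring.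
        * intros x _; auto.
        * intros x _. apply continuous_C_mult; auto. apply continuous_C_cis_scal.
        * intros x _. apply continuous_C_mult; [apply continuous_C_const|auto].
      + intros x _.
        assert (Ec : cis (- INR n * x) = (cis (- INR (S n) * x) * cis x)%C).
        { rewrite <- cis_plus. f_equal. rewrite S_INR. ring. }
        rewrite Ec. field. split; auto. apply kernel_neq_0; auto. }
  rewrite (Rec n).
  match goal with |- Cmod (?a + ?b * ?c - ?a)%C <= _ => replace (a + b * c - a)%C with (b * c)%C by ring end.
  rewrite Cmod_mult, Cmod_pow, Cmod_div, Cmod_R, (Rabs_pos_eq r) by (auto; lra).
  rewrite Rmult_comm. apply Rmult_le_compat_r.
  - apply pow_le. apply Rdiv_le_0_compat; [apply Cmod_ge_0|auto].
  - replace (2 * PI * (G * (r / (r - Cmod u)))) with ((2 * PI - 0) * (G * (r / (r - Cmod u)))) by ring.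
    apply CInt_bound; [lra| |]; [intros x _; auto|].
    intros x _. rewrite !Cmod_mult, Cmod_cis, Rmult_1_r.
    apply Rmult_le_compat; auto; try apply Cmod_ge_0.
    rewrite Cmod_div, Cmod_mult by (apply kernel_neq_0; auto).
    rewrite Cmod_cis, Cmod_R, Rabs_pos_eq, Rmult_1_r by lra.
    apply Rmult_le_compat_l; [lra|]. apply Rinv_le_contravar; [lra|apply kernel_lower]; auto.
Qed.

End Kernel.

(** The expansion applied to the constant function 1: all its circle coefficients vanish except the
    one of index 0. *)
Lemma kernel_total (r : R) (u : C) : Cmod u < r ->
  CInt (fun x => r * cis x / (r * cis x - u))%C 0 (2 * PI) = RtoC (2 * PI).
Proof.
  intros Hu. pose proof PI_RGT_0 as HPI. pose proof (Cmod_ge_0 u).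
  assert (H1 : csums (fun k => circle_coef (fun _ => 1) k * (u / r) ^ k)%C
    (CInt (fun x => r * cis x / (r * cis x - u))%C 0 (2 * PI))).
  { apply csums_geometric_error with (2 * PI * (1 * (r / (r - Cmod u)))) (Cmod u / r).
    - split; [apply Rdiv_le_0_compat; lra|]. apply Rlt_div_l; lra.
    - intros n. rewrite (CInt_ext _ (fun x => 1 * (r * cis x / (r * cis x - u)))%C); [|lra|intros; ring].
      apply (kernel_expansion r (fun _ => 1)); auto; try lra.
      + intros; apply continuous_C_const.
      + intros; rewrite Cmod_1; lra. }
  apply (csums_unique _ _ _ H1).
  intros e He. exists 1%nat. intros n Hn.
  assert (E : psum (fun k => circle_coef (fun _ => 1) k * (u / r) ^ k)%C n = RtoC (2 * PI)).
  { destruct n as [|n]; [lia|]. clear Hn. induction n.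
    - simpl. rewrite circle_coef_one. simpl Nat.eqb. cbv iota. ring.
    - simpl psum in *. rewrite IHn. rewrite circle_coef_one. simpl Nat.eqb. cbv iota. ring. }
  rewrite E. replace (RtoC (2 * PI) - RtoC (2 * PI))%C with (RtoC 0) by ring. rewrite Cmod_0; auto.
Qed.

(** Cauchy's integral for the k-th derivative divided by [k!]. It depends on [r] until it is
    identified with [taylor_fun]. *)
Definition taylor_coef (phi : C -> C) (z : C) (r : R) (k : nat) : C :=
  (/ RtoC (2 * PI) * / RtoC r ^ k * circle_coef (fun x => phi (z + r * cis x)) k)%C.

Section Taylor.

Variables (phi : C -> C) (z0 : C) (r M : R).
Hypothesis Hr : 0 < r.
Hypothesis Hphi : forall z, Cmod (z - z0) <= r -> exists l, has_cderiv phi z l.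
Hypothesis HM : forall z, Cmod (z - z0) <= r -> Cmod (phi z) <= M.

Let Hcirc x : Cmod (z0 + r * cis x - z0) <= r.
Proof.
  replace (z0 + r * cis x - z0)%C with (r * cis x)%C by ring.
  rewrite Cmod_mult, Cmod_cis, Cmod_R, Rabs_pos_eq by lra. lra.
Qed.

Lemma continuous_C_circle x : continuous_C (fun x => phi (z0 + r * cis x)%C) x.
Proof.
  destruct (Hphi _ (Hcirc x)) as [l Hl].
  apply (has_cderiv_continuous_comp phi (fun x => z0 + r * cis x)%C x l Hl).
  apply continuous_C_plus; [|apply continuous_C_mult]; try apply continuous_C_const. apply continuous_C_cis.
Qed.

Let g x := phi (z0 + r * cis x)%C.
Let Nr : RtoC r <> 0.
Proof. apply (proj2 (Cmod_gt_0 _)). rewrite Cmod_R, Rabs_pos_eq; lra. Qed.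
Let Npi : RtoC (2 * PI) <> 0.
Proof. pose proof PI_RGT_0. apply (proj2 (Cmod_gt_0 _)). rewrite Cmod_R, Rabs_pos_eq; lra. Qed.

Lemma cauchy_formula (u : C) : Cmod u < r ->
  phi (z0 + u)%C = (/ RtoC (2 * PI) * CInt (fun x => phi (z0 + r * cis x) * (r * cis x / (r * cis x - u))) 0 (2 * PI))%C.
Proof.
  intros Hu. rewrite (cauchy_formula_kernel phi z0 r u Hr Hu Hphi), kernel_total by auto.
  field. auto.
Qed.

Lemma taylor_expansion (u : C) : Cmod u < r ->
  csums (fun k => taylor_coef phi z0 r k * u ^ k)%C (phi (z0 + u)%C).
Proof.
  intros Hu. rewrite (cauchy_formula u Hu). pose proof (Cmod_ge_0 u).
  apply csums_ext with (fun k => / RtoC (2 * PI) * (circle_coef g k * (u / r) ^ k))%C.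
  - intros k. unfold taylor_coef, Cdiv. rewrite Cpow_mult_l. rewrite Cpow_inv by auto. fold g. ring.
  - apply csums_scal. apply csums_geometric_error with (2 * PI * (M * (r / (r - Cmod u)))) (Cmod u / r).
    + split; [apply Rdiv_le_0_compat; lra|]. apply Rlt_div_l; lra.
    + intros n. apply (kernel_expansion r g M Hr); auto.
      * intros x. apply continuous_C_circle.
      * intros x. apply HM, Hcirc.
Qed.

Lemma taylor_coef_0 : taylor_coef phi z0 r 0 = phi z0.
Proof.
  apply (csums_unique (fun k => taylor_coef phi z0 r k * 0 ^ k)%C).
  - intros e He. exists 1%nat. intros n Hn.
    assert (E : psum (fun k => taylor_coef phi z0 r k * 0 ^ k)%C n = taylor_coef phi z0 r 0).
    { destruct n as [|n]; [lia|]. clear Hn. induction n.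
      - simpl. ring.
      - simpl psum in *. rewrite IHn. simpl Cpow. ring. }
    rewrite E. replace (taylor_coef phi z0 r 0 - taylor_coef phi z0 r 0)%C with (RtoC 0) by ring.
    rewrite Cmod_0; auto.
  - replace (phi z0) with (phi (z0 + 0)%C) by (f_equal; ring).
    apply taylor_expansion. rewrite Cmod_0; auto.
Qed.

Lemma taylor_coef_bound k : Cmod (taylor_coef phi z0 r k) <= M / r ^ k.
Proof.
  pose proof PI_RGT_0 as HPI. unfold taylor_coef.
  rewrite !Cmod_mult, !Cmod_inv, Cmod_pow, !Cmod_R, !Rabs_pos_eq by (auto; try lra; apply Cpow_nz; auto).
  assert (B : Cmod (circle_coef (fun x => phi (z0 + r * cis x)%C) k) <= (2 * PI - 0) * M).
  { apply CInt_bound; [lra| |].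
    - intros x _. apply continuous_C_mult; [apply continuous_C_circle|apply continuous_C_cis_scal].
    - intros x _. rewrite Cmod_mult, Cmod_cis, Rmult_1_r. apply HM, Hcirc. }
  assert (Pr : 0 < r ^ k) by (apply pow_lt; auto).
  assert (0 < / (2 * PI) * / r ^ k).
  { apply Rmult_lt_0_compat; apply Rinv_0_lt_compat; lra. }
  replace (M / r ^ k) with (/ (2 * PI) * / r ^ k * ((2 * PI - 0) * M)) by (field; lra).
  apply Rmult_le_compat_l; lra.
Qed.

End Taylor.

(** * Derivatives of holomorphic functions *)

Lemma has_cderiv_quadratic f z l d K : 0 < d ->
  (forall z', Cmod (z' - z) < d -> Cmod (f z' - f z - l * (z' - z)) <= K * Cmod (z' - z) ^ 2) ->
  has_cderiv f z l.
Proof.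
  intros Hd H e He. pose proof (Rabs_pos K).
  exists (Rmin d (e / (Rabs K + 1))). split.
  - apply Rmin_pos; auto. apply Rdiv_lt_0_compat; lra.
  - intros z' Hz'.
    assert (L1 : Cmod (z' - z) < d) by (eapply Rlt_le_trans; [exact Hz'|apply Rmin_l]).
    assert (L2 : Cmod (z' - z) < e / (Rabs K + 1)) by (eapply Rlt_le_trans; [exact Hz'|apply Rmin_r]).
    eapply Rle_trans; [apply H; auto|].
    pose proof (Cmod_ge_0 (z' - z)). pose proof (Rle_abs K).
    assert (L3 : (Rabs K + 1) * Cmod (z' - z) <= e).
    { replace e with ((Rabs K + 1) * (e / (Rabs K + 1))) by (field; lra).
      apply Rmult_le_compat_l; lra. }
    simpl. rewrite Rmult_1_r. nra.
Qed.

Lemma has_cderiv_unique f z l1 l2 : has_cderiv f z l1 -> has_cderiv f z l2 -> l1 = l2.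
Proof.
  intros H1 H2.
  assert (E : Cmod (l1 - l2) = 0).
  { apply Rle_antisym; [|apply Cmod_ge_0]. apply le_epsilon. intros e He. rewrite Rplus_0_l.
    destruct (H1 (e/2) ltac:(lra)) as [d1 [D1 K1]]. destruct (H2 (e/2) ltac:(lra)) as [d2 [D2 K2]].
    set (h := Rmin d1 d2 / 2).
    assert (Hh : 0 < h). { unfold h. pose proof (Rmin_pos d1 d2 D1 D2). lra. }
    assert (h < d1). { unfold h in *. pose proof (Rmin_l d1 d2). lra. }
    assert (h < d2). { unfold h in *. pose proof (Rmin_r d1 d2). lra. }
    specialize (K1 (z + h)%C). specialize (K2 (z + h)%C).
    replace (z + h - z)%C with (RtoC h) in * by ring.
    rewrite Cmod_R, Rabs_pos_eq in * by lra.
    specialize (K1 ltac:(auto)). specialize (K2 ltac:(auto)).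
    assert (T := Cmod_triangle (f (z + h) - f z - l2 * h)%C (- (f (z + h) - f z - l1 * h))%C).
    replace (f (z + h) - f z - l2 * h + - (f (z + h) - f z - l1 * h))%C with ((l1 - l2) * h)%C in T by ring.
    rewrite Cmod_opp, Cmod_mult, Cmod_R, Rabs_pos_eq in T by lra.
    apply Rmult_le_reg_r with h; lra. }
  apply Cmod_eq_0 in E. replace l1 with (l1 - l2 + l2)%C by ring. rewrite E; ring.
Qed.

Lemma has_cderiv_local f g z l d : 0 < d -> (forall z', Cmod (z' - z) < d -> f z' = g z') ->
  has_cderiv f z l -> has_cderiv g z l.
Proof.
  intros Hd E H e He. destruct (H e He) as [d' [Hd' K]].
  exists (Rmin d d'). split; [apply Rmin_pos; auto|]. intros z' Hz'.
  assert (L1 : Cmod (z' - z) < d) by (eapply Rlt_le_trans; [exact Hz'|apply Rmin_l]).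
  assert (L2 : Cmod (z' - z) < d') by (eapply Rlt_le_trans; [exact Hz'|apply Rmin_r]).
  rewrite <- !E; auto. replace (z - z)%C with (RtoC 0) by ring. rewrite Cmod_0; auto.
Qed.

Lemma has_cderiv_scal c f z l : has_cderiv f z l -> has_cderiv (fun z => c * f z)%C z (c * l)%C.
Proof.
  intros H e He. pose proof (Cmod_ge_0 c).
  destruct (H (e / (Cmod c + 1))) as [d [Hd K]]; [apply Rdiv_lt_0_compat; lra|].
  exists d; split; auto. intros z' Hz'. specialize (K z' Hz').
  replace (c * f z' - c * f z - c * l * (z' - z))%C with (c * (f z' - f z - l * (z' - z)))%C by ring.
  rewrite Cmod_mult. pose proof (Cmod_ge_0 (z' - z)).
  apply Rle_trans with ((Cmod c + 1) * (e / (Cmod c + 1) * Cmod (z' - z))).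
  - apply Rmult_le_compat; auto; try apply Cmod_ge_0; lra.
  - apply Req_le. field. lra.
Qed.

Lemma has_cderiv_bounded f z l : has_cderiv f z l ->
  exists d M, 0 < d /\ forall z', Cmod (z' - z) < d -> Cmod (f z') <= M.
Proof.
  intros H. destruct (H 1 ltac:(lra)) as [d [Hd K]].
  exists d, (Cmod (f z) + (1 + Cmod l) * d). split; auto.
  intros z' Hz'. specialize (K z' Hz').
  replace (f z') with (f z + ((f z' - f z - l * (z' - z)) + l * (z' - z)))%C by ring.
  eapply Rle_trans; [apply Cmod_triangle|]. apply Rplus_le_compat_l.
  eapply Rle_trans; [apply Cmod_triangle|]. rewrite Cmod_mult.
  pose proof (Cmod_ge_0 l). pose proof (Cmod_ge_0 (z' - z)). nra.
Qed.

Section CauchyDerivative.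

Variables (phi : C -> C) (z0 : C) (r M : R).
Hypothesis Hr : 0 < r.
Hypothesis Hphi : forall z, Cmod (z - z0) <= r -> exists l, has_cderiv phi z l.
Hypothesis HM : forall z, Cmod (z - z0) <= r -> Cmod (phi z) <= M.

Let g x := phi (z0 + r * cis x)%C.
Let A (u : C) x := (r * cis x - u)%C.
Let I (h : R -> C) := CInt (fun x => g x * (r * cis x) * h x)%C 0 (2 * PI).
(** [D1] and [D2] come from differentiating Cauchy's formula under the integral sign with respect to
    [u], once at any [u] and twice at the centre. *)
Let D1 (u : C) := (/ RtoC (2 * PI) * I (fun x => / A u x * / A u x))%C.
Let D2 := (/ RtoC (2 * PI) * (2 * I (fun x => / A 0 x * / A 0 x * / A 0 x)))%C.

Let cont_A u x : Cmod u < r -> continuous_C (fun x => / A u x)%C x.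
Proof. intros; apply (continuous_C_kernel r); auto. Qed.

Let cont_g x : continuous_C (fun x => g x * (r * cis x))%C x.
Proof.
  apply continuous_C_mult; [apply continuous_C_circle; auto|].
  apply continuous_C_mult; [apply continuous_C_const|apply continuous_C_cis].
Qed.

Let I_minus h k : (forall x, continuous_C h x) -> (forall x, continuous_C k x) ->
  (I h - I k)%C = I (fun x => h x - k x)%C.
Proof.
  intros Hh Hk. pose proof PI_RGT_0. unfold I. rewrite <- CInt_minus; try lra.
  - apply CInt_ext; [lra|]. intros; ring.
  - intros x _; apply continuous_C_mult; auto.
  - intros x _; apply continuous_C_mult; auto.
Qed.

Let I_scal c h : (forall x, continuous_C h x) -> (c * I h)%C = I (fun x => c * h x)%C.
Proof.
  intros Hh. pose proof PI_RGT_0. unfold I. rewrite <- CInt_scal; try lra.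
  - apply CInt_ext; [lra|]. intros; ring.
  - intros x _; apply continuous_C_mult; auto.
Qed.

Let I_bound h B : (forall x, continuous_C h x) -> (forall x, Cmod (h x) <= B) ->
  Cmod (/ RtoC (2 * PI) * I h)%C <= M * r * B.
Proof.
  intros Hh HB. pose proof PI_RGT_0.
  assert (Npi : RtoC (2 * PI) <> 0). { apply (proj2 (Cmod_gt_0 _)). rewrite Cmod_R, Rabs_pos_eq; lra. }
  rewrite Cmod_mult, Cmod_inv, Cmod_R, Rabs_pos_eq by (auto; lra).
  assert (Cmod (I h) <= (2 * PI - 0) * (M * r * B)).
  { apply CInt_bound; [lra| |].
    - intros x _; apply continuous_C_mult; auto.
    - intros x _. rewrite !Cmod_mult, Cmod_cis, Cmod_R, Rabs_pos_eq, Rmult_1_r by lra.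
      assert (Cmod (g x) <= M).
      { apply HM. replace (z0 + r * cis x - z0)%C with (r * cis x)%C by ring.
        rewrite Cmod_mult, Cmod_cis, Cmod_R, Rabs_pos_eq by lra. lra. }
      pose proof (Cmod_ge_0 (g x)).
      apply Rmult_le_compat; auto; try apply Cmod_ge_0.
      + apply Rmult_le_pos; lra.
      + apply Rmult_le_compat_r; lra. }
  apply Rmult_le_reg_l with (2 * PI); [lra|].
  rewrite <- Rmult_assoc, Rinv_r, Rmult_1_l by lra. lra.
Qed.

Let inv_A_bound u x m : Cmod u < r -> 0 < m <= r - Cmod u -> Cmod (/ A u x) <= / m.
Proof.
  intros Hu Hm. pose proof (kernel_lower r Hr u x) as L.
  rewrite Cmod_inv by (apply kernel_neq_0; auto). apply Rinv_le_contravar; [lra|]. unfold A. lra.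
Qed.

(** The first-order remainder of [/ A u] under an increment [v] is exactly
    [v ^ 2 / ((A u) ^ 2 * A (u + v))]. For [|v| < m], half the distance from [u] to the circle, all
    denominators are at least [m], so the error is quadratic in [v]. *)
Lemma cauchy_derivative (u : C) : Cmod u < r -> has_cderiv phi (z0 + u)%C (D1 u).
Proof.
  intros Hu. set (m := (r - Cmod u) / 2). assert (Hm : 0 < m) by (unfold m; lra).
  apply has_cderiv_quadratic with m (M * r * (/ m * / m * / m)); auto.
  intros z' Hz'. set (v := (z' - (z0 + u))%C) in *.
  assert (Huv : Cmod (u + v) < r). { pose proof (Cmod_triangle u v). unfold m in *; lra. }
  assert (Huv2 : m <= r - Cmod (u + v)). { pose proof (Cmod_triangle u v). unfold m in *; lra. }
  assert (F : forall u, Cmod u < r -> phi (z0 + u)%C = (/ RtoC (2 * PI) * I (fun x => / A u x))%C).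
  { clear - Hr Hphi HM. intros u Hu. rewrite (cauchy_formula phi z0 r Hr Hphi u Hu).
    f_equal. apply CInt_ext; [pose proof PI_RGT_0; lra|]. intros x _. unfold g, A, Cdiv. ring. }
  replace z' with (z0 + (u + v))%C by (unfold v; ring).
  rewrite !F by auto. unfold D1.
  assert (CA1 : forall x, continuous_C (fun x => / A u x)%C x) by auto.
  assert (CA2 : forall x, continuous_C (fun x => / A (u + v) x)%C x) by auto.
  assert (CA3 : forall x, continuous_C (fun x => / A u x * / A u x)%C x) by (intros; apply continuous_C_mult; auto).
  assert (CA4 : forall x, continuous_C (fun x => v * (/ A u x * / A u x))%C x)
    by (intros; apply continuous_C_mult; auto; apply continuous_C_const).
  match goal with |- Cmod ?X <= _ =>
    replace X with (/ RtoC (2 * PI) * I (fun x => / A (u + v) x - / A u x - v * (/ A u x * / A u x)))%C end.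
  2:{ rewrite <- !I_minus, <- I_scal; auto; [ring|].
      intros; apply continuous_C_minus; auto. }
  eapply Rle_trans; [apply I_bound with (B := Cmod v ^ 2 * (/ m * / m * / m))|].
  - intros; repeat apply continuous_C_minus; auto.
  - intros x.
    replace (/ A (u + v) x - / A u x - v * (/ A u x * / A u x))%C
      with (v * v * (/ A u x * / A u x * / A (u + v) x))%C.
    2:{ unfold A. field. split; [apply kernel_neq_0; auto|].
        apply (kernel_neq_0 r Hr (u + v)); auto. }
    rewrite !Cmod_mult. simpl. rewrite Rmult_1_r.
    assert (B1 : Cmod (/ A u x) <= / m) by (apply inv_A_bound; auto; unfold m in *; lra).
    assert (B2 : Cmod (/ A (u + v) x) <= / m) by (apply inv_A_bound; auto; unfold m in *; lra).
    pose proof (Cmod_ge_0 v).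
    apply Rmult_le_compat_l; [apply Rmult_le_pos; auto|].
    apply Rmult_le_compat; auto; try apply Cmod_ge_0.
    + apply Rmult_le_pos; apply Cmod_ge_0.
    + apply Rmult_le_compat; auto; try apply Cmod_ge_0.
  - apply Req_le. ring.
Qed.

(** This shows that a derivative is itself differentiable; every point can be made the centre, so
    the centre is enough. The remainder is [v ^ 2 * (3 * A 0 - 2 * v) / ((A 0) ^ 3 * (A v) ^ 2)],
    and [4 * r] bounds the bracket because [|v| < r / 2]. *)
Lemma cauchy_second_derivative : has_cderiv (fun z => D1 (z - z0)%C) z0 D2.
Proof.
  set (m := r / 2). assert (Hm : 0 < m) by (unfold m; lra).
  apply has_cderiv_quadratic with m (M * r * ((4 * r) * (/ m * / m * / m * (/ m * / m)))); auto.
  intros z' Hz'. set (v := (z' - z0)%C) in *.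
  assert (Hv : Cmod v < r) by (unfold m in *; lra).
  assert (H0 : Cmod 0 < r) by (rewrite Cmod_0; auto).
  replace (z0 - z0)%C with (RtoC 0) by ring. unfold D1, D2.
  assert (C0 : forall x, continuous_C (fun x => / A 0 x)%C x) by auto.
  assert (Cv : forall x, continuous_C (fun x => / A v x)%C x) by auto.
  assert (C00 : forall x, continuous_C (fun x => / A 0 x * / A 0 x)%C x) by (intros; apply continuous_C_mult; auto).
  assert (C000 : forall x, continuous_C (fun x => / A 0 x * / A 0 x * / A 0 x)%C x) by (intros; apply continuous_C_mult; auto).
  assert (Cvv : forall x, continuous_C (fun x => / A v x * / A v x)%C x) by (intros; apply continuous_C_mult; auto).
  assert (C2 : forall x, continuous_C (fun x => (2 * v) * (/ A 0 x * / A 0 x * / A 0 x))%C x)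
    by (intros; apply continuous_C_mult; auto; apply continuous_C_const).
  match goal with |- Cmod ?X <= _ =>
    replace X with (/ RtoC (2 * PI) * I (fun x => / A v x * / A v x - / A 0 x * / A 0 x
       - (2 * v) * (/ A 0 x * / A 0 x * / A 0 x)))%C end.
  2:{ rewrite <- !I_minus, <- I_scal; auto; [ring|].
      intros; apply continuous_C_minus; auto. }
  eapply Rle_trans; [apply I_bound with (B := Cmod v ^ 2 * ((4 * r) * (/ m * / m * / m * (/ m * / m))))|].
  - intros; repeat apply continuous_C_minus; auto.
  - intros x.
    replace (/ A v x * / A v x - / A 0 x * / A 0 x - (2 * v) * (/ A 0 x * / A 0 x * / A 0 x))%C
      with (v * v * ((3 * A 0 x - 2 * v) * (/ A 0 x * / A 0 x * / A 0 x * (/ A v x * / A v x))))%C.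
    2:{ assert (N0 : A 0 x <> 0) by (apply kernel_neq_0; auto).
        assert (Nv : A v x <> 0) by (apply kernel_neq_0; auto).
        assert (EA : A v x = (A 0 x - v)%C) by (unfold A; ring).
        rewrite EA in *. field. auto. }
    rewrite !Cmod_mult. simpl. rewrite Rmult_1_r.
    assert (B1 : Cmod (/ A 0 x) <= / m) by (apply inv_A_bound; auto; rewrite Cmod_0; unfold m in *; lra).
    assert (B2 : Cmod (/ A v x) <= / m) by (apply inv_A_bound; auto; unfold m in *; lra).
    assert (B3 : Cmod (3 * A 0 x - 2 * v) <= 4 * r).
    { unfold Cminus. eapply Rle_trans; [apply Cmod_triangle|].
      rewrite Cmod_opp, !Cmod_mult, !Cmod_R. unfold A.
      replace (r * cis x - 0)%C with (r * cis x)%C by ring.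
      rewrite Cmod_mult, Cmod_cis, Cmod_R. rewrite !Rabs_pos_eq by lra. unfold m in *. lra. }
    pose proof (Cmod_ge_0 v). pose proof (Cmod_ge_0 (/ A 0 x)). pose proof (Cmod_ge_0 (/ A v x)).
    assert (0 <= / m) by (apply Rlt_le, Rinv_0_lt_compat; auto).
    apply Rmult_le_compat_l; [apply Rmult_le_pos; auto|].
    repeat (apply Rmult_le_compat; auto; try apply Cmod_ge_0; repeat apply Rmult_le_pos; auto).
  - apply Req_le. ring.
Qed.

End CauchyDerivative.

(** * Holomorphic functions on an open set *)

Definition open_C (U : C -> Prop) : Prop :=
  forall z, U z -> exists d, 0 < d /\ forall z', Cmod (z' - z) < d -> U z'.

Definition holo_on (U : C -> Prop) (f : C -> C) : Prop :=
  forall z, U z -> exists l, has_cderiv f z l.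

(** Choice turns the derivative into a total function, which can be iterated; where [f] has no
    derivative the value is arbitrary. *)
Definition cderiv (f : C -> C) (z : C) : C := epsilon (inhabits (RtoC 0)) (has_cderiv f z).

Lemma cderiv_correct U f z : holo_on U f -> U z -> has_cderiv f z (cderiv f z).
Proof. intros H Hz. unfold cderiv. apply epsilon_spec. auto. Qed.

(** On a small disc the chosen derivative agrees with the integral [D1], by uniqueness of
    derivatives, and [D1] is differentiable at the centre. The disc is also small enough for [f] to
    be bounded on it. *)
Lemma holo_on_cderiv U f : open_C U -> holo_on U f -> holo_on U (cderiv f).
Proof.
  intros HU Hf z0 Hz.
  destruct (HU z0 Hz) as [d1 [Hd1 K1]].
  destruct (Hf z0 Hz) as [l Hl].
  destruct (has_cderiv_bounded f z0 l Hl) as [d2 [M [Hd2 K2]]].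
  set (r := Rmin d1 d2 / 2).
  assert (Hr : 0 < r). { unfold r. pose proof (Rmin_pos d1 d2 Hd1 Hd2). lra. }
  assert (r < d1). { unfold r in *. pose proof (Rmin_l d1 d2). lra. }
  assert (r < d2). { unfold r in *. pose proof (Rmin_r d1 d2). lra. }
  assert (Hphi : forall z, Cmod (z - z0) <= r -> exists l, has_cderiv f z l).
  { intros z Hz'. apply Hf, K1. lra. }
  assert (HM : forall z, Cmod (z - z0) <= r -> Cmod (f z) <= M).
  { intros z Hz'. apply K2. lra. }
  eexists. eapply has_cderiv_local with (d := r); [auto| |exact (cauchy_second_derivative f z0 r M Hr Hphi HM)].
  intros z' Hz'. symmetry.
  apply has_cderiv_unique with f z'.
  - apply cderiv_correct with U; auto. apply K1. lra.
  - pose proof (cauchy_derivative f z0 r M Hr Hphi HM (z' - z0)%C Hz') as Q.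
    replace (z0 + (z' - z0))%C with z' in Q by ring. exact Q.
Qed.

(** * Derivatives along circles and the recursion for Taylor coefficients *)

Lemma is_derive_epsilon (f : R -> R) x l :
  (forall eps, 0 < eps -> exists d, 0 < d /\ forall y, Rabs (y - x) < d ->
     Rabs (f y - f x - l * (y - x)) <= eps * Rabs (y - x)) -> is_derive f x l.
Proof.
  intros H. apply is_derive_Reals. intros e He.
  destruct (H (e / 2) ltac:(lra)) as [d [Hd K]]. exists (mkposreal d Hd). intros h Hh Hhd. simpl in Hhd.
  specialize (K (x + h)). replace (x + h - x) with h in K by ring. specialize (K Hhd).
  assert (0 < Rabs h) by (apply Rabs_pos_lt; auto).
  replace ((f (x + h) - f x) / h - l) with ((f (x + h) - f x - l * h) / h) by (field; auto).
  unfold Rdiv. rewrite Rabs_mult, Rabs_inv.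
  apply Rmult_lt_reg_r with (Rabs h); auto. rewrite Rmult_assoc, Rinv_l, Rmult_1_r by lra. nra.
Qed.

Lemma has_rderiv_epsilon (f : R -> C) x l :
  (forall eps, 0 < eps -> exists d, 0 < d /\ forall y, Rabs (y - x) < d ->
     Cmod (f y - f x - l * RtoC (y - x)) <= eps * Rabs (y - x)) -> has_rderiv f x l.
Proof.
  intros H. split; apply is_derive_epsilon; intros e He; destruct (H e He) as [d [Hd K]];
    exists d; split; auto; intros y Hy; specialize (K y Hy);
    (eapply Rle_trans; [|exact K]);
    (eapply Rle_trans; [|apply Rmax_Cmod]); simpl.
  - eapply Rle_trans; [|apply Rmax_l]. apply Req_le. f_equal. ring.
  - eapply Rle_trans; [|apply Rmax_r]. apply Req_le. f_equal. ring.
Qed.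

Lemma cis_epsilon (k m : C) x eps : 0 < eps -> exists d, 0 < d /\ forall y, Rabs (y - x) < d ->
  Cmod (m + k * cis y - (m + k * cis x) - k * (Ci * cis x) * RtoC (y - x)) <= eps * Rabs (y - x).
Proof.
  intros He. set (e := eps / (2 * (Cmod k + 1))). pose proof (Cmod_ge_0 k).
  assert (He1 : 0 < e) by (apply Rdiv_lt_0_compat; lra).
  assert (Dc : derivable_pt_lim cos x (- sin x)) by (apply derivable_pt_lim_cos).
  assert (Ds : derivable_pt_lim sin x (cos x)) by (apply derivable_pt_lim_sin).
  assert (X : forall f l, derivable_pt_lim f x l -> exists d, 0 < d /\ forall y, Rabs (y - x) < d ->
     Rabs (f y - f x - l * (y - x)) <= e * Rabs (y - x)).
  { intros f l Hf. destruct (Hf e He1) as [d K]. exists d; split; [apply cond_pos|]. intros y Hy.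
    destruct (Req_dec y x) as [->|N].
    - replace (f x - f x - l * (x - x)) with 0 by ring. rewrite Rminus_diag, Rabs_R0. lra.
    - specialize (K (y - x) ltac:(lra) Hy). replace (x + (y - x)) with y in K by ring.
      replace (f y - f x - l * (y - x)) with (((f y - f x) / (y - x) - l) * (y - x)) by (field; lra).
      rewrite Rabs_mult. apply Rmult_le_compat_r; [apply Rabs_pos|lra]. }
  destruct (X _ _ Dc) as [d1 [H1 K1]]. destruct (X _ _ Ds) as [d2 [H2 K2]].
  exists (Rmin d1 d2); split; [apply Rmin_pos; auto|]. intros y Hy.
  specialize (K1 y ltac:(eapply Rlt_le_trans; [exact Hy|apply Rmin_l])).
  specialize (K2 y ltac:(eapply Rlt_le_trans; [exact Hy|apply Rmin_r])).
  replace (m + k * cis y - (m + k * cis x) - k * (Ci * cis x) * RtoC (y - x))%C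
    with (k * (RtoC (cos y - cos x - - sin x * (y - x)) + Ci * RtoC (sin y - sin x - cos x * (y - x))))%C.
  2:{ apply injective_projections; simpl; ring. }
  rewrite Cmod_mult.
  assert (T := Cmod_triangle (RtoC (cos y - cos x - - sin x * (y - x))) (Ci * RtoC (sin y - sin x - cos x * (y - x)))).
  rewrite Cmod_mult, Cmod_Ci, !Cmod_R in T.
  pose proof (Rabs_pos (y - x)).
  apply Rle_trans with ((Cmod k + 1) * (2 * e * Rabs (y - x))).
  - apply Rmult_le_compat; try apply Cmod_ge_0; lra.
  - apply Req_le. unfold e. field. lra.
Qed.

Lemma has_rderiv_circle (f : C -> C) (z k l : C) x :
  has_cderiv f (z + k * cis x)%C l ->
  has_rderiv (fun t => f (z + k * cis t)%C) x (l * (k * (Ci * cis x)))%C.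
Proof.
  intros H. apply has_rderiv_epsilon. intros e He.
  pose proof (Cmod_ge_0 l). pose proof (Cmod_ge_0 k).
  set (e1 := e / (2 * (Cmod k + 1))). assert (He1 : 0 < e1) by (apply Rdiv_lt_0_compat; lra).
  set (e2 := e / (2 * (Cmod l + 1))). assert (He2 : 0 < e2) by (apply Rdiv_lt_0_compat; lra).
  destruct (H e1 He1) as [d1 [Hd1 K1]].
  destruct (cis_epsilon k z x e2 He2) as [d2 [Hd2 K2]].
  exists (Rmin d2 (d1 / (Cmod k + 1))). split; [apply Rmin_pos; auto; apply Rdiv_lt_0_compat; lra|].
  intros y Hy.
  assert (L1 : Rabs (y - x) < d2) by (eapply Rlt_le_trans; [exact Hy|apply Rmin_l]).
  assert (L2 : Rabs (y - x) < d1 / (Cmod k + 1)) by (eapply Rlt_le_trans; [exact Hy|apply Rmin_r]).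
  specialize (K2 y L1). pose proof (Rabs_pos (y - x)).
  assert (L3 : Cmod (z + k * cis y - (z + k * cis x)) <= (Cmod k + 1) * Rabs (y - x)).
  { replace (z + k * cis y - (z + k * cis x))%C with (k * (cis y - cis x))%C by ring.
    rewrite Cmod_mult. apply Rmult_le_compat; try apply Cmod_ge_0; [lra|apply cis_lipschitz]. }
  assert (L4 : Cmod (z + k * cis y - (z + k * cis x)) < d1).
  { eapply Rle_lt_trans; [exact L3|]. replace d1 with ((Cmod k + 1) * (d1 / (Cmod k + 1))) by (field; lra).
    apply Rmult_lt_compat_l; lra. }
  specialize (K1 _ L4).
  set (G := (z + k * cis y)%C) in *. set (G0 := (z + k * cis x)%C) in *.
  replace (f G - f G0 - l * (k * (Ci * cis x)) * RtoC (y - x))%C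
    with ((f G - f G0 - l * (G - G0)) + l * (G - G0 - k * (Ci * cis x) * RtoC (y - x)))%C by ring.
  eapply Rle_trans; [apply Cmod_triangle|]. rewrite Cmod_mult.
  assert (M1 : e1 * Cmod (G - G0) <= e / 2 * Rabs (y - x)).
  { apply Rle_trans with (e1 * ((Cmod k + 1) * Rabs (y - x))); [apply Rmult_le_compat_l; lra|].
    apply Req_le. unfold e1. field. lra. }
  assert (M2 : Cmod l * Cmod (G - G0 - k * (Ci * cis x) * RtoC (y - x)) <= e / 2 * Rabs (y - x)).
  { apply Rle_trans with ((Cmod l + 1) * (e2 * Rabs (y - x))).
    - apply Rmult_le_compat; auto; try apply Cmod_ge_0; lra.
    - apply Req_le. unfold e2. field. lra. }
  lra.
Qed.

Lemma has_rderiv_mult f g x lf lg : has_rderiv f x lf -> has_rderiv g x lg ->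
  has_rderiv (fun t => f t * g t)%C x (lf * g x + f x * lg)%C.
Proof.
  intros [F1 F2] [G1 G2]. split; simpl.
  - replace (fst lf * fst (g x) - snd lf * snd (g x) + (fst (f x) * fst lg - snd (f x) * snd lg))
      with (minus (fst lf * fst (g x) + fst (f x) * fst lg) (snd lf * snd (g x) + snd (f x) * snd lg))
      by (unfold minus, plus, opp; simpl; ring).
    apply (is_derive_minus (fun t => fst (f t) * fst (g t)) (fun t => snd (f t) * snd (g t)));
      apply (is_derive_mult (K := R_AbsRing)); auto; intros; apply Rmult_comm.
  - replace (fst lf * snd (g x) + snd lf * fst (g x) + (fst (f x) * snd lg + snd (f x) * fst lg))
      with (plus (fst lf * snd (g x) + fst (f x) * snd lg) (snd lf * fst (g x) + snd (f x) * fst lg))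
      by (unfold plus; simpl; ring).
    apply (is_derive_plus (fun t => fst (f t) * snd (g t)) (fun t => snd (f t) * fst (g t)));
      apply (is_derive_mult (K := R_AbsRing)); auto; intros; apply Rmult_comm.
Qed.

(* Integration by parts around the circle. *)
Lemma taylor_coef_S U f z r k : open_C U -> holo_on U f -> 0 < r ->
  (forall z', Cmod (z' - z) <= r -> U z') ->
  taylor_coef f z r (S k) = (/ RtoC (INR (S k)) * taylor_coef (cderiv f) z r k)%C.
Proof.
  intros HU Hf Hr Hd. pose proof PI_RGT_0 as HPI.
  assert (Hcirc : forall x, Cmod (z + r * cis x - z) <= r).
  { intros x. replace (z + r * cis x - z)%C with (r * cis x)%C by ring.
    rewrite Cmod_mult, Cmod_cis, Cmod_R, Rabs_pos_eq by lra. lra. }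
  set (a := - INR (S k)).
  assert (Cf : forall x, continuous_C (fun x => f (z + r * cis x)%C) x).
  { intros x. apply continuous_C_circle; auto. }
  assert (Cdf : forall x, continuous_C (fun x => cderiv f (z + r * cis x)%C) x).
  { intros x. apply continuous_C_circle; auto. intros z' Hz'. apply holo_on_cderiv with U; auto. }
  (* The integrand is the derivative of [f (z + r * cis x) * cis (a * x)], which takes the same
     value at 0 and [2 PI] because [a] is an integer. *)
  assert (E : CInt (fun x => cderiv f (z + r * cis x) * (r * (Ci * cis x)) * cis (a * x)
     + f (z + r * cis x) * (RtoC a * Ci * cis (a * x)))%C 0 (2 * PI) = 0).
  { rewrite (CInt_derive (fun x => f (z + r * cis x) * cis (a * x))%C); [|lra| |].
    - replace (cis (2 * PI)) with (cis 0).
      2:{ rewrite <- (cis_period 0 1). f_equal. simpl. ring. }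
      replace (cis (a * (2 * PI))) with (cis (a * 0)); [ring|].
      rewrite Rmult_0_r. rewrite <- (cis_period (a * (2 * PI)) (S k)). f_equal. unfold a; ring.
    - intros x _. apply (has_rderiv_mult (fun x => f (z + r * cis x)%C) (fun x => cis (a * x))).
      + apply (has_rderiv_circle f z r). apply cderiv_correct with U; auto.
      + pose proof (has_rderiv_cis 1 0 a x) as Q.
        destruct Q as [Q1 Q2]. split.
        * apply is_derive_ext with (fun t => fst (1 * cis (a * t) + 0)%C); [intros; simpl; ring|].
          replace (fst (RtoC a * Ci * cis (a * x))%C) with (fst (1 * (RtoC a * Ci * cis (a * x)))%C); auto.
          simpl; ring.
        * apply is_derive_ext with (fun t => snd (1 * cis (a * t) + 0)%C); [intros; simpl; ring|].
          replace (snd (RtoC a * Ci * cis (a * x))%C) with (snd (1 * (RtoC a * Ci * cis (a * x)))%C); auto.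
          simpl; ring.
    - intros x _. apply continuous_C_plus.
      + apply continuous_C_mult; [apply continuous_C_mult; auto|apply continuous_C_cis_scal].
        repeat apply continuous_C_mult; try apply continuous_C_const. apply continuous_C_cis.
      + apply continuous_C_mult; auto. repeat apply continuous_C_mult; try apply continuous_C_const.
        apply continuous_C_cis_scal. }
  assert (Na : RtoC a <> 0).
  { apply (proj2 (Cmod_gt_0 _)). rewrite Cmod_R. apply Rabs_pos_lt. unfold a.
    pose proof (lt_0_INR (S k) ltac:(lia)). lra. }
  assert (Nr : RtoC r <> 0). { apply (proj2 (Cmod_gt_0 _)). rewrite Cmod_R, Rabs_pos_eq; lra. }
  assert (NCi : Ci <> 0). { apply (proj2 (Cmod_gt_0 _)). rewrite Cmod_Ci; lra. }
  assert (Npi : RtoC (2 * PI) <> 0). { apply (proj2 (Cmod_gt_0 _)). rewrite Cmod_R, Rabs_pos_eq; lra. }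
  set (g := fun x => f (z + r * cis x)%C) in *.
  set (dg := fun x => cderiv f (z + r * cis x)%C) in *.
  rewrite (CInt_ext _ (fun x => (r * Ci) * (dg x * cis (- INR k * x)) + (RtoC a * Ci) * (g x * cis (a * x)))%C) in E; [|lra|].
  2:{ intros x _. fold (dg x) (g x).
      assert (Ec : cis (- INR k * x) = (cis (a * x) * cis x)%C).
      { rewrite <- cis_plus. f_equal. unfold a. rewrite S_INR. ring. }
      rewrite Ec. ring. }
  assert (c1 : continuous_on_C (fun x => dg x * cis (- INR k * x))%C 0 (2 * PI)).
  { intros x _. apply continuous_C_mult; [apply Cdf|apply continuous_C_cis_scal]. }
  assert (c2 : continuous_on_C (fun x => g x * cis (a * x))%C 0 (2 * PI)).
  { intros x _. apply continuous_C_mult; [apply Cf|apply continuous_C_cis_scal]. }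
  rewrite CInt_plus, !CInt_scal in E; auto; try lra.
  2:{ intros x Hx. apply continuous_C_mult; [apply continuous_C_const|apply c1; auto]. }
  2:{ intros x Hx. apply continuous_C_mult; [apply continuous_C_const|apply c2; auto]. }
  set (X := CInt (fun x => dg x * cis (- INR k * x))%C 0 (2 * PI)) in *.
  set (Y := CInt (fun x => g x * cis (a * x))%C 0 (2 * PI)) in *.
  assert (EY : Y = (r * X * / (- RtoC a))%C).
  { replace Y with ((r * Ci * X + RtoC a * Ci * Y) * / (RtoC a * Ci) + r * X * / (- RtoC a))%C.
    - rewrite E. ring.
    - field. split; auto. }
  unfold taylor_coef.
  change (circle_coef (fun x => f (z + r * cis x)%C) (S k)) with Y.
  change (circle_coef (fun x => cderiv f (z + r * cis x)%C) k) with X.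
  rewrite EY. replace (RtoC (INR (S k))) with (- RtoC a)%C.
  2:{ unfold a. rewrite RtoC_opp. ring. }
  assert (Nk : (RtoC r ^ k)%C <> 0) by (apply Cpow_nz; auto).
  change (RtoC r ^ S k)%C with (RtoC r * RtoC r ^ k)%C. field. repeat split; auto.
Qed.

(** The Taylor coefficient as a function of the centre. Unlike [taylor_coef] it involves no radius,
    so it is a single holomorphic function on all of [U], to which a functional calculus can be
    applied. *)
Definition taylor_fun (f : C -> C) (k : nat) (z : C) : C :=
  (/ RtoC (INR (Factorial.fact k)) * Nat.iter k cderiv f z)%C.

Lemma holo_on_iter_cderiv U f k : open_C U -> holo_on U f -> holo_on U (Nat.iter k cderiv f).
Proof. intros HU Hf. induction k; simpl; auto. apply holo_on_cderiv; auto. Qed.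

Lemma holo_on_taylor_fun U f k : open_C U -> holo_on U f -> holo_on U (taylor_fun f k).
Proof.
  intros HU Hf z Hz. destruct (holo_on_iter_cderiv U f k HU Hf z Hz) as [l Hl].
  eexists. apply has_cderiv_scal. exact Hl.
Qed.

(** Each step of the induction trades one index for one derivative, so [f] is generalised and
    boundedness on the disc is assumed for every holomorphic function: the base case is reached at
    the k-th derivative. *)
Lemma taylor_coef_taylor_fun U f z r k : open_C U -> holo_on U f -> 0 < r ->
  (forall z', Cmod (z' - z) <= r -> U z') ->
  (forall g, holo_on U g -> exists M, forall z', Cmod (z' - z) <= r -> Cmod (g z') <= M) ->
  taylor_coef f z r k = taylor_fun f k z.
Proof.
  intros HU Hf Hr Hd Hb. revert f Hf. induction k as [|k IH]; intros f Hf.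
  - destruct (Hb f Hf) as [M HM].
    rewrite (taylor_coef_0 f z r M); auto. unfold taylor_fun. simpl. field.
  - rewrite (taylor_coef_S U); auto. rewrite IH by (apply holo_on_cderiv; auto).
    unfold taylor_fun. rewrite <- Nat.iter_succ_r.
    rewrite fact_simpl, mult_INR, RtoC_mult.
    assert (N : forall n, (0 < n)%nat -> RtoC (INR n) <> 0).
    { intros n Hn. apply (proj2 (Cmod_gt_0 _)). rewrite Cmod_R.
      apply Rabs_pos_lt, not_0_INR. lia. }
    field. split; apply N; [apply lt_O_fact|lia].
Qed.

Theorem holomorphic_taylor U f z r M : open_C U -> holo_on U f -> 0 < r ->
  (forall z', Cmod (z' - z) <= r -> U z') ->
  (forall g, holo_on U g -> exists B, forall z', Cmod (z' - z) <= r -> Cmod (g z') <= B) ->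
  (forall z', Cmod (z' - z) <= r -> Cmod (f z') <= M) ->
  (forall k, Cmod (taylor_fun f k z) <= M / r ^ k) /\
  (forall u, Cmod u < r -> csums (fun k => taylor_fun f k z * u ^ k)%C (f (z + u)%C)).
Proof.
  intros HU Hf Hr Hd Hb HM.
  assert (Hphi : forall z', Cmod (z' - z) <= r -> exists l, has_cderiv f z' l) by auto.
  split.
  - intros k. rewrite <- (taylor_coef_taylor_fun U f z r k); auto. apply taylor_coef_bound; auto.
  - intros u Hu. apply csums_ext with (fun k => taylor_coef f z r k * u ^ k)%C.
    + intros k. rewrite <- (taylor_coef_taylor_fun U f z r k); auto.
    + apply taylor_expansion with M; auto.
Qed.

(** * Unordered sums *)

Definition eq_dec_classic {T : Type} (x y : T) : {x = y} + {x <> y} := excluded_middle_informative (x = y).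

Definition undup {T : Type} (l : list T) : list T := nodup eq_dec_classic l.

Lemma NoDup_undup {T} (l : list T) : NoDup (undup l).
Proof. apply NoDup_nodup. Qed.

Lemma In_undup {T} (l : list T) x : In x (undup l) <-> In x l.
Proof. apply nodup_In. Qed.

Fixpoint rsum {T : Type} (f : T -> R) (l : list T) : R :=
  match l with nil => 0 | x :: l' => f x + rsum f l' end.

Fixpoint csum {T : Type} (f : T -> C) (l : list T) : C :=
  match l with nil => 0 | x :: l' => f x + csum f l' end.

Lemma rsum_app {T} (f : T -> R) l1 l2 : rsum f (l1 ++ l2) = rsum f l1 + rsum f l2.
Proof. induction l1; simpl; [|rewrite IHl1]; ring. Qed.

Lemma csum_app {T} (f : T -> C) l1 l2 : csum f (l1 ++ l2) = (csum f l1 + csum f l2)%C.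
Proof. induction l1; simpl; [|rewrite IHl1]; ring. Qed.

Lemma rsum_perm {T} (f : T -> R) l1 l2 : Permutation l1 l2 -> rsum f l1 = rsum f l2.
Proof. induction 1; simpl; lra. Qed.

Lemma csum_perm {T} (f : T -> C) l1 l2 : Permutation l1 l2 -> csum f l1 = csum f l2.
Proof. induction 1; simpl; [reflexivity|rewrite IHPermutation; auto|ring|congruence]. Qed.

Lemma rsum_ext {T} (f g : T -> R) l : (forall x, In x l -> f x = g x) -> rsum f l = rsum g l.
Proof. intros H; induction l; simpl; auto. rewrite H, IHl; simpl; auto. intros; apply H; simpl; auto. Qed.

Lemma csum_ext {T} (f g : T -> C) l : (forall x, In x l -> f x = g x) -> csum f l = csum g l.
Proof. intros H; induction l; simpl; auto. rewrite H, IHl; simpl; auto. intros; apply H; simpl; auto. Qed.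

Lemma rsum_le {T} (f g : T -> R) l : (forall x, In x l -> f x <= g x) -> rsum f l <= rsum g l.
Proof.
  intros H; induction l; simpl; [lra|]. apply Rplus_le_compat; [apply H; simpl; auto|].
  apply IHl. intros; apply H; simpl; auto.
Qed.

Lemma rsum_ge_0 {T} (f : T -> R) l : (forall x, 0 <= f x) -> 0 <= rsum f l.
Proof. intros H; induction l; simpl; [lra|]. specialize (H a). lra. Qed.

Lemma rsum_scal {T} c (f : T -> R) l : rsum (fun x => c * f x) l = c * rsum f l.
Proof. induction l; simpl; [|rewrite IHl]; ring. Qed.

Lemma csum_scal {T} c (f : T -> C) l : csum (fun x => c * f x)%C l = (c * csum f l)%C.
Proof. induction l; simpl; [|rewrite IHl]; ring. Qed.

Lemma rsum_plus {T} (f g : T -> R) l : rsum (fun x => f x + g x) l = rsum f l + rsum g l.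
Proof. induction l; simpl; [|rewrite IHl]; ring. Qed.

Lemma csum_plus {T} (f g : T -> C) l : csum (fun x => f x + g x)%C l = (csum f l + csum g l)%C.
Proof. induction l; simpl; [|rewrite IHl]; ring. Qed.

Lemma Cmod_csum {T} (f : T -> C) l : Cmod (csum f l) <= rsum (fun x => Cmod (f x)) l.
Proof.
  induction l; simpl; [rewrite Cmod_0; lra|].
  eapply Rle_trans; [apply Cmod_triangle|]. lra.
Qed.

Lemma rsum_swap {T U} (f : T -> U -> R) l m :
  rsum (fun x => rsum (f x) m) l = rsum (fun y => rsum (fun x => f x y) l) m.
Proof.
  induction l; simpl.
  - induction m; simpl; lra.
  - rewrite IHl, <- rsum_plus. reflexivity.
Qed.

Lemma csum_swap {T U} (f : T -> U -> C) l m :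
  csum (fun x => csum (f x) m) l = csum (fun y => csum (fun x => f x y) l) m.
Proof.
  induction l; simpl.
  - induction m; simpl; auto. rewrite <- IHm. ring.
  - rewrite IHl, <- csum_plus. reflexivity.
Qed.

Lemma rsum_map {T U} (h : T -> U) (f : U -> R) l : rsum f (map h l) = rsum (fun x => f (h x)) l.
Proof. induction l; simpl; auto. rewrite IHl; auto. Qed.

Lemma csum_map {T U} (h : T -> U) (f : U -> C) l : csum f (map h l) = csum (fun x => f (h x)) l.
Proof. induction l; simpl; auto. rewrite IHl; auto. Qed.

Lemma rsum_list_prod {T U} (f : T * U -> R) l m :
  rsum f (list_prod l m) = rsum (fun x => rsum (fun y => f (x, y)) m) l.
Proof. induction l; simpl; auto. rewrite rsum_app, rsum_map, IHl; auto. Qed.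

Lemma csum_list_prod {T U} (f : T * U -> C) l m :
  csum f (list_prod l m) = csum (fun x => csum (fun y => f (x, y)) m) l.
Proof. induction l; simpl; auto. rewrite csum_app, csum_map, IHl; auto. Qed.

Lemma csum_seq_psum (f : nat -> C) n : csum f (seq 0 n) = psum f n.
Proof.
  induction n; auto. rewrite seq_S, csum_app, IHn. simpl. ring.
Qed.

Lemma NoDup_incl_split {T} (l0 l : list T) : NoDup l0 -> incl l0 l ->
  exists l', Permutation l (l0 ++ l').
Proof.
  revert l. induction l0 as [|x l0 IH]; intros l N I.
  - exists l. simpl; auto.
  - inversion N as [|? ? Nx N0]; subst.
    destruct (in_split x l) as [l1 [l2 E]]; [apply I; simpl; auto|]. subst l.
    destruct (IH (l1 ++ l2) N0) as [l' P].
    + intros y Hy. assert (In y (l1 ++ x :: l2)) by (apply I; simpl; auto).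
      apply in_app_or in H. apply in_or_app. destruct H as [|[|]]; auto. subst; contradiction.
    + exists l'. simpl. rewrite <- P. symmetry. apply Permutation_middle.
Qed.

Lemma rsum_incl {T} (f : T -> R) l0 l : (forall x, 0 <= f x) -> NoDup l0 -> incl l0 l ->
  rsum f l0 <= rsum f l.
Proof.
  intros Hf N I. destruct (NoDup_incl_split l0 l N I) as [l' P].
  rewrite (rsum_perm f _ _ P), rsum_app. pose proof (rsum_ge_0 f l' Hf). lra.
Qed.

Lemma NoDup_list_prod {T U} (l : list T) (m : list U) : NoDup l -> NoDup m -> NoDup (list_prod l m).
Proof.
  intros Hl Hm. induction Hl as [|x l Hx Hl IH]; simpl; [constructor|].
  apply NoDup_app; auto.
  - apply FinFun.Injective_map_NoDup; auto. intros a b E. congruence.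
  - intros [a b] H1 H2. apply in_map_iff in H1. destruct H1 as [y [E _]]. inversion E; subst.
    apply in_prod_iff in H2. tauto.
Qed.

Definition bounded_sums {T : Type} (g : T -> R) (M : R) : Prop :=
  forall l, NoDup l -> rsum g l <= M.

(** Take [L0] with sum within [eps] of the supremum over all finite sets. A disjoint finite set adds
    to it without passing the supremum. *)
Lemma bounded_sums_tail {T} (g : T -> R) M : (forall x, 0 <= g x) -> bounded_sums g M ->
  forall eps, 0 < eps -> exists L0, NoDup L0 /\
    forall L, NoDup L -> (forall x, In x L -> ~ In x L0) -> rsum g L <= eps.
Proof.
  intros Hg HM eps He.
  destruct (completeness (fun y => exists l, NoDup l /\ y = rsum g l)) as [s [S1 S2]].
  - exists M. intros y [l [Nl ->]]. auto.
  - exists 0. exists nil. split; [constructor|reflexivity].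
  - assert (X : exists l, NoDup l /\ s - eps < rsum g l).
    { apply NNPP. intros N. assert (s <= s - eps); [|lra].
      apply S2. intros y [l [Nl ->]]. apply Rnot_lt_le. intros Q. apply N. eauto. }
    destruct X as [L0 [N0 H0]]. exists L0. split; auto.
    intros L NL D.
    assert (rsum g (L0 ++ L) <= s).
    { apply S1. exists (L0 ++ L). split; auto. apply NoDup_app; auto.
      intros x H1 H2. apply (D x); auto. }
    rewrite rsum_app in H. lra.
Qed.

(** Convergence along the finite subsets of an arbitrary index type, with duplicate-free lists in
    the role of finite sets. Reindexing, products and double series then need no enumeration. *)
Definition has_sum {T : Type} (f : T -> C) (v : C) : Prop :=
  forall eps, 0 < eps -> exists L0, forall L, NoDup L -> incl L0 L -> Cmod (csum f L - v) <= eps.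

Lemma has_sum_unique {T} (f : T -> C) u v : has_sum f u -> has_sum f v -> u = v.
Proof.
  intros Hu Hv.
  assert (E : Cmod (u - v) = 0).
  { apply Rle_antisym; [|apply Cmod_ge_0]. apply le_epsilon. intros e He. rewrite Rplus_0_l.
    destruct (Hu (e/2) ltac:(lra)) as [L1 K1]. destruct (Hv (e/2) ltac:(lra)) as [L2 K2].
    specialize (K1 (undup (L1 ++ L2)) (NoDup_undup _)). specialize (K2 (undup (L1 ++ L2)) (NoDup_undup _)).
    specialize (K1 ltac:(intros x Hx; apply In_undup, in_or_app; auto)).
    specialize (K2 ltac:(intros x Hx; apply In_undup, in_or_app; auto)).
    set (s := csum f (undup (L1 ++ L2))) in *.
    replace (u - v)%C with (- (s - u) + (s - v))%C by ring.
    eapply Rle_trans; [apply Cmod_triangle|]. rewrite Cmod_opp. lra. }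
  apply Cmod_eq_0 in E. replace u with (u - v + v)%C by ring. rewrite E; ring.
Qed.

Lemma has_sum_ext {T} (f g : T -> C) v : (forall x, f x = g x) -> has_sum f v -> has_sum g v.
Proof.
  intros E H e He. destruct (H e He) as [L0 K]. exists L0. intros L N I.
  rewrite <- (csum_ext f g L); auto.
Qed.

Lemma has_sum_plus {T} (f g : T -> C) u v : has_sum f u -> has_sum g v ->
  has_sum (fun x => f x + g x)%C (u + v)%C.
Proof.
  intros Hu Hv e He.
  destruct (Hu (e/2) ltac:(lra)) as [L1 K1]. destruct (Hv (e/2) ltac:(lra)) as [L2 K2].
  exists (L1 ++ L2). intros L N I.
  specialize (K1 L N (fun x Hx => I x (in_or_app _ _ _ (or_introl Hx)))).
  specialize (K2 L N (fun x Hx => I x (in_or_app _ _ _ (or_intror Hx)))).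
  rewrite csum_plus.
  replace (csum f L + csum g L - (u + v))%C with ((csum f L - u) + (csum g L - v))%C by ring.
  eapply Rle_trans; [apply Cmod_triangle|]. lra.
Qed.

Lemma has_sum_scal {T} c (f : T -> C) v : has_sum f v -> has_sum (fun x => c * f x)%C (c * v)%C.
Proof.
  intros H e He. pose proof (Cmod_ge_0 c).
  destruct (H (e / (Cmod c + 1))) as [L0 K]; [apply Rdiv_lt_0_compat; lra|].
  exists L0. intros L N I. specialize (K L N I). rewrite csum_scal.
  replace (c * csum f L - c * v)%C with (c * (csum f L - v))%C by ring. rewrite Cmod_mult.
  apply Rle_trans with ((Cmod c + 1) * (e / (Cmod c + 1))).
  - apply Rmult_le_compat; auto; try apply Cmod_ge_0. lra.
  - apply Req_le. field. lra.
Qed.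

Lemma has_sum_0 {T} : has_sum (fun _ : T => RtoC 0) 0.
Proof.
  intros e He. exists nil. intros L _ _.
  replace (csum (fun _ : T => RtoC 0) L) with (RtoC 0).
  - replace (0 - 0)%C with (RtoC 0) by ring. rewrite Cmod_0; lra.
  - induction L; simpl; auto. rewrite <- IHL. ring.
Qed.

Lemma has_sum_csum {T J} (F : J -> T -> C) (a : J -> C) js :
  (forall j, has_sum (F j) (a j)) -> has_sum (fun x => csum (fun j => F j x) js) (csum a js).
Proof. intros H. induction js; simpl; [apply has_sum_0|]. apply has_sum_plus; auto. Qed.

Lemma has_sum_uniform {T J} (F : J -> T -> C) (a : J -> C) js :
  (forall j, has_sum (F j) (a j)) -> forall eps, 0 < eps ->
  exists L0, forall L, NoDup L -> incl L0 L -> forall j, In j js -> Cmod (csum (F j) L - a j) <= eps.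
Proof.
  intros H e He. induction js as [|j js [L1 K1]].
  - exists nil. intros L _ _ j [].
  - destruct (H j e He) as [L2 K2]. exists (L1 ++ L2). intros L N I i [<-|Hi].
    + apply K2; auto. intros x Hx; apply I, in_or_app; auto.
    + apply K1; auto. intros x Hx; apply I, in_or_app; auto.
Qed.

Lemma has_sum_bound {T} (f : T -> C) v M : has_sum f v ->
  bounded_sums (fun x => Cmod (f x)) M -> Cmod v <= M.
Proof.
  intros H HM. apply le_epsilon. intros e He. destruct (H e He) as [L0 K].
  specialize (K (undup L0) (NoDup_undup _) ltac:(intros x Hx; apply In_undup; auto)).
  pose proof (HM _ (NoDup_undup L0)). pose proof (Cmod_csum f (undup L0)).
  replace v with (csum f (undup L0) + - (csum f (undup L0) - v))%C by ring.
  eapply Rle_trans; [apply Cmod_triangle|]. rewrite Cmod_opp. lra.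
Qed.

Lemma has_sum_finite {T} (f : T -> C) L0 : NoDup L0 -> (forall x, ~ In x L0 -> f x = 0) ->
  has_sum f (csum f L0).
Proof.
  intros N0 Z e He. exists L0. intros L NL I.
  destruct (NoDup_incl_split L0 L N0 I) as [l' P].
  rewrite (csum_perm f _ _ P), csum_app.
  assert (E : csum f l' = 0).
  { assert (N : NoDup (L0 ++ l')) by (eapply Permutation_NoDup; eauto).
    rewrite (csum_ext f (fun _ => RtoC 0)).
    - clear. induction l'; simpl; auto. rewrite IHl'; ring.
    - intros x Hx. apply Z. intros Hx0. clear - N Hx Hx0.
      induction L0; simpl in *; [auto|]. inversion N; subst. destruct Hx0 as [<-|]; auto.
      apply H1. apply in_or_app; auto. }
  rewrite E. replace (csum f L0 + 0 - csum f L0)%C with (RtoC 0) by ring. rewrite Cmod_0; lra.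
Qed.

(** The filter behind [has_sum]; it makes the Cauchy criterion for filters in a complete space
    available. *)
Definition net {T : Type} (P : list T -> Prop) : Prop :=
  exists L0, forall L, NoDup L -> incl L0 L -> P L.

Lemma net_filter {T} : ProperFilter (@net T).
Proof.
  constructor.
  - intros P [L0 H]. exists (undup L0). apply H; [apply NoDup_undup|].
    intros x Hx; apply In_undup; auto.
  - constructor.
    + exists nil; auto.
    + intros P Q [L1 H1] [L2 H2]. exists (L1 ++ L2). intros L N I. split; [apply H1|apply H2]; auto;
        intros x Hx; apply I, in_or_app; auto.
    + intros P Q H [L0 K]. exists L0; auto.
Qed.

Lemma has_sum_exists {T} (f : T -> C) M : bounded_sums (fun x => Cmod (f x)) M -> exists v, has_sum f v.
Proof.
  intros HM.
  destruct (proj1 (@filterlim_locally_cauchy (list T) C_CompleteNormedModule net net_filter (csum f))) as [v Hv].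
  - intros eps. pose proof (cond_pos eps) as He.
    destruct (bounded_sums_tail _ M (fun x => Cmod_ge_0 (f x)) HM (eps / 3)) as [L0 [N0 K]]; [lra|].
    exists (fun L => Cmod (csum f L - csum f L0) <= eps / 3). split.
    + exists L0. intros L NL I. destruct (NoDup_incl_split L0 L N0 I) as [l' P].
      rewrite (csum_perm f _ _ P), csum_app.
      replace (csum f L0 + csum f l' - csum f L0)%C with (csum f l') by ring.
      eapply Rle_trans; [apply Cmod_csum|].
      assert (N : NoDup (L0 ++ l')) by (eapply Permutation_NoDup; eauto).
      apply K.
      * clear - N. induction L0; simpl in *; auto. inversion N; auto.
      * intros x Hx Hx0. clear - N Hx Hx0.
        induction L0; simpl in *; [auto|]. inversion N; subst. destruct Hx0 as [<-|]; auto.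
        apply H1. apply in_or_app; auto.
    + intros u v Hu Hv. apply C_NormedModule_mixin_compat1.
      change (Cmod (csum f v - csum f u) < eps).
      replace (csum f v - csum f u)%C with ((csum f v - csum f L0) + - (csum f u - csum f L0))%C by ring.
      eapply Rle_lt_trans; [apply Cmod_triangle|]. rewrite Cmod_opp. lra.
  - exists v. intros e He.
    (* Balls of C come from the product structure on R x R and control the modulus only up to
       [sqrt 2]; the radius [e / 2] absorbs this factor. *)
    destruct (proj1 (@filterlim_locally _ C_NormedModule net (@filter_filter _ _ net_filter) (csum f) v) Hv
       (mkposreal (e / 2) ltac:(lra))) as [L0 K].
    exists L0. intros L N I. specialize (K L N I).
    apply C_NormedModule_mixin_compat2 in K. simpl in K.
    change (Cmod (csum f L - v) < sqrt 2 * (e / 2)) in K.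
    assert (sqrt 2 <= 2).
    { rewrite <- (sqrt_pow2 2) at 2 by lra. apply sqrt_le_1_alt. lra. }
    nra.
Qed.

(** * Fibres, products and double series *)

Definition restrict {T} (P : T -> Prop) (f : T -> C) (x : T) : C :=
  if excluded_middle_informative (P x) then f x else 0.

Lemma Cmod_restrict_le {T} (P : T -> Prop) (f : T -> C) x : Cmod (restrict P f x) <= Cmod (f x).
Proof.
  unfold restrict. destruct (excluded_middle_informative _); [lra|]. rewrite Cmod_0; apply Cmod_ge_0.
Qed.

Section Fibres.

Variables (T J : Type) (p : T -> J) (js : list J).
Hypothesis Njs : NoDup js.

Lemma csum_fibres (f : T -> C) x :
  csum (fun j => restrict (fun x => p x = j) f x) js = restrict (fun x => In (p x) js) f x.
Proof.
  induction js as [|j l IH]; simpl.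
  - unfold restrict. destruct (excluded_middle_informative False); tauto.
  - inversion Njs; subst. rewrite IH by auto. unfold restrict.
    destruct (excluded_middle_informative (p x = j)), (excluded_middle_informative (In (p x) l)),
      (excluded_middle_informative (j = p x \/ In (p x) l)); subst; try tauto; try ring; exfalso;
      intuition congruence.
Qed.

End Fibres.

(* Summation by fibres of [p]; Fubini's theorem is the case of a projection. *)
Lemma has_sum_fibres {T J} (p : T -> J) (f : T -> C) (a : J -> C) v :
  has_sum f v -> (forall j, has_sum (restrict (fun x => p x = j) f) (a j)) -> has_sum a v.
Proof.
  intros Hv Ha e He.
  destruct (Hv (e/2) ltac:(lra)) as [L0 K0].
  exists (map p L0). intros js Njs I.
  pose proof (has_sum_csum (fun j => restrict (fun x => p x = j) f) a js Ha) as HJ.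
  destruct (HJ (e/2) ltac:(lra)) as [L1 K1].
  set (L := undup (L0 ++ L1)).
  assert (NL : NoDup L) by apply NoDup_undup.
  specialize (K1 L NL ltac:(intros x Hx; apply In_undup, in_or_app; auto)).
  (* Keeping only the points of [L] above [js] turns the finitely many truncated fibre sums into one
     finite sum of [f], which still contains [L0]. *)
  set (P := fun x => if excluded_middle_informative (In (p x) js) then true else false).
  specialize (K0 (filter P L) (NoDup_filter _ NL)).
  assert (I0 : incl L0 (filter P L)).
  { intros x Hx. apply filter_In. split; [apply In_undup, in_or_app; auto|].
    unfold P. destruct (excluded_middle_informative _); auto. destruct n. apply I, in_map; auto. }
  specialize (K0 I0).
  assert (E : csum (fun x => csum (fun j => restrict (fun x => p x = j) f x) js) L = csum f (filter P L)).
  { rewrite (csum_ext _ (restrict (fun x => In (p x) js) f)) by (intros; apply csum_fibres; auto).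
    clear. induction L as [|x L IH]; simpl; auto. rewrite IH. unfold restrict, P.
    destruct (excluded_middle_informative _); simpl; auto. ring. }
  rewrite E in K1.
  replace (csum a js - v)%C with (- (csum f (filter P L) - csum a js) + (csum f (filter P L) - v))%C by ring.
  eapply Rle_trans; [apply Cmod_triangle|]. rewrite Cmod_opp. lra.
Qed.

(** The triangle inequality on each fibre: pushing coefficients forward along [p] does not increase
    the weighted norm, because the weight is constant on fibres. *)
Lemma bounded_sums_fibres {T J} (p : T -> J) (f : T -> C) (a : J -> C) (w : J -> R) M :
  (forall j, 0 <= w j) ->
  bounded_sums (fun x => Cmod (f x) * w (p x)) M ->
  (forall j, has_sum (restrict (fun x => p x = j) f) (a j)) ->
  bounded_sums (fun j => Cmod (a j) * w j) M.
Proof.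
  intros Hw HM Ha js Njs. apply le_epsilon. intros e He.
  set (W := rsum w js). assert (HW : 0 <= W) by (apply rsum_ge_0; auto).
  (* The fibre sums over [js] are truncated simultaneously with this error, so that the total
     weighted error is at most [e]. *)
  assert (He1 : 0 < e / (W + 1)) by (apply Rdiv_lt_0_compat; lra).
  destruct (has_sum_uniform _ a js Ha _ He1) as [L0 K].
  set (L := undup L0). assert (NL : NoDup L) by apply NoDup_undup.
  specialize (K L NL ltac:(intros x Hx; apply In_undup; auto)).
  apply Rle_trans with (rsum (fun j => rsum (fun x => Cmod (restrict (fun x => p x = j) f x) * w j) L
     + e / (W + 1) * w j) js).
  - apply rsum_le. intros j Hj. specialize (K j Hj).
    pose proof (Cmod_csum (restrict (fun x => p x = j) f) L) as B.
    set (s := csum (restrict (fun x => p x = j) f) L) in *.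
    assert (Cmod (a j) <= rsum (fun x => Cmod (restrict (fun x => p x = j) f x)) L + e / (W + 1)).
    { replace (a j) with (s + - (s - a j))%C by ring.
      eapply Rle_trans; [apply Cmod_triangle|]. rewrite Cmod_opp. lra. }
    rewrite (rsum_ext (fun x => Cmod (restrict (fun x => p x = j) f x) * w j)
      (fun x => w j * Cmod (restrict (fun x => p x = j) f x))) by (intros; ring).
    rewrite rsum_scal. specialize (Hw j). nra.
  - rewrite rsum_plus, rsum_scal. fold W. apply Rplus_le_compat.
    + rewrite rsum_swap. eapply Rle_trans; [|exact (HM L NL)]. apply rsum_le. intros x _.
      clear - Hw Njs. induction Njs as [|j js Hj Njs IH]; simpl.
      * apply Rmult_le_pos; auto; apply Cmod_ge_0.
      * unfold restrict at 1. destruct (excluded_middle_informative (p x = j)) as [E|N].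
        -- subst j.
           replace (rsum (fun y => Cmod (restrict (fun x0 => p x0 = y) f x) * w y) js) with 0; [lra|].
           clear - Hj. induction js as [|j js IH]; simpl in *; auto.
           rewrite <- IH by tauto. unfold restrict. destruct (excluded_middle_informative (p x = j)).
           ++ subst; tauto.
           ++ rewrite Cmod_0; ring.
        -- rewrite Cmod_0, Rmult_0_l, Rplus_0_l. apply IH.
    + apply Rle_trans with (e / (W + 1) * (W + 1)); [apply Rmult_le_compat_l; lra|].
      apply Req_le. field. lra.
Qed.

(** A finite set of pairs lies in a product of two finite sets, which bounds the double sums by
    [M * N] and gives some sum [s]. Its value is found by testing it on large products, where the
    finite sum factors. *)
Lemma has_sum_mult {T U} (f : T -> C) (g : U -> C) u v M N :
  bounded_sums (fun x => Cmod (f x)) M -> bounded_sums (fun y => Cmod (g y)) N ->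
  has_sum f u -> has_sum g v -> has_sum (fun q => f (fst q) * g (snd q))%C (u * v)%C.
Proof.
  intros HM HN Hu Hv.
  assert (HB : bounded_sums (fun q => Cmod (f (fst q) * g (snd q))%C) (M * N)).
  { intros l Nl.
    apply Rle_trans with (rsum (fun q => Cmod (f (fst q) * g (snd q))%C)
       (list_prod (undup (map fst l)) (undup (map snd l)))).
    - apply rsum_incl; auto; [intros; apply Cmod_ge_0|].
      intros [x y] Hxy. apply in_prod; apply In_undup.
      + change x with (fst (x, y)). apply in_map; auto.
      + change y with (snd (x, y)). apply in_map; auto.
    - rewrite rsum_list_prod. simpl.
      rewrite (rsum_ext _ (fun x => rsum (fun y => Cmod (g y)) (undup (map snd l)) * Cmod (f x))).
      + rewrite rsum_scal, Rmult_comm.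
        apply Rmult_le_compat; try (apply rsum_ge_0; intros; apply Cmod_ge_0).
        * apply HM, NoDup_undup.
        * apply HN, NoDup_undup.
      + intros x _. rewrite (rsum_ext _ (fun y => Cmod (f x) * Cmod (g y))) by (intros; apply Cmod_mult).
        rewrite rsum_scal. ring. }
  destruct (has_sum_exists _ _ HB) as [s Hs].
  assert (E : Cmod (s - u * v) = 0); [|apply Cmod_eq_0 in E; replace (u * v)%C with (s - (s - u * v))%C by ring; rewrite E; replace (s - 0)%C with s by ring; auto].
  apply Rle_antisym; [|apply Cmod_ge_0]. apply le_epsilon. intros e He. rewrite Rplus_0_l.
  pose proof (Cmod_ge_0 u). pose proof (Cmod_ge_0 v).
  set (A := Cmod u + Cmod v + 1). assert (HA : 0 < A) by (unfold A; lra).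
  (* With errors at most [d <= 1] in both factors, the product is off by at most
     [d * (|u| + |v| + 1) = d * A <= e / 2]. *)
  set (d := Rmin 1 (e / (2 * A))).
  assert (Hd : 0 < d) by (apply Rmin_pos; [lra|apply Rdiv_lt_0_compat; lra]).
  assert (D1 : d <= 1) by apply Rmin_l.
  assert (D2 : d * A <= e / 2).
  { apply Rle_trans with (e / (2 * A) * A); [apply Rmult_le_compat_r; [lra|apply Rmin_r]|].
    apply Req_le. field. lra. }
  destruct (Hs (e/2) ltac:(lra)) as [L0 K0].
  destruct (Hu d Hd) as [L1 K1]. destruct (Hv d Hd) as [L2 K2].
  set (A1 := undup (L1 ++ map fst L0)). set (A2 := undup (L2 ++ map snd L0)).
  specialize (K1 A1 (NoDup_undup _) ltac:(intros x Hx; apply In_undup, in_or_app; auto)).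
  specialize (K2 A2 (NoDup_undup _) ltac:(intros x Hx; apply In_undup, in_or_app; auto)).
  specialize (K0 (list_prod A1 A2) (NoDup_list_prod _ _ (NoDup_undup _) (NoDup_undup _))).
  assert (I0 : incl L0 (list_prod A1 A2)).
  { intros [x y] Hxy. apply in_prod; apply In_undup, in_or_app; right.
    - change x with (fst (x, y)). apply in_map; auto.
    - change y with (snd (x, y)). apply in_map; auto. }
  specialize (K0 I0). rewrite csum_list_prod in K0. simpl in K0.
  rewrite (csum_ext _ (fun x => csum g A2 * f x)%C) in K0 by (intros; rewrite csum_scal; ring).
  rewrite csum_scal in K0.
  set (a := csum f A1) in *. set (b := csum g A2) in *.
  replace (s - u * v)%C with (- (b * a - s) + ((a - u) * (b - v) + (u * (b - v) + (a - u) * v)))%C by ring.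
  eapply Rle_trans; [apply Cmod_triangle|]. rewrite Cmod_opp.
  eapply Rle_trans; [apply Rplus_le_compat_l, Cmod_triangle|].
  eapply Rle_trans; [apply Rplus_le_compat_l, Rplus_le_compat_l, Cmod_triangle|].
  rewrite !Cmod_mult. pose proof (Cmod_ge_0 (a - u)). pose proof (Cmod_ge_0 (b - v)).
  assert (Cmod (a - u) * Cmod (b - v) <= d * 1) by (apply Rmult_le_compat; lra).
  assert (Cmod u * Cmod (b - v) <= Cmod u * d) by (apply Rmult_le_compat_l; lra).
  assert (Cmod (a - u) * Cmod v <= d * Cmod v) by (apply Rmult_le_compat_r; lra).
  unfold A in D2. nra.
Qed.

(** The outer sum is given only as an ordered series. Absolute boundedness of the double family
    provides an unordered sum, and products of an initial segment of indices with a large finite set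
    identify the two. *)
Lemma has_sum_series {T} (F : nat -> T -> C) (s : nat -> C) v M :
  bounded_sums (fun q => Cmod (F (fst q) (snd q))) M ->
  (forall k, has_sum (F k) (s k)) -> csums s v -> has_sum (fun q => F (fst q) (snd q)) v.
Proof.
  intros HB Hs Hv.
  destruct (has_sum_exists _ _ HB) as [t Ht].
  assert (E : Cmod (t - v) = 0); [|apply Cmod_eq_0 in E; replace v with (t - (t - v))%C by ring; rewrite E; replace (t - 0)%C with t by ring; auto].
  apply Rle_antisym; [|apply Cmod_ge_0]. apply le_epsilon. intros e He. rewrite Rplus_0_l.
  destruct (Ht (e/3) ltac:(lra)) as [L0 K0].
  destruct (Hv (e/3) ltac:(lra)) as [N HN].
  set (K := (N + S (list_max (map fst L0)))%nat).
  specialize (HN K ltac:(lia)).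
  destruct (has_sum_csum F s (seq 0 K) Hs (e/3) ltac:(lra)) as [L1 K1].
  set (A := undup (L1 ++ map snd L0)).
  specialize (K1 A (NoDup_undup _) ltac:(intros x Hx; apply In_undup, in_or_app; auto)).
  specialize (K0 (list_prod (seq 0 K) A) (NoDup_list_prod _ _ (seq_NoDup _ _) (NoDup_undup _))).
  assert (I0 : incl L0 (list_prod (seq 0 K) A)).
  { intros [k y] Hxy. apply in_prod.
    - apply in_seq. split; [lia|].
      assert (Q : (k <= list_max (map fst L0))%nat).
      { pose proof (proj1 (list_max_le (map fst L0) _) (Nat.le_refl _)) as Q.
        rewrite Forall_forall in Q. apply Q. change k with (fst (k, y)). apply in_map; auto. }
      unfold K. lia.
    - apply In_undup, in_or_app; right. change y with (snd (k, y)). apply in_map; auto. }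
  specialize (K0 I0). rewrite csum_list_prod in K0. simpl in K0.
  rewrite csum_swap in K0. rewrite csum_seq_psum in K1.
  set (a := csum (fun x => csum (fun j => F j x) (seq 0 K)) A) in *.
  change (csum (fun y => csum (fun x => F x y) (seq 0 K)) A) with a in K0.
  replace (t - v)%C with (- (a - t) + ((a - psum s K) + (psum s K - v)))%C by ring.
  eapply Rle_trans; [apply Cmod_triangle|]. rewrite Cmod_opp.
  eapply Rle_trans; [apply Rplus_le_compat_l, Cmod_triangle|]. lra.
Qed.

(** * Weighted convolution algebras *)

Section WeightedAlgebra.

Variables (T X : Type) (mul : T -> T -> T) (one : T) (w : T -> R) (e : X -> T -> C).
Hypothesis w_ge_1 : forall p, 1 <= w p.
Hypothesis w_mul : forall p q, w (mul p q) <= w p * w q.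
Hypothesis e_one : forall x, e x one = 1.
Hypothesis e_mul : forall x p q, e x (mul p q) = (e x p * e x q)%C.
Hypothesis e_le_1 : forall x p, Cmod (e x p) <= 1.

(** [M] bounds the weighted l^1 norm of [a], and [f] is the transform of [a] on the characters
    [e x]. The support [S] is recorded because functions of a polynomial must keep their
    coefficients on one finitely generated semigroup. *)
Definition represents (S : T -> Prop) (a : T -> C) (f : X -> C) (M : R) : Prop :=
  (forall p, a p <> 0 -> S p) /\ bounded_sums (fun p => Cmod (a p) * w p) M /\
  forall x, has_sum (fun p => a p * e x p)%C (f x).

Definition in_algebra (S : T -> Prop) (f : X -> C) (M : R) : Prop := exists a, represents S a f M.

Let Cmod_term_le (c : C) x p : Cmod (c * e x p) <= Cmod c * w p.
Proof.
  rewrite Cmod_mult. pose proof (e_le_1 x p). pose proof (w_ge_1 p).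
  pose proof (Cmod_ge_0 (e x p)). apply Rmult_le_compat_l; [apply Cmod_ge_0|lra].
Qed.

Lemma bounded_sums_term {I} (c : I -> C) (g : I -> T) M x :
  bounded_sums (fun i => Cmod (c i) * w (g i)) M -> bounded_sums (fun i => Cmod (c i * e x (g i))%C) M.
Proof.
  intros H l N. eapply Rle_trans; [|exact (H l N)]. apply rsum_le. intros i _. apply Cmod_term_le.
Qed.

Lemma represents_bound S a f M x : represents S a f M -> Cmod (f x) <= M.
Proof.
  intros (_ & H2 & H3). apply has_sum_bound with (fun p => a p * e x p)%C; auto.
  apply (bounded_sums_term a (fun p => p)); auto.
Qed.

(** Terms with the same [g i] are merged into one coefficient, chosen as the sum over the fibre.
    Constants, products and series are the index types [unit], [T * T] and [nat * T]. *)
Lemma in_algebra_collect {I : Type} (S : T -> Prop) (c : I -> C) (g : I -> T) (f : X -> C) M :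
  (forall i, c i <> 0 -> S (g i)) -> bounded_sums (fun i => Cmod (c i) * w (g i)) M ->
  (forall x, has_sum (fun i => c i * e x (g i))%C (f x)) -> in_algebra S f M.
Proof.
  intros HS HB Hf.
  assert (HB0 : bounded_sums (fun i => Cmod (c i)) M).
  { intros l N. eapply Rle_trans; [|exact (HB l N)]. apply rsum_le. intros i _.
    pose proof (w_ge_1 (g i)). pose proof (Cmod_ge_0 (c i)). nra. }
  assert (Ex : forall p, exists v, has_sum (restrict (fun i => g i = p) c) v).
  { intros p. apply has_sum_exists with M. intros l N. eapply Rle_trans; [|exact (HB0 l N)].
    apply rsum_le. intros; apply Cmod_restrict_le. }
  set (a := fun p => proj1_sig (constructive_indefinite_description _ (Ex p))).
  assert (Ha : forall p, has_sum (restrict (fun i => g i = p) c) (a p)).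
  { intros p. exact (proj2_sig (constructive_indefinite_description _ (Ex p))). }
  exists a. repeat split.
  - intros p Hp. apply NNPP. intros NS. apply Hp.
    apply (has_sum_unique (restrict (fun i => g i = p) c)); auto.
    apply has_sum_ext with (fun _ => RtoC 0); [|apply has_sum_0].
    intros i. unfold restrict. destruct (excluded_middle_informative (g i = p)); auto.
    destruct (classic (c i = 0)); auto. subst p. destruct NS; auto.
  - apply (bounded_sums_fibres g c a w M); auto. intros j; pose proof (w_ge_1 j); lra.
  - intros x. apply has_sum_fibres with (p := g) (f := fun i => (c i * e x (g i))%C); auto.
    intros p. apply has_sum_ext with (fun i => e x p * restrict (fun i => g i = p) c i)%C.
    + intros i. unfold restrict. destruct (excluded_middle_informative (g i = p)); subst; ring.
    + rewrite Cmult_comm. apply has_sum_scal; auto.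
Qed.

Lemma in_algebra_ext S f g M : (forall x, f x = g x) -> in_algebra S f M -> in_algebra S g M.
Proof.
  intros E [a (H1 & H2 & H3)]. exists a. repeat split; auto. intros x. rewrite <- E. auto.
Qed.

Lemma in_algebra_weaken (S S' : T -> Prop) f M M' : (forall p, S p -> S' p) -> M <= M' ->
  in_algebra S f M -> in_algebra S' f M'.
Proof.
  intros HS HM [a (H1 & H2 & H3)]. exists a. repeat split; auto.
  intros l N. eapply Rle_trans; [exact (H2 l N)|auto].
Qed.

Lemma in_algebra_const (S : T -> Prop) c : S one -> in_algebra S (fun _ => c) (Cmod c * w one).
Proof.
  intros HS.
  apply (in_algebra_collect S (fun _ : unit => c) (fun _ => one)); auto.
  - intros l N. assert (l = nil \/ l = tt :: nil) as [->| ->].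
    { destruct l as [|[] [|[] l]]; auto. inversion N; subst. simpl in *; tauto. }
    + simpl. apply Rmult_le_pos; [apply Cmod_ge_0|]. pose proof (w_ge_1 one); lra.
    + simpl. lra.
  - intros x. pose proof (has_sum_finite (fun _ : unit => (c * e x one)%C) (tt :: nil)) as H.
    simpl in H. rewrite e_one in *. replace (c * 1 + 0)%C with c in H by ring. apply H.
    + constructor; [simpl; tauto|constructor].
    + intros [] Hn; destruct Hn; auto.
Qed.

Lemma in_algebra_mult (S : T -> Prop) f g M N : (forall p q, S p -> S q -> S (mul p q)) ->
  in_algebra S f M -> in_algebra S g N -> in_algebra S (fun x => f x * g x)%C (M * N).
Proof.
  intros HS [a (A1 & A2 & A3)] [b (B1 & B2 & B3)].
  apply (in_algebra_collect S (fun q : T * T => a (fst q) * b (snd q))%C (fun q => mul (fst q) (snd q))).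
  - intros [p q]; simpl. intros H. apply HS.
    + apply A1. intros E; apply H; rewrite E; ring.
    + apply B1. intros E; apply H; rewrite E; ring.
  - intros l Nl.
    set (G := fun q : T * T => Cmod (a (fst q)) * w (fst q) * (Cmod (b (snd q)) * w (snd q))).
    assert (G0 : forall q, 0 <= G q).
    { intros q. unfold G. pose proof (w_ge_1 (fst q)). pose proof (w_ge_1 (snd q)).
      repeat apply Rmult_le_pos; try apply Cmod_ge_0; lra. }
    apply Rle_trans with (rsum G l).
    { apply rsum_le. intros [p q] _. unfold G; simpl. rewrite Cmod_mult.
      pose proof (w_mul p q). pose proof (Cmod_ge_0 (a p)). pose proof (Cmod_ge_0 (b q)).
      assert (0 <= Cmod (a p) * Cmod (b q)) by (apply Rmult_le_pos; auto).
      apply Rle_trans with (Cmod (a p) * Cmod (b q) * (w p * w q)); [apply Rmult_le_compat_l; auto|].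
      apply Req_le; ring. }
    apply Rle_trans with (rsum G (list_prod (undup (map fst l)) (undup (map snd l)))).
    { apply rsum_incl; auto. intros [x y] Hxy. apply in_prod; apply In_undup.
      + change x with (fst (x, y)). apply in_map; auto.
      + change y with (snd (x, y)). apply in_map; auto. }
    rewrite rsum_list_prod. unfold G; simpl.
    rewrite (rsum_ext _ (fun p => rsum (fun q => Cmod (b q) * w q) (undup (map snd l)) * (Cmod (a p) * w p))).
    + rewrite rsum_scal, Rmult_comm. apply Rmult_le_compat.
      * apply rsum_ge_0. intros p. pose proof (w_ge_1 p). apply Rmult_le_pos; [apply Cmod_ge_0|lra].
      * apply rsum_ge_0. intros p. pose proof (w_ge_1 p). apply Rmult_le_pos; [apply Cmod_ge_0|lra].
      * apply A2, NoDup_undup.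
      * apply B2, NoDup_undup.
    + intros p _. rewrite rsum_scal. ring.
  - intros x.
    apply has_sum_ext with (fun q => (a (fst q) * e x (fst q)) * (b (snd q) * e x (snd q)))%C.
    + intros [p q]; simpl. rewrite e_mul. ring.
    + apply (has_sum_mult (fun p => a p * e x p)%C (fun p => b p * e x p)%C) with (M := M) (N := N); auto.
      * apply (bounded_sums_term a (fun p => p)); auto.
      * apply (bounded_sums_term b (fun p => p)); auto.
Qed.

(** The factor [w one] is the norm of the constant function 1, the power of exponent 0; a weight may
    exceed 1 at the identity. *)
Lemma in_algebra_pow (S : T -> Prop) f M k : S one -> (forall p q, S p -> S q -> S (mul p q)) ->
  in_algebra S f M -> in_algebra S (fun x => f x ^ k)%C (w one * M ^ k).
Proof.
  intros H1 HS Hf. induction k; simpl.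
  - apply in_algebra_weaken with (S := S) (M := Cmod 1 * w one); auto.
    + rewrite Cmod_1; lra.
    + apply in_algebra_const; auto.
  - replace (w one * (M * M ^ k)) with (M * (w one * M ^ k)) by ring.
    apply in_algebra_mult; auto.
Qed.

Lemma in_algebra_series (S : T -> Prop) (f : nat -> X -> C) (B : nat -> R) g M :
  (forall k, in_algebra S (f k) (B k)) -> (forall n, rsum B (seq 0 n) <= M) ->
  (forall x, csums (fun k => f k x) (g x)) -> in_algebra S g M.
Proof.
  intros Hf HB Hg.
  set (a := fun k => proj1_sig (constructive_indefinite_description _ (Hf k))).
  assert (Ha : forall k, represents S (a k) (f k) (B k)).
  { intros k. exact (proj2_sig (constructive_indefinite_description _ (Hf k))). }
  assert (HM : bounded_sums (fun q : nat * T => Cmod (a (fst q) (snd q)) * w (snd q)) M).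
  { intros l Nl.
    apply Rle_trans with (rsum (fun q : nat * T => Cmod (a (fst q) (snd q)) * w (snd q))
      (list_prod (seq 0 (Datatypes.S (list_max (map fst l)))) (undup (map snd l)))).
    - apply rsum_incl; auto.
      + intros [k p]; simpl. pose proof (w_ge_1 p). apply Rmult_le_pos; [apply Cmod_ge_0|lra].
      + intros [k y] Hxy. apply in_prod.
        * apply in_seq. split; [lia|].
          assert (Q : (k <= list_max (map fst l))%nat).
          { pose proof (proj1 (list_max_le (map fst l) _) (Nat.le_refl _)) as Q.
            rewrite Forall_forall in Q. apply Q. change k with (fst (k, y)). apply in_map; auto. }
          lia.
        * apply In_undup. change y with (snd (k, y)). apply in_map; auto.
    - rewrite rsum_list_prod. eapply Rle_trans; [|apply HB]. apply rsum_le. intros k _; simpl.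
      destruct (Ha k) as (_ & H & _). apply H, NoDup_undup. }
  apply (in_algebra_collect S (fun q : nat * T => a (fst q) (snd q)) snd); auto.
  - intros [k p]; simpl. apply Ha.
  - intros x. apply (has_sum_series (fun k p => a k p * e x p)%C (fun k => f k x) (g x) M); auto.
    + apply (bounded_sums_term (fun q : nat * T => a (fst q) (snd q)) snd). auto.
    + intros k. apply Ha.
Qed.

(** One constant [K] serves all [f]: the map sending [f] to [f] composed with [g] is bounded from
    the sup norm on [V] to the norm of the algebra. *)
Definition calculus_bound (U V : C -> Prop) (S : T -> Prop) (g : X -> C) (K : R) : Prop :=
  forall f B, holo_on U f -> (forall z, V z -> Cmod (f z) <= B) -> in_algebra S (fun x => f (g x)) (K * B).

(** * Perturbation of the functional calculus *)

Section Perturbation.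

Variables (U V : C -> Prop) (S : T -> Prop) (rho : R).
Hypothesis S_one : S one.
Hypothesis S_mul : forall p q, S p -> S q -> S (mul p q).
Hypothesis U_open : open_C U.
Hypothesis rho_pos : 0 < rho.
Hypothesis V_disc : forall z z', V z -> Cmod (z' - z) <= rho -> U z'.
Hypothesis V_bounded : forall f, holo_on U f ->
  exists M, forall z z', V z -> Cmod (z' - z) <= rho -> Cmod (f z') <= M.

(* Taylor expansion [f(g1) = sum_k f_k(g0) (g1 - g0)^k] inside the algebra; it
   converges because the bound [K] is uniform over all holomorphic functions. *)
Lemma in_algebra_perturbation g0 g1 K eps : (forall x, V (g0 x)) -> 0 <= K ->
  calculus_bound U V S g0 K -> 0 <= eps -> 2 * eps <= rho ->
  in_algebra S (fun x => g1 x - g0 x)%C eps ->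
  forall f, holo_on U f -> exists M, in_algebra S (fun x => f (g1 x)) M.
Proof.
  intros Hg0 HK Hc He Her Hd f Hf.
  destruct (V_bounded f Hf) as [M0 HM0].
  (* If [V] is empty, [M0] may be negative; the geometric estimate needs a nonnegative bound. *)
  set (M := Rabs M0).
  assert (HM : forall z z', V z -> Cmod (z' - z) <= rho -> Cmod (f z') <= M).
  { intros z z' Hz Hz'. eapply Rle_trans; [apply (HM0 z z'); auto|apply Rle_abs]. }
  assert (M0' : 0 <= M) by apply Rabs_pos.
  assert (Tay : forall z, V z -> (forall k, Cmod (taylor_fun f k z) <= M / rho ^ k) /\
    (forall u, Cmod u < rho -> csums (fun k => taylor_fun f k z * u ^ k)%C (f (z + u)%C))).
  { intros z Hz. apply (holomorphic_taylor U f z rho M); auto.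
    - intros z' Hz'. apply (V_disc z); auto.
    - intros g Hg. destruct (V_bounded g Hg) as [B HB]. exists B. intros z' Hz'. apply (HB z); auto.
    - intros z' Hz'. apply (HM z); auto. }
  pose proof (w_ge_1 one) as W1.
  (* The k-th term has norm at most [K * (M / rho ^ k) * (w one * eps ^ k)]. By [2 * eps <= rho]
     this is dominated by a geometric series of ratio 1/2, whose sum is at most 2. *)
  exists (2 * (K * M * w one)).
  apply in_algebra_series with
    (f := fun k x => (taylor_fun f k (g0 x) * (g1 x - g0 x) ^ k)%C)
    (B := fun k => K * M * w one * (/ 2) ^ k).
  - intros k.
    apply in_algebra_weaken with (S := S) (M := K * (M / rho ^ k) * (w one * eps ^ k)); auto.
    + assert (Pr : 0 < rho ^ k) by (apply pow_lt; auto).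
      replace (K * (M / rho ^ k) * (w one * eps ^ k)) with (K * M * w one * (eps ^ k / rho ^ k))
        by (field; lra).
      apply Rmult_le_compat_l; [repeat apply Rmult_le_pos; lra|].
      replace (eps ^ k / rho ^ k) with ((eps / rho) ^ k).
      * apply pow_incr. split; [apply Rdiv_le_0_compat; auto|].
        apply Rmult_le_reg_r with rho; auto. unfold Rdiv. rewrite Rmult_assoc, Rinv_l, Rmult_1_r by lra. lra.
      * unfold Rdiv. rewrite Rpow_mult_distr, pow_inv. reflexivity.
    + apply in_algebra_mult; auto.
      * apply (Hc (taylor_fun f k)); [apply holo_on_taylor_fun; auto|]. intros z Hz. apply Tay; auto.
      * apply in_algebra_pow; auto.
  - intros n. rewrite rsum_scal.
    assert (G : forall n, rsum (fun k => (/ 2) ^ k) (seq 0 n) = 2 - 2 * (/ 2) ^ n).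
    { clear. induction n; [simpl; ring|]. rewrite seq_S, rsum_app, IHn. simpl. field. }
    rewrite G. assert (0 <= (/ 2) ^ n) by (apply pow_le; lra).
    assert (0 <= K * M * w one) by (repeat apply Rmult_le_pos; lra). nra.
  - intros x. destruct Hd as [a Ha]. pose proof (represents_bound _ _ _ _ x Ha) as B.
    destruct (Tay (g0 x) (Hg0 x)) as [_ Q]. specialize (Q (g1 x - g0 x)%C ltac:(lra)).
    replace (g0 x + (g1 x - g0 x))%C with (g1 x) in Q by ring. exact Q.
Qed.

End Perturbation.

Lemma calculus_bound_const U V (S : T -> Prop) c : S one -> V c -> calculus_bound U V S (fun _ => c) (w one).
Proof.
  intros HS Hc f B _ HB.
  apply in_algebra_weaken with (S := S) (M := Cmod (f c) * w one); auto.
  - pose proof (w_ge_1 one). specialize (HB c Hc). nra.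
  - apply (in_algebra_const S (f c)); auto.
Qed.

End WeightedAlgebra.

(** * Characters of N^2 *)

(* The pair [(i, j)] stands for the element [(i + 1, j + 1)] of N^2. *)
Definition mulp (p q : nat * nat) : nat * nat :=
  (pred (S (fst p) * S (fst q)), pred (S (snd p) * S (snd q))).
Definition onep : nat * nat := (O, O).
Definition powp (p : nat * nat) (k : nat) : nat * nat := Nat.iter k (mulp p) onep.
Definition wt (w : nat -> nat -> R) (p : nat * nat) : R := w (S (fst p)) (S (snd p)).
Definition nrm (p : nat * nat) : R := INR (S (fst p) * S (snd p)).

Definition bihalf : Type := { s : C * C | inH (fst s) /\ inH (snd s) }.
Definition ev (x : bihalf) (p : nat * nat) : C :=
  (npow_neg (S (fst p)) (fst (proj1_sig x)) * npow_neg (S (snd p)) (snd (proj1_sig x)))%C.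

Lemma S_fst_mulp p q : S (fst (mulp p q)) = (S (fst p) * S (fst q))%nat.
Proof. unfold mulp; simpl. lia. Qed.
Lemma S_snd_mulp p q : S (snd (mulp p q)) = (S (snd p) * S (snd q))%nat.
Proof. unfold mulp; simpl. lia. Qed.

Lemma pair_S_eq (p q : nat * nat) : S (fst p) = S (fst q) -> S (snd p) = S (snd q) -> p = q.
Proof. destruct p, q; simpl. intros; f_equal; lia. Qed.

Lemma mulp_assoc p q r : mulp p (mulp q r) = mulp (mulp p q) r.
Proof. apply pair_S_eq; rewrite ?S_fst_mulp, ?S_snd_mulp; lia. Qed.
Lemma mulp_comm p q : mulp p q = mulp q p.
Proof. apply pair_S_eq; rewrite ?S_fst_mulp, ?S_snd_mulp; lia. Qed.
Lemma mulp_one_l p : mulp onep p = p.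
Proof. apply pair_S_eq; rewrite ?S_fst_mulp, ?S_snd_mulp; simpl; lia. Qed.

Lemma powp_S p k : powp p (S k) = mulp p (powp p k).
Proof. reflexivity. Qed.
Lemma powp_plus p k m : powp p (k + m) = mulp (powp p k) (powp p m).
Proof.
  induction k; [symmetry; apply mulp_one_l|].
  change (S k + m)%nat with (S (k + m)). rewrite !powp_S, IHk, mulp_assoc. reflexivity.
Qed.
Lemma S_fst_powp p k : S (fst (powp p k)) = (S (fst p) ^ k)%nat.
Proof. induction k; [reflexivity|]. rewrite powp_S, S_fst_mulp, IHk. reflexivity. Qed.
Lemma S_snd_powp p k : S (snd (powp p k)) = (S (snd p) ^ k)%nat.
Proof. induction k; [reflexivity|]. rewrite powp_S, S_snd_mulp, IHk. reflexivity. Qed.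

Lemma nrm_ge_1 p : 1 <= nrm p.
Proof. unfold nrm. replace 1 with (INR 1) by reflexivity. apply le_INR. lia. Qed.

Lemma nrm_ge_2 p : p <> onep -> 2 <= nrm p.
Proof.
  intros H. unfold nrm. replace 2 with (INR 2) by reflexivity. apply le_INR.
  destruct p as [[|i] [|j]]; simpl in *; try lia. destruct H; reflexivity.
Qed.

Lemma nrm_mulp p q : nrm (mulp p q) = nrm p * nrm q.
Proof. unfold nrm. rewrite <- mult_INR, S_fst_mulp, S_snd_mulp. f_equal. lia. Qed.

(** Multiplying the coefficients by [decay t] translates both variables by [t]. For negative [t] the
    translated point may leave the half planes, and only this description on coefficients
    remains. *)
Definition decay (t : R) (p : nat * nat) : R := Rpower (nrm p) (- t).

Lemma decay_pos t p : 0 < decay t p.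
Proof. apply exp_pos. Qed.

Lemma decay_mulp t p q : decay t (mulp p q) = decay t p * decay t q.
Proof.
  unfold decay. rewrite nrm_mulp. pose proof (nrm_ge_1 p). pose proof (nrm_ge_1 q).
  symmetry. apply Rpower_mult_distr; lra.
Qed.

Lemma decay_plus t s p : decay (t + s) p = decay t p * decay s p.
Proof. unfold decay. rewrite <- Rpower_plus. f_equal. ring. Qed.

Lemma decay_0 p : decay 0 p = 1.
Proof. unfold decay. rewrite Ropp_0. apply Rpower_O. pose proof (nrm_ge_1 p); lra. Qed.

Lemma decay_onep t : decay t onep = 1.
Proof. unfold decay, nrm, onep; simpl. unfold Rpower. rewrite ln_1, Rmult_0_r. apply exp_0. Qed.

Lemma npow_neg_cis n s : npow_neg n s = (RtoC (Rpower (INR n) (- fst s)) * cis (- snd s * ln (INR n)))%C.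
Proof. unfold npow_neg, cis. apply injective_projections; simpl; ring. Qed.

Lemma npow_neg_mult m n s : (1 <= m)%nat -> (1 <= n)%nat ->
  npow_neg (m * n) s = (npow_neg m s * npow_neg n s)%C.
Proof.
  intros Hm Hn. apply le_INR in Hm, Hn. simpl in Hm, Hn. rewrite !npow_neg_cis.
  rewrite mult_INR, <- Rpower_mult_distr, ln_mult by lra.
  rewrite RtoC_mult, Rmult_plus_distr_l, cis_plus. ring.
Qed.

Lemma npow_neg_1 s : npow_neg 1 s = 1.
Proof.
  rewrite npow_neg_cis. simpl. rewrite ln_1, Rmult_0_r, cis_0. unfold Rpower.
  rewrite ln_1, Rmult_0_r, exp_0. ring.
Qed.

Lemma Cmod_npow_neg_le n s : (1 <= n)%nat -> inH s -> Cmod (npow_neg n s) <= 1.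
Proof.
  intros Hn Hs. unfold inH in Hs. apply le_INR in Hn. simpl in Hn.
  rewrite npow_neg_cis, Cmod_mult, Cmod_cis, Cmod_R, Rmult_1_r.
  rewrite Rabs_pos_eq by (apply Rlt_le, exp_pos).
  rewrite <- (Rpower_O (INR n)) by lra.
  apply Rle_Rpower; lra.
Qed.

Lemma ev_one x : ev x onep = 1.
Proof. unfold ev; simpl. rewrite !npow_neg_1. ring. Qed.

Lemma ev_mulp x p q : ev x (mulp p q) = (ev x p * ev x q)%C.
Proof. unfold ev. rewrite S_fst_mulp, S_snd_mulp, !npow_neg_mult by lia. ring. Qed.

Lemma Cmod_ev_le x p : Cmod (ev x p) <= 1.
Proof.
  unfold ev. destruct x as [[s1 s2] [H1 H2]]; simpl in *. rewrite Cmod_mult.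
  rewrite <- (Rmult_1_r 1).
  apply Rmult_le_compat; try apply Cmod_ge_0; apply Cmod_npow_neg_le; auto; lia.
Qed.

Definition shift (t : R) (Ht : 0 <= t) (x : bihalf) : bihalf.
Proof.
  refine (exist _ ((fst (proj1_sig x) + t)%C, (snd (proj1_sig x) + t)%C) _).
  abstract (destruct x as [[s1 s2] [H1 H2]]; unfold inH in *; simpl in *; lra).
Defined.

Lemma npow_neg_shift n s (t : R) : npow_neg n (s + t)%C = (RtoC (Rpower (INR n) (- t)) * npow_neg n s)%C.
Proof.
  rewrite !npow_neg_cis. simpl. rewrite Rplus_0_r.
  replace (- (fst s + t)) with (- t + - fst s) by ring. rewrite Rpower_plus, RtoC_mult. ring.
Qed.

Lemma ev_shift t Ht x p : ev (shift t Ht x) p = (RtoC (decay t p) * ev x p)%C.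
Proof.
  unfold ev, shift. cbn [proj1_sig fst snd]. rewrite !npow_neg_shift.
  unfold decay, nrm. rewrite mult_INR, <- Rpower_mult_distr by (apply lt_0_INR; lia).
  rewrite RtoC_mult. ring.
Qed.

(** * Coefficients are bounded by the supremum of the function *)

Lemma small_scale {T} (c : T -> R) (l : list T) : (forall x, 0 <= c x) ->
  exists h, 0 < h /\ forall x, In x l -> h * c x < 1.
Proof.
  intros Hc. pose proof (rsum_ge_0 c l Hc) as H0.
  exists (/ (1 + rsum c l)). split; [apply Rinv_0_lt_compat; lra|].
  intros x Hx. assert (c x <= rsum c l).
  { clear H0. induction l as [|y l IH]; simpl in *; [tauto|].
    pose proof (rsum_ge_0 c l Hc). destruct Hx as [->|Hx]; [lra|]. specialize (IH Hx). specialize (Hc y). lra. }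
  apply Rmult_lt_reg_l with (1 + rsum c l); [lra|].
  rewrite <- Rmult_assoc, Rinv_r, Rmult_1_l, Rmult_1_r by lra. lra.
Qed.

Lemma cis_neq_1 x : x <> 0 -> Rabs x < 1 -> cis x <> 1.
Proof.
  intros Hx Hb E. unfold cis in E. injection E as _ E2.
  pose proof PI2_1 as HP. apply Rabs_lt_between in Hb.
  destruct (Rtotal_order x 0) as [H|[H|H]]; [| tauto |].
  - pose proof (sin_gt_0 (- x)) as Q. rewrite sin_neg, E2 in Q. lra.
  - pose proof (sin_gt_0 x) as Q. rewrite E2 in Q. lra.
Qed.

Lemma psum_pow_bound y n : Cmod y = 1 -> y <> 1 -> Cmod (psum (fun k => y ^ k)%C n) <= 2 / Cmod (1 - y).
Proof.
  intros Hy Ny.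
  assert (N1 : (1 - y)%C <> 0).
  { intros E. apply Ny. replace y with (1 - (1 - y))%C by ring. rewrite E. ring. }
  assert (P : 0 < Cmod (1 - y)) by (apply (proj1 (Cmod_gt_0 _)); auto).
  assert (E : ((1 - y) * psum (fun k => y ^ k) n)%C = (1 - y ^ n)%C).
  { induction n; simpl; [ring|]. rewrite Cmult_plus_distr_l, IHn. ring. }
  apply Rmult_le_reg_l with (Cmod (1 - y)); auto.
  rewrite <- Cmod_mult, E. unfold Rdiv. rewrite (Rmult_comm 2), <- Rmult_assoc, Rinv_r, Rmult_1_l by lra.
  unfold Cminus. eapply Rle_trans; [apply Cmod_triangle|].
  rewrite Cmod_opp, Cmod_1, Cmod_pow, Hy, pow1. lra.
Qed.

(** Multiply the values by [cis (- th p0) ^ k] and sum over [k < n]. The term of [p0] contributes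
    [n * a p0], the others geometric sums with ratio different from 1, bounded by [D] independently
    of [n]. Thus [n * |a p0| <= n * B + D] for all [n]. *)
Lemma trig_polynomial_coef {T} (a : T -> C) (th : T -> R) p0 (l : list T) B :
  (forall p, In p l -> th p - th p0 <> 0 /\ Rabs (th p - th p0) < 1) ->
  (forall k, Cmod (csum (fun p => a p * cis (th p) ^ k)%C (p0 :: l)) <= B) -> Cmod (a p0) <= B.
Proof.
  intros Hth HB.
  set (y := fun p => cis (th p - th p0)).
  assert (Ey : forall p k, (cis (th p) ^ k * cis (- th p0) ^ k)%C = (y p ^ k)%C).
  { intros p k. rewrite <- Cpow_mult_l. unfold y. rewrite <- cis_plus. reflexivity. }
  set (D := rsum (fun p => Cmod (a p) * (2 / Cmod (1 - y p))) l).
  assert (Av : forall n, INR n * Cmod (a p0) <= INR n * B + D).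
  { intros n.
    assert (E : psum (fun k => csum (fun p => a p * cis (th p) ^ k) (p0 :: l) * cis (- th p0) ^ k)%C n
       = (INR n * a p0 + csum (fun p => a p * psum (fun k => y p ^ k) n) l)%C).
    { induction n.
      - simpl. rewrite (csum_ext _ (fun p => 0 * a p)%C) by (intros; ring). rewrite csum_scal. ring.
      - rewrite psum_S, IHn.
        rewrite (csum_ext (fun p => a p * psum (fun k => y p ^ k) (S n))%C (fun p => a p * (psum (fun k => y p ^ k) n + y p ^ n))%C) by (intros; rewrite psum_S; reflexivity).
        rewrite (csum_ext (fun p => a p * (psum (fun k => y p ^ k) n + y p ^ n))%C
          (fun p => a p * psum (fun k => y p ^ k) n + a p * y p ^ n)%C) by (intros; ring).
        rewrite csum_plus, S_INR, RtoC_plus.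
        rewrite (csum_ext (fun p => a p * y p ^ n)%C (fun p => cis (- th p0) ^ n * (a p * cis (th p) ^ n))%C)
          by (intros; rewrite <- Ey; ring).
        rewrite csum_scal. simpl csum.
        assert (E0 : (cis (th p0) ^ n * cis (- th p0) ^ n)%C = 1).
        { rewrite Ey. unfold y. rewrite Rminus_diag, cis_0. clear. induction n; simpl; [|rewrite IHn]; ring. }
        replace ((a p0 * cis (th p0) ^ n + csum (fun p : T => a p * cis (th p) ^ n) l) * cis (- th p0) ^ n)%C
          with (a p0 * (cis (th p0) ^ n * cis (- th p0) ^ n) +
             cis (- th p0) ^ n * csum (fun p : T => a p * cis (th p) ^ n) l)%C by ring.
        rewrite E0. ring. }
    assert (B1 : Cmod (psum (fun k => csum (fun p => a p * cis (th p) ^ k) (p0 :: l) * cis (- th p0) ^ k)%C n) <= INR n * B).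
    { clear E. induction n; rewrite ?psum_S.
      - simpl. rewrite Cmod_0. lra.
      - rewrite S_INR. eapply Rle_trans; [apply Cmod_triangle|].
        rewrite Cmod_mult, Cmod_pow, Cmod_cis, pow1. specialize (HB n). lra. }
    assert (B2 : Cmod (csum (fun p => a p * psum (fun k => y p ^ k) n)%C l) <= D).
    { eapply Rle_trans; [apply Cmod_csum|]. apply rsum_le. intros p Hp. rewrite Cmod_mult.
      apply Rmult_le_compat_l; [apply Cmod_ge_0|]. destruct (Hth p Hp).
      apply psum_pow_bound; [apply Cmod_cis|apply cis_neq_1; auto]. }
    rewrite E in B1.
    set (s := csum (fun p => a p * psum (fun k => y p ^ k) n)%C l) in *.
    assert (T1 := Cmod_triangle (INR n * a p0 + s) (- s)).
    replace (INR n * a p0 + s + - s)%C with (INR n * a p0)%C in T1 by ring.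
    rewrite Cmod_opp, Cmod_mult, Cmod_R, Rabs_pos_eq in T1 by apply pos_INR. lra. }
  apply Rnot_lt_le. intros Q.
  set (d := Cmod (a p0) - B). assert (Hd : 0 < d) by (unfold d; lra).
  destruct (nfloor_ex (Rabs D / d)) as [n Hn].
  { apply Rdiv_le_0_compat; [apply Rabs_pos|auto]. }
  specialize (Av (S n)). rewrite S_INR in Av.
  assert (Rabs D < (INR n + 1) * d).
  { replace (Rabs D) with (Rabs D / d * d) by (field; lra). apply Rmult_lt_compat_r; lra. }
  pose proof (Rle_abs D). unfold d in *. nra.
Qed.

(** A generic direction distinguishes finitely many pairs of logarithms, and a small multiple of it
    brings all frequency differences below 1, where [cis] takes the value 1 only at 0. *)
Lemma separating_direction (p0 : nat * nat) (l : list (nat * nat)) : ~ In p0 l ->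
  exists h1 h2, forall p, In p l ->
    let th q := - (h1 * ln (INR (S (fst q))) + h2 * ln (INR (S (snd q)))) in
    th p - th p0 <> 0 /\ Rabs (th p - th p0) < 1.
Proof.
  intros N0.
  set (u := fun p : nat * nat => ln (INR (S (fst p))) - ln (INR (S (fst p0)))).
  set (v := fun p : nat * nat => ln (INR (S (snd p))) - ln (INR (S (snd p0)))).
  assert (Hln : forall i j, ln (INR (S i)) - ln (INR (S j)) = 0 -> i = j).
  { intros i j E. assert (Q : ln (INR (S i)) = ln (INR (S j))) by lra.
    apply ln_inv in Q; try (apply lt_0_INR; lia). apply INR_eq in Q. lia. }
  (* A zero of [u p + tau * v p] with [u p <> 0] would force [|v p / u p| = / tau], which is too
     large. Where [u p = 0] the quotient is immaterial: then [v p = 0] too, and [p = p0] by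
     injectivity of the logarithm. *)
  destruct (small_scale (fun p => Rabs (v p / u p)) l) as [tau [Ht Kt]]; [intros; apply Rabs_pos|].
  destruct (small_scale (fun p => Rabs (u p + tau * v p)) l) as [h [Hh Kh]]; [intros; apply Rabs_pos|].
  exists h, (h * tau). intros p Hp th.
  assert (E : th p - th p0 = - (h * (u p + tau * v p))) by (unfold th, u, v; ring).
  rewrite E. split.
  - intros Z. assert (Z2 : u p + tau * v p = 0) by nra.
    destruct (Req_dec (u p) 0) as [U0|U0].
    + assert (V0 : v p = 0) by nra. apply Hln in U0, V0.
      apply N0. destruct p, p0; simpl in *; subst; auto.
    + specialize (Kt p Hp). assert (v p / u p = - / tau).
      { apply Rmult_eq_reg_l with (tau * u p); [|apply Rmult_integral_contrapositive_currified; lra].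
        field_simplify; lra. }
      rewrite H, Rabs_Ropp, Rabs_pos_eq, Rinv_r in Kt; [lra|lra|]. apply Rlt_le, Rinv_0_lt_compat; auto.
  - rewrite Rabs_Ropp, Rabs_mult, (Rabs_pos_eq h) by lra. apply (Kh p Hp).
Qed.

Lemma has_sum_tail {T} (f : T -> C) v L0 eps : has_sum f v -> NoDup L0 ->
  (forall L, NoDup L -> (forall x, In x L -> ~ In x L0) -> rsum (fun x => Cmod (f x)) L <= eps) ->
  Cmod (v - csum f L0) <= eps.
Proof.
  intros H N0 HT. apply le_epsilon. intros e He. destruct (H e He) as [L1 K].
  set (L := undup (L0 ++ L1)).
  specialize (K L (NoDup_undup _) ltac:(intros x Hx; apply In_undup, in_or_app; auto)).
  destruct (NoDup_incl_split L0 L N0) as [l' P]; [intros x Hx; apply In_undup, in_or_app; auto|].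
  assert (N : NoDup (L0 ++ l')) by (eapply Permutation_NoDup; [exact P|apply NoDup_undup]).
  rewrite (csum_perm f _ _ P), csum_app in K.
  assert (B : rsum (fun x => Cmod (f x)) l' <= eps).
  { apply HT.
    - clear - N. induction L0; simpl in *; auto. inversion N; auto.
    - intros x Hx Hx0. clear - N Hx Hx0.
      induction L0; simpl in *; [auto|]. inversion N; subst. destruct Hx0 as [<-|]; auto.
      apply H1. apply in_or_app; auto. }
  pose proof (Cmod_csum f l').
  replace (v - csum f L0)%C with (- (csum f L0 + csum f l' - v) + csum f l')%C by ring.
  eapply Rle_trans; [apply Cmod_triangle|]. rewrite Cmod_opp. lra.
Qed.

(** Dropping a tail of norm at most [eps] leaves a trigonometric polynomial on imaginary points,
    bounded there by [B + eps]. *)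
Lemma coefficient_bound (a : nat * nat -> C) (f : bihalf -> C) M B :
  bounded_sums (fun p => Cmod (a p)) M -> (forall x, has_sum (fun p => a p * ev x p)%C (f x)) ->
  (forall x, Cmod (f x) <= B) -> forall p0, Cmod (a p0) <= B.
Proof.
  intros HM Hf HB p0. apply le_epsilon. intros eps He.
  destruct (bounded_sums_tail _ M (fun p => Cmod_ge_0 (a p)) HM eps He) as [L0 [N0 K0]].
  set (l := filter (fun p => if eq_dec_classic p p0 then false else true) L0).
  assert (Nl : ~ In p0 l).
  { intros H. apply filter_In in H. destruct H as [_ H]. destruct (eq_dec_classic p0 p0); congruence. }
  assert (NL : NoDup (p0 :: l)) by (constructor; auto; apply NoDup_filter; auto).
  assert (Il : forall p, In p L0 -> In p (p0 :: l)).
  { intros p Hp. destruct (eq_dec_classic p p0) as [->|N]; [simpl; auto|]. right. apply filter_In.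
    split; auto. destruct (eq_dec_classic p p0); congruence. }
  destruct (separating_direction p0 l Nl) as [h1 [h2 Hh]].
  apply (trig_polynomial_coef a (fun q => - (h1 * ln (INR (S (fst q))) + h2 * ln (INR (S (snd q))))) p0 l);
    [exact Hh|].
  intros k.
  (* At the point [(i k h1, i k h2)] every character is unimodular, and [ev x p] is the k-th power
     of one fixed number of modulus 1. *)
  assert (HH : inH (fst ((0, INR k * h1), (0, INR k * h2))) /\ inH (snd ((0, INR k * h1), (0, INR k * h2)))).
  { unfold inH; simpl; lra. }
  set (x := exist _ ((0, INR k * h1), (0, INR k * h2)) HH : bihalf).
  assert (Ex : forall p, ev x p = (cis (- (h1 * ln (INR (S (fst p))) + h2 * ln (INR (S (snd p))))) ^ k)%C).
  { intros p. unfold ev, x. cbn [proj1_sig fst snd]. rewrite !npow_neg_cis. cbn [fst snd].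
    rewrite Ropp_0, !Rpower_O by (apply lt_0_INR; lia).
    assert (Ck : forall th, (cis th ^ k)%C = cis (INR k * th)).
    { clear. intros th. induction k.
      - simpl. rewrite Rmult_0_l, cis_0. reflexivity.
      - rewrite S_INR, Rmult_plus_distr_r, Rmult_1_l, cis_plus, <- IHk. simpl. ring. }
    rewrite Ck.
    replace (INR k * - (h1 * ln (INR (S (fst p))) + h2 * ln (INR (S (snd p)))))
      with (- (INR k * h1) * ln (INR (S (fst p))) + - (INR k * h2) * ln (INR (S (snd p)))) by ring.
    rewrite cis_plus. ring. }
  rewrite (csum_ext _ (fun p => a p * ev x p)%C) by (intros; rewrite Ex; reflexivity).
  pose proof (has_sum_tail (fun p => a p * ev x p)%C (f x) (p0 :: l) eps (Hf x) NL) as Tl.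
  assert (Q : Cmod (f x - csum (fun p => a p * ev x p)%C (p0 :: l)) <= eps).
  { apply Tl. intros L NL' D. eapply Rle_trans; [|apply (K0 L NL')].
    - apply rsum_le. intros p _. rewrite Cmod_mult. pose proof (Cmod_ev_le x p). pose proof (Cmod_ge_0 (a p)). nra.
    - intros p Hp Hp0. apply (D p Hp), Il; auto. }
  specialize (HB x).
  set (s := csum (fun p => a p * ev x p)%C (p0 :: l)) in *.
  replace s with (f x + - (f x - s))%C by ring.
  eapply Rle_trans; [apply Cmod_triangle|]. rewrite Cmod_opp. lra.
Qed.

(** * Finitely generated semigroups and admissible weights *)

(** Elements are written as products of powers, one exponent per generator; this normal form lets a
    sum over the semigroup be split into one geometric sum per generator. *)
Fixpoint generated (gs : list (nat * nat)) (p : nat * nat) : Prop :=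
  match gs with
  | nil => p = onep
  | g :: gs' => exists k q, generated gs' q /\ p = mulp (powp g k) q
  end.

Lemma generated_one gs : generated gs onep.
Proof. induction gs; simpl; auto. exists O, onep. split; auto. Qed.

Lemma generated_mulp gs p q : generated gs p -> generated gs q -> generated gs (mulp p q).
Proof.
  revert p q. induction gs as [|g gs IH]; simpl; intros p q.
  - intros -> ->. apply mulp_one_l.
  - intros (k & p' & Hp & ->) (m & q' & Hq & ->). exists (k + m)%nat, (mulp p' q'). split; auto.
    rewrite powp_plus. rewrite !mulp_assoc. f_equal. rewrite <- !mulp_assoc. f_equal. apply mulp_comm.
Qed.

Lemma generated_In gs p : In p gs -> generated gs p.
Proof.
  induction gs as [|g gs IH]; simpl; [tauto|]. intros [->|H].
  - exists 1%nat, onep. split; [apply generated_one|].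
    unfold powp; simpl. rewrite (mulp_comm p onep), mulp_one_l, (mulp_comm p onep), mulp_one_l. reflexivity.
  - exists O, p. split; auto. symmetry. apply mulp_one_l.
Qed.

Lemma weight_wt_ge_1 w p : weight w -> 1 <= wt w p.
Proof. intros [H _]. apply H; lia. Qed.

Lemma weight_wt_mulp w p q : weight w -> wt w (mulp p q) <= wt w p * wt w q.
Proof. intros [_ H]. unfold wt. rewrite S_fst_mulp, S_snd_mulp. apply H; lia. Qed.

Lemma admissible_powp_growth w g q : weight w -> admissible w -> 1 < q ->
  exists A, 0 < A /\ forall k, wt w (powp g k) <= A * q ^ k.
Proof.
  intros Hw Ha Hq.
  specialize (Ha (S (fst g)) (S (snd g)) ltac:(lia) ltac:(lia)).
  destruct (proj1 (is_lim_seq_Reals _ _) Ha (q - 1) ltac:(lra)) as [N HN].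
  set (A := 1 + rsum (fun k => wt w (powp g k)) (seq 0 (S N))).
  assert (W0 : forall k, 0 <= wt w (powp g k)).
  { intros k. pose proof (weight_wt_ge_1 w (powp g k) Hw). lra. }
  assert (HA : 1 <= A).
  { unfold A. pose proof (rsum_ge_0 (fun k => wt w (powp g k)) (seq 0 (S N)) W0). lra. }
  exists A. split; [lra|]. intros k.
  assert (Pk : 1 <= q ^ k) by (apply pow_R1_Rle; lra).
  (* Indices up to [N], among them [k = 0] where [/ INR k] is a default value, are absorbed by [A];
     beyond [N] the k-th root of the weight is below [q]. *)
  destruct (Compare_dec.le_lt_dec k N) as [L|L].
  - assert (wt w (powp g k) <= A).
    { unfold A. assert (In k (seq 0 (S N))) by (apply in_seq; lia).
      pose proof (rsum_incl (fun k => wt w (powp g k)) (k :: nil) (seq 0 (S N)) W0) as Q.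
      assert (rsum (fun k => wt w (powp g k)) (k :: nil) <= rsum (fun k => wt w (powp g k)) (seq 0 (S N))).
      { apply Q; [constructor; [simpl; tauto|constructor]|]. intros y [<-|[]]; auto. }
      simpl rsum in H0. simpl rsum. lra. }
    nra.
  - specialize (HN k ltac:(lia)). unfold Rdist in HN. apply Rabs_lt_between in HN.
    unfold wt. rewrite S_fst_powp, S_snd_powp.
    set (y := w (S (fst g) ^ k)%nat (S (snd g) ^ k)%nat) in *.
    assert (Hy : 1 <= y).
    { pose proof (weight_wt_ge_1 w (powp g k) Hw) as Q. unfold wt in Q.
      rewrite S_fst_powp, S_snd_powp in Q. exact Q. }
    assert (Hk : 0 < INR k) by (apply lt_0_INR; lia).
    assert (B : Rpower y (/ INR k) < q) by lra.
    assert (y <= q ^ k).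
    { rewrite <- (Rpower_1 y) by lra. replace 1 with (/ INR k * INR k) by (field; lra).
      rewrite <- Rpower_mult, Rpower_pow by apply exp_pos.
      apply pow_incr. split; [apply Rlt_le, exp_pos|lra]. }
    nra.
Qed.

Lemma rsum_geometric r n : 0 <= r < 1 -> rsum (fun k => r ^ k) (seq 0 n) <= / (1 - r).
Proof.
  intros Hr. assert (E : rsum (fun k => r ^ k) (seq 0 n) * (1 - r) = 1 - r ^ n).
  { induction n; [simpl; ring|]. rewrite seq_S, rsum_app, Rmult_plus_distr_r, IHn. simpl. ring. }
  apply Rmult_le_reg_r with (1 - r); [lra|]. rewrite E, Rinv_l by lra.
  pose proof (pow_le r n (proj1 Hr)). lra.
Qed.

Lemma decay_powp t p k : decay t (powp p k) = decay t p ^ k.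
Proof. induction k; [apply decay_onep|]. rewrite powp_S, decay_mulp, IHk. reflexivity. Qed.

(** With [q = |g| ^ (t / 2) > 1] the decay along powers of [g] is [q ^ (- 2 k)]. Half of it pays for
    the growth of the weight, which is at most [A * q ^ k]; the other half is summable. *)
Lemma decay_sum_powp w g t : weight w -> admissible w -> g <> onep -> 0 < t ->
  exists K, forall n, rsum (fun k => wt w (powp g k) * decay t (powp g k)) (seq 0 n) <= K.
Proof.
  intros Hw Ha Hg Ht. pose proof (nrm_ge_2 g Hg) as H2.
  set (q := Rpower (nrm g) (t / 2)).
  assert (Hq : 1 < q). { unfold q. rewrite <- (Rpower_O (nrm g)) by lra. apply Rpower_lt; lra. }
  assert (Eq : decay t g = / q * / q).
  { unfold decay, q. rewrite <- !Rpower_Ropp, <- Rpower_plus. f_equal. field. }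
  destruct (admissible_powp_growth w g q Hw Ha Hq) as [A [HA K]].
  exists (A * / (1 - / q)). intros n.
  assert (Hiq : 0 < / q < 1).
  { split; [apply Rinv_0_lt_compat; lra|]. rewrite <- Rinv_1. apply Rinv_lt_contravar; lra. }
  eapply Rle_trans; [|apply Rmult_le_compat_l; [lra|apply (rsum_geometric (/ q) n); lra]].
  rewrite <- rsum_scal. apply rsum_le. intros k _. rewrite decay_powp, Eq, Rpow_mult_distr.
  specialize (K k). pose proof (pow_lt (/ q) k (proj1 Hiq)) as P.
  apply Rle_trans with (A * q ^ k * ((/ q) ^ k * (/ q) ^ k)).
  - apply Rmult_le_compat_r; [nra|auto].
  - replace (A * q ^ k * ((/ q) ^ k * (/ q) ^ k)) with (A * (q * / q) ^ k * (/ q) ^ k).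
    + rewrite Rinv_r, pow1 by lra. lra.
    + rewrite Rpow_mult_distr. ring.
Qed.

(** The function [W] is submultiplicative, so a sum over the semigroup is bounded by the product of
    the sum over powers of [g] and the sum over the semigroup of the other generators. *)
Lemma decay_sum_generated w gs t : weight w -> admissible w -> (forall g, In g gs -> g <> onep) -> 0 < t ->
  exists K, forall l, NoDup l -> (forall p, In p l -> generated gs p) ->
    rsum (fun p => wt w p * decay t p) l <= K.
Proof.
  intros Hw Ha Hg Ht.
  set (W := fun p => wt w p * decay t p).
  assert (W0 : forall p, 0 <= W p).
  { intros p. unfold W. pose proof (weight_wt_ge_1 w p Hw). pose proof (decay_pos t p).
    apply Rmult_le_pos; lra. }
  induction gs as [|g gs IH].
  - exists (W onep). intros l Nl Hl. simpl in Hl.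
    change (rsum W l <= W onep).
    apply Rle_trans with (rsum W (onep :: nil)); [|simpl; lra].
    apply rsum_incl; auto. intros p Hp. rewrite (Hl p Hp). simpl; auto.
  - destruct IH as [K2 H2]; [intros; apply Hg; simpl; auto|].
    destruct (decay_sum_powp w g t Hw Ha (Hg g (or_introl eq_refl)) Ht) as [K1 H1].
    exists (K1 * K2). intros l Nl Hl.
    (* A factorisation need not be unique, so one is chosen for each [p]. The choice is injective,
       since the product gives [p] back. *)
    assert (Ch : forall p, exists kq : nat * (nat * nat), generated (g :: gs) p ->
       generated gs (snd kq) /\ p = mulp (powp g (fst kq)) (snd kq)).
    { intros p. destruct (classic (generated (g :: gs) p)) as [(k & q & Hq & E)|N].
      - exists (k, q). auto.
      - exists (O, onep). tauto. }
    set (kq := fun p => proj1_sig (constructive_indefinite_description _ (Ch p))).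
    assert (Hkq : forall p, generated (g :: gs) p -> generated gs (snd (kq p)) /\ p = mulp (powp g (fst (kq p))) (snd (kq p))).
    { intros p. exact (proj2_sig (constructive_indefinite_description _ (Ch p))). }
    set (G := fun z : nat * (nat * nat) => W (powp g (fst z)) * W (snd z)).
    set (m := map kq l).
    assert (Nm : NoDup m).
    { unfold m. clear - Nl Hl Hkq. induction Nl as [|p l Hp Nl IH]; simpl; constructor.
      - intros H. apply in_map_iff in H. destruct H as [q [E Hq]]. apply Hp.
        destruct (Hkq p (Hl p (or_introl eq_refl))) as [_ E1].
        destruct (Hkq q (Hl q (or_intror Hq))) as [_ E2].
        rewrite E1, <- E, <- E2. auto.
      - apply IH. intros; apply Hl; simpl; auto. }
    apply Rle_trans with (rsum G m).
    { unfold m. rewrite rsum_map. apply rsum_le. intros p Hp. unfold G.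
      destruct (Hkq p (Hl p Hp)) as [_ E].
      set (a := powp g (fst (kq p))) in *. set (b := snd (kq p)) in *.
      change (W p <= W a * W b). replace (W p) with (W (mulp a b)) by (f_equal; auto).
      unfold W. rewrite decay_mulp.
      pose proof (weight_wt_mulp w a b Hw). pose proof (decay_pos t a). pose proof (decay_pos t b).
      apply Rle_trans with (wt w a * wt w b * (decay t a * decay t b)); [|apply Req_le; ring].
      apply Rmult_le_compat_r; auto. apply Rmult_le_pos; lra. }
    set (n := S (list_max (map fst m))).
    apply Rle_trans with (rsum G (list_prod (seq 0 n) (undup (map snd m)))).
    { apply rsum_incl; auto.
      - intros z. unfold G. apply Rmult_le_pos; auto.
      - intros [k y] Hxy. apply in_prod.
        + apply in_seq. split; [lia|].
          assert (Q : (k <= list_max (map fst m))%nat).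
          { pose proof (proj1 (list_max_le (map fst m) _) (Nat.le_refl _)) as Q.
            rewrite Forall_forall in Q. apply Q. change k with (fst (k, y)). apply in_map; auto. }
          unfold n; lia.
        + apply In_undup. change y with (snd (k, y)). apply in_map; auto. }
    rewrite rsum_list_prod. unfold G; cbn [fst snd]. clearbody n.
    rewrite (rsum_ext _ (fun k => rsum W (undup (map snd m)) * W (powp g k))).
    + rewrite rsum_scal, Rmult_comm. apply Rmult_le_compat; try (apply rsum_ge_0; auto).
      * apply H1.
      * apply H2; [apply NoDup_undup|]. intros q Hq. apply In_undup, in_map_iff in Hq.
        destruct Hq as [z [<- Hz]]. apply in_map_iff in Hz. destruct Hz as [p [<- Hp]].
        apply Hkq, Hl; auto.
    + intros k _. rewrite rsum_scal. ring.
Qed.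

Lemma almost_monotone_admissible w : almost_monotone w -> admissible w.
Proof.
  intros [Hw [Ha|(K & HK & H)]]; auto.
  (* Taking [n1 = n2] and then [m1 = m2], the divisibility condition bounds [w]. *)
  set (B := K * (K * w 1%nat 1%nat)).
  assert (HB : forall m n, (1 <= m)%nat -> (1 <= n)%nat -> w m n <= B).
  { intros m n Hm Hn. unfold B.
    apply Rle_trans with (K * w 1%nat n); [apply H; auto; right; apply Nat.divide_refl|].
    apply Rmult_le_compat_l; [lra|]. apply H; auto. left. apply Nat.divide_refl. }
  intros l k Hl Hk.
  assert (P : forall n, (1 <= l ^ n)%nat /\ (1 <= k ^ n)%nat).
  { intros n. split; apply Nat.neq_0_lt_0, Nat.pow_nonzero; lia. }
  assert (B1 : 1 <= B).
  { destruct Hw as [W1 _]. pose proof (W1 1%nat 1%nat ltac:(lia) ltac:(lia)).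
    pose proof (HB 1%nat 1%nat ltac:(lia) ltac:(lia)). lra. }
  apply is_lim_seq_le_le_loc with (fun _ => 1) (fun n => Rpower B (/ INR n)).
  - exists 1%nat. intros n Hn. destruct (P n) as [P1 P2].
    assert (0 < / INR n) by (apply Rinv_0_lt_compat, lt_0_INR; lia).
    pose proof (proj1 Hw _ _ P1 P2). pose proof (HB _ _ P1 P2).
    split.
    + rewrite <- (Rpower_O (w (l ^ n)%nat (k ^ n)%nat)) at 1 by lra.
      destruct (Req_dec (w (l ^ n)%nat (k ^ n)%nat) 1) as [->|N].
      * unfold Rpower. rewrite ln_1, !Rmult_0_r. lra.
      * apply Rle_Rpower; lra.
    + apply Rle_Rpower_l; lra.
  - apply is_lim_seq_const.
  - unfold Rpower. rewrite <- exp_0.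
    apply (is_lim_seq_continuous exp (fun n => / INR n * ln B) 0).
    + apply derivable_continuous_pt, derivable_pt_exp.
    + replace (Finite 0) with (Rbar_mult 0 (ln B)) by (simpl; f_equal; ring).
      apply is_lim_seq_scal_r. apply (is_lim_seq_inv INR p_infty); [apply is_lim_seq_INR|discriminate].
Qed.

(** * The holomorphic functional calculus *)

Lemma Cmod_le_Rabs_sum (z : C) : Cmod z <= Rabs (fst z) + Rabs (snd z).
Proof.
  replace z with (RtoC (fst z) + Ci * RtoC (snd z))%C at 1
    by (apply injective_projections; simpl; ring).
  eapply Rle_trans; [apply Cmod_triangle|]. rewrite Cmod_mult, Cmod_Ci, !Cmod_R. lra.
Qed.

Definition closure_C (E : C -> Prop) (z : C) : Prop :=
  forall eps, 0 < eps -> exists z', E z' /\ Cmod (z' - z) < eps.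

(** A Lebesgue number argument on the square of half side [R0]. Around a point outside the closure
    of [E] the radius is so small that [E] is not met, so the local hypothesis is asked only on the
    closure. *)
Lemma compact_uniform (E : C -> Prop) R0 (P : C -> R -> Prop) :
  (forall z, E z -> Cmod z <= R0) ->
  (forall z d d', P z d -> d' <= d -> P z d') ->
  (forall z, closure_C E z -> exists d, 0 < d /\ forall z', Cmod (z' - z) < d -> P z' d) ->
  exists d, 0 < d /\ forall z, E z -> P z d.
Proof.
  intros HE Hm Hl.
  (* The covering theorem yields closeness below [delta u v] in each coordinate, hence below twice
     that in modulus. *)
  assert (Ch : forall u v : R, exists d : posreal,
     (closure_C E (u, v) -> forall z', Cmod (z' - (u, v))%C < 2 * d -> P z' d) /\
     (~ closure_C E (u, v) -> forall z', E z' -> ~ Cmod (z' - (u, v))%C < 2 * d)).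
  { intros u v. destruct (classic (closure_C E (u, v))) as [Y|N].
    - destruct (Hl _ Y) as [d [Hd K]].
      assert (H2 : 0 < d / 2) by lra.
      exists (mkposreal _ H2). simpl. split; [|tauto]. intros _ z' Hz'.
      apply Hm with d; [|lra]. apply K. replace (2 * (d / 2)) with d in Hz' by field. exact Hz'.
    - apply not_all_ex_not in N. destruct N as [eps N]. apply imply_to_and in N. destruct N as [He N].
      assert (H2 : 0 < eps / 2) by lra.
      exists (mkposreal _ H2). simpl. split.
      + intros Y. destruct N. apply Y; auto.
      + intros _ z' Hz' Q. apply N. exists z'. split; auto.
        replace (2 * (eps / 2)) with eps in Q by field. exact Q. }
  set (delta := fun u v => proj1_sig (constructive_indefinite_description _ (Ch u v))).
  assert (Hdelta : forall u v, (closure_C E (u, v) -> forall z', Cmod (z' - (u, v))%C < 2 * delta u v -> P z' (delta u v)) /\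
     (~ closure_C E (u, v) -> forall z', E z' -> ~ Cmod (z' - (u, v))%C < 2 * delta u v)).
  { intros u v. exact (proj2_sig (constructive_indefinite_description _ (Ch u v))). }
  destruct (compactness_value_2d (- R0) R0 (- R0) R0 delta) as [d Hd].
  exists d. split; [apply cond_pos|]. intros z Hz.
  pose proof (HE z Hz) as B. pose proof (Rmax_Cmod z) as Mx.
  pose proof (Rmax_l (Rabs (fst z)) (Rabs (snd z))). pose proof (Rmax_r (Rabs (fst z)) (Rabs (snd z))).
  assert (B1 : - R0 <= fst z <= R0) by (apply Rabs_le_between; lra).
  assert (B2 : - R0 <= snd z <= R0) by (apply Rabs_le_between; lra).
  specialize (Hd (fst z) (snd z) B1 B2). apply NNPP in Hd.
  destruct Hd as (u & v & _ & _ & D1 & D2 & D3).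
  assert (D : Cmod (z - (u, v))%C < 2 * delta u v).
  { eapply Rle_lt_trans; [apply Cmod_le_Rabs_sum|]. simpl.
    replace (fst z + - u) with (fst z - u) by ring. replace (snd z + - v) with (snd z - v) by ring. lra. }
  destruct (Hdelta u v) as [Y N].
  destruct (classic (closure_C E (u, v))) as [Q|Q].
  - apply Hm with (delta u v); auto.
  - exfalso. apply (N Q z Hz D).
Qed.

Lemma rsum_supported {T} (g : T -> R) l L0 : (forall x, 0 <= g x) -> NoDup l ->
  (forall x, In x l -> ~ In x L0 -> g x = 0) -> rsum g l <= rsum g L0.
Proof.
  intros Hg Nl Hz.
  set (P := fun x => if excluded_middle_informative (In x L0) then true else false).
  apply Rle_trans with (rsum g (filter P l)).
  - clear Nl. induction l as [|x l IH]; simpl; [lra|].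
    assert (IH' : rsum g l <= rsum g (filter P l)) by (apply IH; intros; apply Hz; simpl; auto).
    unfold P at 1. destruct (excluded_middle_informative (In x L0)); simpl; [lra|].
    rewrite Hz; simpl; auto. lra.
  - apply rsum_incl; auto; [apply NoDup_filter; auto|].
    intros x Hx. apply filter_In in Hx. destruct Hx as [_ Hx]. unfold P in Hx.
    destruct (excluded_middle_informative (In x L0)); [auto|discriminate].
Qed.

Lemma exp_lipschitz A B L : A <= L -> B <= L -> Rabs (exp A - exp B) <= exp L * Rabs (A - B).
Proof.
  assert (H : forall A B, B <= A -> A <= L -> exp A - exp B <= exp L * (A - B)).
  { clear. intros A B H1 H2.
    assert (E : exp B = exp A * exp (B - A)) by (rewrite <- exp_plus; f_equal; ring).
    pose proof (exp_ineq1_le (B - A)). pose proof (exp_pos A).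
    assert (exp A <= exp L). { destruct (Req_dec A L) as [->|N]; [lra|]. apply Rlt_le, exp_increasing; lra. }
    apply Rle_trans with (exp A * (A - B)); [rewrite E; nra|]. apply Rmult_le_compat_r; lra. }
  intros HA HB. destruct (Rle_dec B A) as [Q|Q].
  - assert (exp B <= exp A). { destruct (Req_dec A B) as [->|N]; [lra|]. apply Rlt_le, exp_increasing; lra. }
    rewrite !Rabs_pos_eq by lra. auto.
  - assert (exp A < exp B) by (apply exp_increasing; lra).
    rewrite !Rabs_left by lra. specialize (H B A). lra.
Qed.

(** For [t >= -1] the exponent [- t * ln (nrm p)] is at most [ln (nrm p)], so [exp] has Lipschitz
    constant [nrm p] on the relevant range. *)
Lemma decay_lipschitz p s t : -1 <= s -> -1 <= t ->
  Rabs (decay s p - decay t p) <= nrm p * ln (nrm p) * Rabs (s - t).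
Proof.
  intros Hs Ht. pose proof (nrm_ge_1 p) as H1.
  assert (L0 : 0 <= ln (nrm p)). { rewrite <- ln_1. apply ln_le; lra. }
  unfold decay, Rpower.
  eapply Rle_trans; [apply (exp_lipschitz _ _ (ln (nrm p))); nra|].
  rewrite exp_ln by lra.
  replace (- s * ln (nrm p) - - t * ln (nrm p)) with (- ((s - t) * ln (nrm p))) by ring.
  rewrite Rabs_Ropp, Rabs_mult, (Rabs_pos_eq (ln (nrm p))) by auto. apply Req_le; ring.
Qed.

(** * The calculus for a given series and open set *)

Section Calculus.

Variables (w : nat -> nat -> R) (F : bihalf -> C) (a : nat * nat -> C) (M : R) (U : C -> Prop).
Hypothesis w_weight : weight w.
Hypothesis w_admissible : admissible w.
Hypothesis F_rep : represents (nat * nat) bihalf (wt w) ev (fun _ => True) a F M.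
Hypothesis U_open : open_C U.
Hypothesis U_closure : forall z, closure_C (fun z => exists x, F x = z) z -> U z.

Let inA := in_algebra (nat * nat) bihalf (wt w) ev.
Let w1 p : 1 <= wt w p := weight_wt_ge_1 w p w_weight.
Let wm p q : wt w (mulp p q) <= wt w p * wt w q := weight_wt_mulp w p q w_weight.

Let F_bound x : Cmod (F x) <= M.
Proof. exact (represents_bound _ _ _ _ w1 Cmod_ev_le _ _ _ _ x F_rep). Qed.

(** The range is bounded, so its closure is compact. The factor 4 is a budget: [rho] for the
    neighbourhood [V], [rho] for the Taylor discs around its points, [rho] for the closure on which
    holomorphic functions are bounded. *)
Lemma exists_range_margin : exists rho, 0 < rho /\ forall x z, Cmod (F x - z) < 4 * rho -> U z.
Proof.
  destruct (compact_uniform (fun z => exists x, F x = z) M (fun z d => forall z', Cmod (z - z') < d -> U z'))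
    as [d [Hd K]].
  - intros z [x <-]. auto.
  - intros z d d' H Hd z' Hz'. apply H. lra.
  - intros z Hz. destruct (U_open z (U_closure z Hz)) as [d [Hd K]].
    exists (d / 2). split; [lra|]. intros z' Hz' z'' Hz''. apply K.
    replace (z'' - z)%C with (- (z' - z'') + (z' - z))%C by ring.
    eapply Rle_lt_trans; [apply Cmod_triangle|]. rewrite Cmod_opp. lra.
  - exists (d / 4). split; [lra|]. intros x z Hz. apply (K (F x)); [eauto|lra].
Qed.

Lemma calculus_of_margin rho : 0 < rho -> (forall x z, Cmod (F x - z) < 4 * rho -> U z) ->
  forall f, holo_on U f -> exists B, inA (fun _ => True) (fun x => f (F x)) B.
Proof.
  intros Hrho Hmargin.
  set (V := fun z => exists x, Cmod (F x - z) < rho).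
  assert (V_disc : forall z z', V z -> Cmod (z' - z) <= rho -> U z').
  { intros z z' [x Hx] Hz'. apply (Hmargin x).
    replace (F x - z')%C with ((F x - z) + - (z' - z))%C by ring.
    eapply Rle_lt_trans; [apply Cmod_triangle|]. rewrite Cmod_opp. lra. }
  assert (V_bounded : forall f, holo_on U f -> exists B, forall z z', V z -> Cmod (z' - z) <= rho -> Cmod (f z') <= B).
  { intros f Hf.
    (* Boundedness by [/ d], written as a property that persists when [d] decreases. *)
    destruct (compact_uniform (fun z => exists x, Cmod (F x - z) < 2 * rho) (M + 2 * rho)
      (fun z d => Cmod (f z) * d <= 1)) as [d [Hd K]].
    - intros z [x Hx]. pose proof (F_bound x).
      replace z with (F x + - (F x - z))%C by ring.
      eapply Rle_trans; [apply Cmod_triangle|]. rewrite Cmod_opp. lra.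
    - intros z d d' H Hd. pose proof (Cmod_ge_0 (f z)). nra.
    - intros z Hz.
      assert (Uz : U z).
      { destruct (Hz rho Hrho) as [z' [[x Hx] Hz']]. apply (Hmargin x).
        replace (F x - z)%C with ((F x - z') + (z' - z))%C by ring.
        eapply Rle_lt_trans; [apply Cmod_triangle|]. lra. }
      destruct (Hf z Uz) as [l Hl].
      destruct (has_cderiv_bounded f z l Hl) as [d1 [B [Hd1 HB]]].
      pose proof (Rabs_pos B).
      set (d := Rmin d1 (/ (Rabs B + 1))).
      assert (Hd : 0 < d) by (apply Rmin_pos; auto; apply Rinv_0_lt_compat; lra).
      exists d. split; auto. intros z' Hz'.
      assert (L1 : d <= d1) by apply Rmin_l. assert (L2 : d <= / (Rabs B + 1)) by apply Rmin_r.
      specialize (HB z' ltac:(lra)). pose proof (Rle_abs B). pose proof (Cmod_ge_0 (f z')).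
      apply Rle_trans with ((Rabs B + 1) * / (Rabs B + 1)); [apply Rmult_le_compat; lra|].
      rewrite Rinv_r; lra.
    - exists (/ d). intros z z' [x Hx] Hz'. specialize (K z').
      apply Rmult_le_reg_r with d; auto. rewrite Rinv_l by lra. apply K. exists x.
      replace (F x - z')%C with ((F x - z) + - (z' - z))%C by ring.
      eapply Rle_lt_trans; [apply Cmod_triangle|]. rewrite Cmod_opp. lra. }
  destruct F_rep as (_ & HaM & HaF).
  assert (g0 : forall p, 0 <= Cmod (a p) * wt w p).
  { intros p. pose proof (w1 p). apply Rmult_le_pos; [apply Cmod_ge_0|lra]. }
  (* Two errors of size [rho / 4], from truncation and from moving [t], keep all values inside [V];
     one such error also satisfies [2 * eps <= rho] in the perturbation lemma. *)
  destruct (bounded_sums_tail _ M g0 HaM (rho / 4) ltac:(lra)) as [L0 [N0 Tl]].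
  (* The identity has no decay, so the sum over the powers of a generator converges only for
     generators other than [onep]; [generated] contains the identity anyway. *)
  set (gs := filter (fun p => if eq_dec_classic p onep then false else true) L0).
  set (S := generated gs).
  assert (HgS : forall g, In g gs -> g <> onep).
  { intros g Hg. apply filter_In in Hg. destruct Hg as [_ Hg]. destruct (eq_dec_classic g onep); congruence. }
  assert (SL0 : forall p, In p L0 -> S p).
  { intros p Hp. destruct (eq_dec_classic p onep) as [->|N]; [apply generated_one|].
    apply generated_In, filter_In. split; auto. destruct (eq_dec_classic p onep); congruence. }
  assert (S1 : S onep) by apply generated_one.
  assert (Sm : forall p q, S p -> S q -> S (mulp p q)) by (intros; apply generated_mulp; auto).
  assert (Fin : forall c : nat * nat -> C,
    inA S (fun x => csum (fun p => c p * ev x p)%C L0) (rsum (fun p => Cmod (c p) * wt w p) L0)).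
  { intros c. exists (restrict (fun p => In p L0) c). repeat split.
    - intros p. unfold restrict. destruct (excluded_middle_informative (In p L0)); [auto|congruence].
    - intros l Nl.
      apply Rle_trans with (rsum (fun p => Cmod (restrict (fun p => In p L0) c p) * wt w p) L0).
      + apply rsum_supported; auto.
        * intros p. pose proof (w1 p). apply Rmult_le_pos; [apply Cmod_ge_0|lra].
        * intros p _ Hp. unfold restrict. destruct (excluded_middle_informative (In p L0)); [tauto|].
          rewrite Cmod_0; ring.
      + apply rsum_le. intros p _. apply Rmult_le_compat_r; [pose proof (w1 p); lra|apply Cmod_restrict_le].
    - intros x.
      rewrite (csum_ext _ (fun p => restrict (fun p => In p L0) c p * ev x p)%C).
      + apply (has_sum_finite (fun p => restrict (fun p => In p L0) c p * ev x p)%C); auto.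
        intros p Hp. unfold restrict. destruct (excluded_middle_informative (In p L0)); [tauto|]. ring.
      + intros p Hp. unfold restrict. destruct (excluded_middle_informative (In p L0)); [auto|tauto]. }
  set (P := fun (t : R) x => csum (fun p => a p * RtoC (decay t p) * ev x p)%C L0).
  (* The Lipschitz constant of [t |-> P t] in the norm of the algebra, for [t >= -1]. *)
  set (Lam := rsum (fun p => Cmod (a p) * wt w p * (nrm p * ln (nrm p))) L0).
  assert (HLam : 0 <= Lam).
  { apply rsum_ge_0. intros p. pose proof (nrm_ge_1 p). apply Rmult_le_pos; auto.
    apply Rmult_le_pos; [lra|]. rewrite <- ln_1. apply ln_le; lra. }
  assert (PLip : forall s t, -1 <= s -> -1 <= t -> inA S (fun x => P s x - P t x)%C (Lam * Rabs (s - t))).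
  { intros s t Hs Ht.
    apply in_algebra_weaken with (S := S)
      (M := rsum (fun p => Cmod (a p * RtoC (decay s p - decay t p))%C * wt w p) L0); auto.
    - unfold Lam. rewrite Rmult_comm, <- rsum_scal. apply rsum_le. intros p _.
      rewrite Cmod_mult, Cmod_R. pose proof (decay_lipschitz p s t Hs Ht) as Q. specialize (g0 p). nra.
    - eapply in_algebra_ext; [|apply Fin]. intros x. cbv beta. unfold P.
      rewrite (csum_ext _ (fun p => a p * RtoC (decay s p) * ev x p + (-1) * (a p * RtoC (decay t p) * ev x p))%C)
        by (intros; rewrite RtoC_minus; ring).
      rewrite csum_plus, csum_scal. ring. }
  assert (PV_diff : forall f g eps x, inA S (fun x => f x - g x)%C eps -> Cmod (f x - g x) <= eps).
  { intros f g eps x [b Hb].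
    exact (represents_bound _ _ _ _ w1 Cmod_ev_le _ _ _ _ x Hb). }
  assert (FP : inA (fun _ => True) (fun x => F x - P 0 x)%C (rho / 4)).
  { exists (restrict (fun p => ~ In p L0) a). repeat split.
    - intros l Nl.
      set (Q := fun p => if excluded_middle_informative (In p L0) then false else true).
      apply Rle_trans with (rsum (fun p => Cmod (a p) * wt w p) (filter Q l)).
      + clear Nl. induction l as [|p l IH]; simpl; [lra|]. unfold restrict at 1. unfold Q at 1.
        destruct (excluded_middle_informative (In p L0)), (excluded_middle_informative (~ In p L0)); simpl; try tauto.
        * rewrite Cmod_0. lra.
        * lra.
      + apply Tl; [apply NoDup_filter; auto|]. intros p Hp. apply filter_In in Hp. destruct Hp as [_ Hp].
        unfold Q in Hp. destruct (excluded_middle_informative (In p L0)); [discriminate|auto].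
    - intros x.
      apply has_sum_ext with (fun p => a p * ev x p + (-1) * (restrict (fun p => In p L0) a p * ev x p))%C.
      + intros p. unfold restrict.
        destruct (excluded_middle_informative (In p L0)), (excluded_middle_informative (~ In p L0)); try tauto; ring.
      + replace (F x - P 0 x)%C with (F x + (-1) * P 0 x)%C by ring.
        apply has_sum_plus; auto. apply has_sum_scal. unfold P.
        rewrite (csum_ext _ (fun p => restrict (fun p => In p L0) a p * ev x p)%C).
        * apply (has_sum_finite (fun p => restrict (fun p => In p L0) a p * ev x p)%C); auto.
          intros p Hp. unfold restrict. destruct (excluded_middle_informative (In p L0)); [tauto|]. ring.
        * intros p Hp. rewrite decay_0. unfold restrict.
          destruct (excluded_middle_informative (In p L0)); [ring|tauto]. }
  assert (FP_le : forall x, Cmod (F x - P 0 x) <= rho / 4).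
  { intros x. destruct FP as [b Hb]. exact (represents_bound _ _ _ _ w1 Cmod_ev_le _ _ _ _ x Hb). }
  (* A step goes from [t + h] to [t - h], so [Lam * (2 * h)] has to be at most [rho / 4]; [h <= 1]
     keeps every parameter in the range of the Lipschitz estimate. *)
  set (h := Rmin 1 (rho / (8 * (Lam + 1)))).
  assert (Hh : 0 < h) by (apply Rmin_pos; [lra|apply Rdiv_lt_0_compat; lra]).
  assert (Hh1 : h <= 1) by apply Rmin_l.
  assert (HLh : Lam * (2 * h) <= rho / 4).
  { apply Rle_trans with ((Lam + 1) * (2 * (rho / (8 * (Lam + 1))))).
    - apply Rmult_le_compat; try lra. apply Rmult_le_compat_l; [lra|apply Rmin_r].
    - apply Req_le. field. lra. }
  assert (P_shift : forall t s Hs x, P t (shift s Hs x) = P (t + s) x).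
  { intros t s Hs x. unfold P. apply csum_ext. intros p _. rewrite ev_shift, decay_plus, RtoC_mult. ring. }
  (* For [t >= 0], [P t x] is the value of [P 0] at a translated point, hence within [rho / 4] of a
     value of [F]. For [t < 0] the Lipschitz bound compares it with [P 0 x]. *)
  assert (PV : forall t x, - h <= t -> V (P t x)).
  { intros t x Ht. destruct (Rle_dec 0 t) as [Y|N].
    - exists (shift t Y x). pose proof (FP_le (shift t Y x)) as Q. rewrite P_shift, Rplus_0_l in Q. lra.
    - exists x. pose proof (FP_le x) as Q1.
      pose proof (PV_diff _ _ _ x (PLip 0 t ltac:(lra) ltac:(lra))) as Q2.
      assert (Rabs (0 - t) <= 2 * h) by (rewrite Rabs_pos_eq; lra).
      assert (Lam * Rabs (0 - t) <= Lam * (2 * h)) by (apply Rmult_le_compat_l; auto).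
      replace (F x - P t x)%C with ((F x - P 0 x) + (P 0 x - P t x))%C by ring.
      eapply Rle_lt_trans; [apply Cmod_triangle|]. lra. }
  (* The bound [B] may depend on [f] in an uncontrolled way; uniformity is recovered by [Gain],
     whose constant [K] is the same for all [t]. *)
  set (Q := fun t => forall f, holo_on U f -> exists B, inA S (fun x => f (P t x)) B).
  destruct (decay_sum_generated w gs h w_weight w_admissible HgS Hh) as [K HK].
  assert (HK0 : 0 <= K). { apply (HK nil); [constructor|intros p []]. }
  (* Absolute summability at [t] bounds the coefficients by the sup of [f], and
     the factor [decay h] makes them summable against [w] at [t + h]. *)
  assert (Gain : forall t, - h <= t -> Q t ->
     calculus_bound (nat * nat) bihalf (wt w) ev U V S (P (t + h)) K).
  { intros t Ht Hq f B Hf HB. destruct (Hq f Hf) as [B0 [b (Hb1 & Hb2 & Hb3)]].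
    assert (Hb : forall p, Cmod (b p) <= B).
    { apply (coefficient_bound b (fun x => f (P t x)) B0); auto.
      intros l Nl. eapply Rle_trans; [|exact (Hb2 l Nl)]. apply rsum_le. intros p _.
      pose proof (w1 p). pose proof (Cmod_ge_0 (b p)). nra. }
    assert (HB0 : 0 <= B). { pose proof (Hb onep). pose proof (Cmod_ge_0 (b onep)). lra. }
    exists (fun p => b p * RtoC (decay h p))%C. repeat split.
    - intros p Hp. apply Hb1. intros E. apply Hp. rewrite E. ring.
    - intros l Nl.
      set (R := fun p => if excluded_middle_informative (S p) then true else false).
      apply Rle_trans with (rsum (fun p => B * (wt w p * decay h p)) (filter R l)).
      + clear Nl. induction l as [|p l IH]; simpl; [lra|]. rewrite Cmod_mult, Cmod_R.
        pose proof (decay_pos h p). rewrite Rabs_pos_eq by lra. unfold R at 1.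
        destruct (excluded_middle_informative (S p)) as [Y|N]; simpl.
        * apply Rplus_le_compat; auto. rewrite Rmult_assoc, (Rmult_comm (decay h p)).
          apply Rmult_le_compat_r; auto. pose proof (w1 p). apply Rmult_le_pos; lra.
        * replace (b p) with (RtoC 0).
          -- rewrite Cmod_0. lra.
          -- destruct (classic (b p = 0)) as [|Nb]; auto. destruct N; auto.
      + rewrite rsum_scal, Rmult_comm. apply Rmult_le_compat_r; auto.
        apply HK; [apply NoDup_filter; auto|]. intros p Hp. apply filter_In in Hp. destruct Hp as [_ Hp].
        unfold R in Hp. destruct (excluded_middle_informative (S p)); [auto|discriminate].
    - intros x. rewrite <- (P_shift t h (Rlt_le _ _ Hh)).
      apply has_sum_ext with (2 := Hb3 (shift h (Rlt_le _ _ Hh) x)).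
      intros p. rewrite ev_shift. ring. }
  (* [Q t] gives the uniform bound at [t + h]; the perturbation from there over a distance [2 * h]
     reaches [t - h]. *)
  assert (Step : forall t, 0 <= t -> Q t -> Q (t - h)).
  { intros t Ht Hq f Hf.
    apply (in_algebra_perturbation (nat * nat) bihalf mulp onep (wt w) ev w1 wm ev_one ev_mulp Cmod_ev_le
       U V S rho S1 Sm U_open Hrho V_disc V_bounded (P (t + h)) (P (t - h)) K (Lam * Rabs (t - h - (t + h)))); auto.
    - intros x. apply PV. lra.
    - apply Gain; auto; lra.
    - apply Rmult_le_pos; auto. apply Rabs_pos.
    - replace (t - h - (t + h)) with (- (2 * h)) by ring. rewrite Rabs_Ropp, Rabs_pos_eq by lra. lra.
    - apply PLip; lra. }
  (* [q = 2 ^ (- h)]: every [p] other than the identity has [nrm p >= 2], so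
     [decay (INR N * h) p <= q ^ N]. *)
  set (q := exp (- (h * ln 2))).
  assert (Hq : 0 < q < 1).
  { split; [apply exp_pos|]. unfold q. rewrite <- exp_0. apply exp_increasing.
    pose proof ln_lt_2. assert (0 < h * ln 2) by (apply Rmult_lt_0_compat; lra). lra. }
  assert (M0 : 0 <= M). { specialize (HaM nil). simpl in HaM. apply HaM. constructor. }
  destruct (pow_lt_1_zero q ltac:(rewrite Rabs_pos_eq; lra) (rho / (4 * (M + 1)))) as [N HN].
  { apply Rdiv_lt_0_compat; lra. }
  specialize (HN N (Nat.le_refl _)). rewrite Rabs_pos_eq in HN by (apply pow_le; lra).
  (* The limit of [P t] as [t] tends to infinity, that is, the constant term of the polynomial, or 0
     if the identity is not in [L0]. *)
  set (Pinf := csum (fun p => if eq_dec_classic p onep then a p else RtoC 0) L0).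
  set (TN := INR N * h).
  assert (Far : inA S (fun x => P TN x - Pinf)%C (rho / 4)).
  { apply in_algebra_weaken with (S := S) (M := rsum (fun p =>
      Cmod (if eq_dec_classic p onep then RtoC 0 else a p * RtoC (decay TN p))%C * wt w p) L0); auto.
    - apply Rle_trans with (q ^ N * rsum (fun p => Cmod (a p) * wt w p) L0).
      + rewrite <- rsum_scal. apply rsum_le. intros p _. pose proof (w1 p). specialize (g0 p).
        assert (0 <= q ^ N) by (apply pow_le; lra).
        destruct (eq_dec_classic p onep) as [E|E].
        * rewrite Cmod_0. rewrite Rmult_0_l. apply Rmult_le_pos; auto.
        * rewrite Cmod_mult, Cmod_R, Rabs_pos_eq by (apply Rlt_le, decay_pos).
          assert (decay TN p <= q ^ N).
          { unfold decay, q, TN. rewrite <- Rpower_pow by apply exp_pos. unfold Rpower. rewrite ln_exp.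
            pose proof (nrm_ge_2 p E).
            assert (L2 : ln 2 <= ln (nrm p)) by (apply ln_le; lra).
            assert (0 <= INR N * h) by (apply Rmult_le_pos; [apply pos_INR|lra]).
            assert (X : - (INR N * h) * ln (nrm p) <= INR N * - (h * ln 2)) by nra.
            destruct X as [X|X]; [apply Rlt_le, exp_increasing; auto|rewrite X; lra]. }
          replace (Cmod (a p) * decay TN p * wt w p) with (decay TN p * (Cmod (a p) * wt w p)) by ring.
          apply Rmult_le_compat_r; auto.
      + apply Rle_trans with (rho / (4 * (M + 1)) * (M + 1)).
        * apply Rmult_le_compat; try lra; [apply pow_le; lra|apply rsum_ge_0; auto|].
          pose proof (HaM L0 N0). lra.
        * apply Req_le. field. lra.
    - eapply in_algebra_ext; [|apply Fin]. intros x. cbv beta. unfold P, Pinf.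
      rewrite (csum_ext _ (fun p => a p * RtoC (decay TN p) * ev x p
         + (-1) * (if eq_dec_classic p onep then a p else RtoC 0))%C).
      + rewrite csum_plus, csum_scal. ring.
      + intros p _. destruct (eq_dec_classic p onep) as [->|_]; [rewrite ev_one, decay_onep|]; ring. }
  (* The constant is within [rho / 4] of a value of [P TN], which is itself within [rho / 4] of a
     value of [F] at a point translated by [TN]. *)
  assert (VPinf : V Pinf).
  { assert (X0 : inH (fst (RtoC 0, RtoC 0)) /\ inH (snd (RtoC 0, RtoC 0))) by (unfold inH; simpl; lra).
    set (x := exist _ (RtoC 0, RtoC 0) X0 : bihalf).
    assert (T0 : 0 <= TN) by (apply Rmult_le_pos; [apply pos_INR|lra]).
    exists (shift TN T0 x).
    pose proof (FP_le (shift TN T0 x)) as Q1. rewrite P_shift, Rplus_0_l in Q1.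
    pose proof (PV_diff _ (fun _ => Pinf) _ x Far) as Q2.
    replace (F (shift TN T0 x) - Pinf)%C with
      ((F (shift TN T0 x) - P TN x) + (P TN x - Pinf))%C by ring.
    eapply Rle_lt_trans; [apply Cmod_triangle|]. lra. }
  assert (Base : Q TN).
  { intros f Hf.
    apply (in_algebra_perturbation (nat * nat) bihalf mulp onep (wt w) ev w1 wm ev_one ev_mulp Cmod_ev_le
       U V S rho S1 Sm U_open Hrho V_disc V_bounded (fun _ => Pinf) (P TN) (wt w onep) (rho / 4)); auto; try lra.
    - pose proof (w1 onep). lra.
    - apply calculus_bound_const; auto. exact ev_one. }
  assert (Down : forall n, (n <= N)%nat -> Q (INR (N - n) * h)).
  { induction n; intros Hn; [rewrite Nat.sub_0_r; exact Base|].
    specialize (IHn ltac:(lia)).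
    replace (INR (N - Datatypes.S n) * h) with (INR (N - n) * h - h).
    - apply Step; auto. apply Rmult_le_pos; [apply pos_INR|lra].
    - replace (N - n)%nat with (Datatypes.S (N - Datatypes.S n)) by lia. rewrite S_INR. ring. }
  assert (Q0 : Q (- h)).
  { specialize (Down N (Nat.le_refl _)). rewrite Nat.sub_diag in Down. simpl in Down.
    replace (0 * h) with 0 in Down by ring. apply Step in Down; [|lra].
    replace (0 - h) with (- h) in Down by ring. auto. }
  (* From [- h] the upgrade lands exactly at 0, which gives the uniform bound for [P 0]. *)
  apply Gain in Q0; [|lra]. replace (- h + h) with 0 in Q0 by ring.
  (* The difference [F - P 0] is supported outside the finitely many terms of the polynomial, so the
     last expansion takes place in the algebra of all of N^2. *)
  apply (in_algebra_perturbation (nat * nat) bihalf mulp onep (wt w) ev w1 wm ev_one ev_mulp Cmod_ev_le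
     U V (fun _ => True) rho I (fun _ _ _ _ => I) U_open Hrho V_disc V_bounded (P 0) F K (rho / 4)); auto; try lra.
  - intros x. apply PV. lra.
  - intros f B Hf HB. apply in_algebra_weaken with (S := S) (M := K * B); auto. lra.
Qed.

Theorem holomorphic_calculus f : holo_on U f -> exists B, inA (fun _ => True) (fun x => f (F x)) B.
Proof. destruct exists_range_margin as [rho [H1 H2]]. apply (calculus_of_margin rho); auto. Qed.

End Calculus.

(** * Dirichlet series *)

Lemma sum_n_rsum (g : nat -> R) N : sum_n g N = rsum g (seq 0 (S N)).
Proof.
  induction N.
  - rewrite sum_O. simpl. ring.
  - rewrite sum_Sn, IHN, (seq_S (S N)), rsum_app. unfold plus; simpl. ring.
Qed.

Lemma sum_n_csum (g : nat -> C) N : sum_n g N = csum g (seq 0 (S N)).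
Proof.
  induction N.
  - rewrite sum_O. simpl. ring.
  - rewrite sum_Sn, IHN, (seq_S (S N)), csum_app. change plus with Cplus. simpl. ring.
Qed.

Definition square (N : nat) : list (nat * nat) := list_prod (seq 0 (S N)) (seq 0 (S N)).

Lemma NoDup_square N : NoDup (square N).
Proof. apply NoDup_list_prod; apply seq_NoDup. Qed.

Lemma incl_square (l : list (nat * nat)) : exists N0, forall N, (N0 <= N)%nat -> incl l (square N).
Proof.
  induction l as [|[i j] l [N0 H]].
  - exists O. intros N _ x [].
  - exists (N0 + i + j)%nat. intros N HN x [<-|Hx].
    + apply in_prod; apply in_seq; lia.
    + apply H; auto. lia.
Qed.

Lemma dir_partial_square a (x : bihalf) N :
  dir_partial a (fst (proj1_sig x)) (snd (proj1_sig x)) N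
  = csum (fun p => a (S (fst p)) (S (snd p)) * ev x p)%C (square N).
Proof.
  unfold dir_partial, square. rewrite sum_n_csum, csum_list_prod. apply csum_ext. intros i _.
  rewrite sum_n_csum. apply csum_ext. intros j _. unfold ev. simpl fst; simpl snd. symmetry. apply Cmult_assoc.
Qed.

(** The terms are nonnegative, and every finite set of indices lies in a square. *)
Lemma w_summable_bounded_sums w a M : weight w ->
  (forall N, sum_n (fun i => sum_n (fun j => Cmod (a (S i) (S j)) * w (S i) (S j)) N) N <= M) <->
  bounded_sums (fun p => Cmod (a (S (fst p)) (S (snd p))) * wt w p) M.
Proof.
  intros Hw.
  assert (E : forall N, sum_n (fun i => sum_n (fun j => Cmod (a (S i) (S j)) * w (S i) (S j)) N) N =
     rsum (fun p => Cmod (a (S (fst p)) (S (snd p))) * wt w p) (square N)).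
  { intros N. unfold square. rewrite sum_n_rsum, rsum_list_prod. apply rsum_ext. intros i _.
    apply sum_n_rsum. }
  split.
  - intros H l Nl. destruct (incl_square l) as [N I]. specialize (I N (Nat.le_refl _)).
    eapply Rle_trans; [|apply (H N)]. rewrite E. apply rsum_incl; auto.
    intros p. pose proof (weight_wt_ge_1 w p Hw). apply Rmult_le_pos; [apply Cmod_ge_0|lra].
  - intros H N. rewrite E. apply H, NoDup_square.
Qed.

Lemma filterlim_C_epsilon (u : nat -> C) (l : C) :
  filterlim u eventually (@locally C_UniformSpace l) <->
  forall eps, 0 < eps -> exists N, forall n, (N <= n)%nat -> Cmod (u n - l) <= eps.
Proof.
  split.
  - intros H eps He.
    destruct (proj1 (@filterlim_locally _ C_UniformSpace eventually _ u l) H (mkposreal (eps / 2) ltac:(lra))) as [N K].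
    exists N. intros n Hn. specialize (K n Hn). apply C_NormedModule_mixin_compat2 in K. simpl in K.
    change (Cmod (u n - l) < sqrt 2 * (eps / 2)) in K.
    assert (sqrt 2 <= 2). { rewrite <- (sqrt_pow2 2) at 2 by lra. apply sqrt_le_1_alt. lra. }
    nra.
  - intros H. apply (proj2 (@filterlim_locally _ C_UniformSpace eventually _ u l)). intros eps. pose proof (cond_pos eps).
    destruct (H (eps / 2) ltac:(lra)) as [N K]. exists N. intros n Hn.
    apply C_NormedModule_mixin_compat1. change (Cmod (u n - l) < eps). specialize (K n Hn). lra.
Qed.

Lemma has_sum_square (g : nat * nat -> C) v : has_sum g v ->
  forall eps, 0 < eps -> exists N, forall n, (N <= n)%nat -> Cmod (csum g (square n) - v) <= eps.
Proof.
  intros H eps He. destruct (H eps He) as [L0 K]. destruct (incl_square L0) as [N I].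
  exists N. intros n Hn. apply K; [apply NoDup_square|auto].
Qed.

Definition on_bihalf (f : C -> C -> C) (x : bihalf) : C := f (fst (proj1_sig x)) (snd (proj1_sig x)).

(** Weighted summability dominates the terms of the series, as [w >= 1] and characters have modulus
    at most 1. The sum over finite sets therefore exists, and it equals the limit of the square
    partial sums because squares exhaust all finite sets. *)
Lemma w_abs_dirichlet_in_algebra w f : weight w ->
  w_abs_dirichlet w f <-> exists M, in_algebra (nat * nat) bihalf (wt w) ev (fun _ => True) (on_bihalf f) M.
Proof.
  intros Hw. split.
  - intros [a [[M HM] Hf]]. exists M. exists (fun p => a (S (fst p)) (S (snd p))).
    apply (w_summable_bounded_sums w a M Hw) in HM.
    repeat split; auto. intros x.
    destruct (has_sum_exists (fun p => a (S (fst p)) (S (snd p)) * ev x p)%C M) as [v Hv].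
    { apply (bounded_sums_term (nat * nat) bihalf (wt w) ev (fun p => weight_wt_ge_1 w p Hw) Cmod_ev_le
        (fun p => a (S (fst p)) (S (snd p))) (fun p => p)). auto. }
    destruct (proj2_sig x) as [H1 H2].
    pose proof (proj1 (filterlim_C_epsilon _ _) (Hf _ _ H1 H2)) as Lf.
    assert (E : Cmod (v - on_bihalf f x) = 0).
    { apply Rle_antisym; [|apply Cmod_ge_0]. apply le_epsilon. intros e He. rewrite Rplus_0_l.
      destruct (Lf (e / 2) ltac:(lra)) as [N1 K1].
      destruct (has_sum_square _ v Hv (e / 2) ltac:(lra)) as [N2 K2].
      specialize (K1 (N1 + N2)%nat ltac:(lia)). specialize (K2 (N1 + N2)%nat ltac:(lia)).
      rewrite dir_partial_square in K1. fold (on_bihalf f x) in K1.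
      set (s := csum _ (square (N1 + N2))) in *.
      replace (v - on_bihalf f x)%C with (- (s - v) + (s - on_bihalf f x))%C by ring.
      eapply Rle_trans; [apply Cmod_triangle|]. rewrite Cmod_opp. lra. }
    apply Cmod_eq_0 in E. replace (on_bihalf f x) with (v - (v - on_bihalf f x))%C by ring.
    rewrite E. replace (v - 0)%C with v by ring. auto.
  - intros [M [b (_ & HM & Hf)]]. exists (fun m n => b (pred m, pred n)). split.
    + exists M. apply (w_summable_bounded_sums w (fun m n => b (pred m, pred n)) M Hw).
      intros l Nl. eapply Rle_trans; [|exact (HM l Nl)]. apply rsum_le. intros [i j] _. simpl. lra.
    + intros s1 s2 H1 H2. set (x := exist _ (s1, s2) (conj H1 H2) : bihalf).
      apply filterlim_C_epsilon. intros eps He.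
      destruct (has_sum_square _ _ (Hf x) eps He) as [N K]. exists N. intros n Hn.
      change (Cmod (dir_partial (fun m n => b (pred m, pred n)) (fst (proj1_sig x)) (snd (proj1_sig x)) n
         - on_bihalf f x) <= eps).
      rewrite dir_partial_square.
      rewrite (csum_ext _ (fun p => b p * ev x p)%C); [auto|]. intros [i j] _. reflexivity.
Qed.

Lemma w_abs_dirichlet_holomorphic w f U phi : weight w -> admissible w -> w_abs_dirichlet w f ->
  open_C U -> (forall z, in_closure_range f z -> U z) -> holo_on U phi ->
  w_abs_dirichlet w (fun s1 s2 => phi (f s1 s2)).
Proof.
  intros Hw Ha Hf HU Hcl Hphi.
  apply (w_abs_dirichlet_in_algebra w f Hw) in Hf. destruct Hf as [M [a Hrep]].
  apply (w_abs_dirichlet_in_algebra w _ Hw).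
  apply (holomorphic_calculus w (on_bihalf f) a M U Hw Ha Hrep HU); auto.
  intros z Hz. apply Hcl. intros eps He. destruct (Hz eps He) as [z' [[x <-] Hx]].
  exists (fst (proj1_sig x)), (snd (proj1_sig x)). destruct (proj2_sig x). auto.
Qed.

Lemma has_cderiv_inv (z : C) : z <> 0 -> has_cderiv Cinv z (- (/ z * / z))%C.
Proof.
  intros Hz. assert (P : 0 < Cmod z) by (apply (proj1 (Cmod_gt_0 _)); auto).
  set (m := Cmod z) in *.
  apply has_cderiv_quadratic with (m / 2) (2 / (m * m * m)); [lra|].
  intros z' Hz'.
  assert (L : m / 2 <= Cmod z').
  { assert (T := Cmod_triangle z' (- (z' - z))).
    replace (z' + - (z' - z))%C with z in T by ring. rewrite Cmod_opp in T. fold m in T. lra. }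
  assert (N' : z' <> 0) by (apply (proj2 (Cmod_gt_0 _)); lra).
  replace (/ z' - / z - - (/ z * / z) * (z' - z))%C with ((z' - z) * (z' - z) * (/ z * / z * / z'))%C
    by (field; auto).
  rewrite !Cmod_mult, !Cmod_inv by auto. fold m.
  assert (I : / Cmod z' <= 2 / m).
  { replace (2 / m) with (/ (m / 2)) by (field; lra). apply Rinv_le_contravar; lra. }
  pose proof (Cmod_ge_0 (z' - z)).
  assert (0 < / m) by (apply Rinv_0_lt_compat; auto).
  replace (2 / (m * m * m) * Cmod (z' - z) ^ 2) with (Cmod (z' - z) * Cmod (z' - z) * (/ m * / m * (2 / m)))
    by (field; lra).
  apply Rmult_le_compat_l; [apply Rmult_le_pos; auto|]. apply Rmult_le_compat_l; auto.
  apply Rmult_le_pos; lra.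
Qed.

Theorem theorem1 (w : nat -> nat -> R) (f : C -> C -> C) :
  almost_monotone w -> w_abs_dirichlet w f ->
  (bounded_away_from_zero f ->
     exists nu, almost_monotone nu /\
       (constant_on_N2 nu <-> constant_on_N2 w) /\
       (admissible nu <-> admissible w) /\
       (forall m n, (1 <= m)%nat -> (1 <= n)%nat -> 1 <= nu m n /\ nu m n <= w m n) /\
       w_abs_dirichlet nu (fun s1 s2 => Cinv (f s1 s2))) /\
  (forall phi : C -> C, holo_near_closure_range phi f ->
     exists xi, almost_monotone xi /\
       (constant_on_N2 xi <-> constant_on_N2 w) /\
       (admissible xi <-> admissible w) /\
       (forall m n, (1 <= m)%nat -> (1 <= n)%nat -> 1 <= xi m n /\ xi m n <= w m n) /\
       w_abs_dirichlet xi (fun s1 s2 => phi (f s1 s2))).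
Proof.
  intros Hm Hf.
  pose proof (almost_monotone_admissible w Hm) as Ha. pose proof (proj1 Hm) as Hw.
  assert (Hself : forall m n, (1 <= m)%nat -> (1 <= n)%nat -> 1 <= w m n /\ w m n <= w m n).
  { intros m n H1 H2. split; [apply Hw; auto|lra]. }
  split.
  - intros (k & Hk & Hb). exists w. do 4 (split; [tauto|]).
    (* The lower bound [k] keeps 0 out of the closure of the range: otherwise some value would have
       modulus below [k]. *)
    apply w_abs_dirichlet_holomorphic with (U := fun z : C => z <> 0); auto.
    + intros z Hz. exists (Cmod z). split; [apply (proj1 (Cmod_gt_0 _)); auto|].
      intros z' Hz' E. subst z'. replace (0 - z)%C with (- z)%C in Hz' by ring.
      rewrite Cmod_opp in Hz'. lra.
    + intros z Hz E. subst z. destruct (Hz k Hk) as (s1 & s2 & H1 & H2 & H3).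
      replace (f s1 s2 - 0)%C with (f s1 s2) in H3 by ring. specialize (Hb s1 s2 H1 H2). lra.
    + intros z Hz. eexists. apply has_cderiv_inv; auto.
  - intros phi (U & HU & Hcl & Hphi). exists w. do 4 (split; [tauto|]).
    apply w_abs_dirichlet_holomorphic with (U := U); auto.
    + intros z Hz. destruct (HU z Hz) as [d Hd]. exists d. split; [apply cond_pos|].
      intros z' Hz'. apply Hd. apply C_NormedModule_mixin_compat1. exact Hz'.
    + intros z Hz. destruct (Hphi z Hz) as [l Hl]. exists l. apply is_derive_has_cderiv; auto.
Qed.
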